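(* Let $E$ be a Hermite-Biehler function such that $E'/E\in H^\infty(\mathbb{C}^+)$, and let $\nu\ge2$ be an integer. If there is a constant $C>0$ such that $$\|F\|^2_{\mathcal{H}(E^\nu)}\le C\sum_{t\in\mathcal{T}_B}\sum_{j=0}^{\nu-1}\frac{|F^{(j)}(t)|^2}{K_\nu(t,t)}$$ for all $F\in\mathcal{H}(E^\nu)$, then there is a constant $\delta>0$ such that $\varphi'(t)\ge\delta$ for all $t\in\mathcal{T}_B$.
   Context: $\mathbb{C}^+=\{z:\operatorname{Im} z>0\}$; $H^\infty(\mathbb{C}^+)$ is the space of bounded holomorphic functions on $\mathbb{C}^+$. For entire $F$, $F^*(z)=\overline{F(\overline z)}$. A Hermite-Biehler function is an entire function $E$ with $|E^*(z)|<|E(z)|$ for all $z\in\mathbb{C}^+$ (then so is $E^\nu$). A function analytic in $\mathbb{C}^+$ has bounded type if it is a quotient of two bounded analytic functions in $\mathbb{C}^+$; its mean type is $v(F)=\limsup_{y\to\infty}y^{-1}\log|F(iy)|$. The de Branges space $\mathcal{H}(E)$ is the Hilbert space of entire $F$ with $\|F\|^2_{\mathcal{H}(E)}=\int_{\mathbb{R}}|F(x)|^2|E(x)|^{-2}dx<\infty$ such that $F/E$ and $F^*/E$ have bounded type and non-positive mean type in $\mathbb{C}^+$. Its inner product is $\langle F,G\rangle_E=\int_{\mathbb{R}}F\overline{G}|E|^{-2}dx$ and its reproducing kernel $K(w,z)$ satisfies $F(w)=\langle F,K(w,\cdot)\rangle_E$; $K_\nu(w,z)$ denotes the reproducing kernel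 of $\mathcal{H}(E^\nu)$. Put $B(z)=\frac{i}{2}(E(z)-E^*(z))$ and let $\mathcal{T}_B$ be the set of real zeros of $B$. The phase $\varphi$ of $E$ is an analytic function in a neighborhood of $\mathbb{R}$ with $e^{i\varphi(x)}E(x)\in\mathbb{R}$ for all real $x$; one has $\varphi'(x)=\operatorname{Re}(iE'(x)/E(x))>0$. *)

(* Defs.v *)
From HB Require Import structures.
From mathcomp Require Export all_boot all_order all_algebra.
From mathcomp Require Export all_classical all_reals all_analysis.
From mathcomp Require Export complex.
Export Order.TTheory GRing.Theory Num.Theory.
Export numFieldNormedType.Exports.

Set Implicit Arguments.
Unset Strict Implicit.
Unset Printing Implicit Defensive.

Global Open Scope ring_scope.
Global Open Scope classical_set_scope.
Global Open Scope complex_scope.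

(* The complex numbers seen as the carrier of a numFieldType: it is this
   presentation of R[i] that carries the topology and the norm. *)
Notation Cplx R := (Num.NumField.sort (R[i] : numFieldType)).

Section HermiteBiehler.
Variable R : realType.
Local Notation C := (Cplx R).
Implicit Types (E F G f phi : C -> C) (z w : C).

(* The norm of R[i] takes its values in R[i]; this is the same real number
   as an element of R. *)
Definition cabs z : R := complex.Re `|z|.

Definition upper_half_plane : set C := [set z | 0 < complex.Im z].

Definition holomorphic_on (U : set C) f := forall z, U z -> derivable f z 1.

Definition entire f := holomorphic_on setT f.

Definition Hinfty f :=
  holomorphic_on upper_half_plane f /\
  exists M : R, forall z, upper_half_plane z -> cabs (f z) <= M.

Definition sharp F : C -> C := fun z => (F z^*)^*.

Definition fpow E (n : nat) : C -> C := fun z => E z ^+ n.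

Definition hermite_biehler E :=
  entire E /\ forall z, upper_half_plane z -> cabs (sharp E z) < cabs (E z).

Definition bounded_type f :=
  holomorphic_on upper_half_plane f /\
  exists P Q : C -> C,
    [/\ Hinfty P, Hinfty Q,
        exists2 z, upper_half_plane z & Q z != 0 &
        forall z, upper_half_plane z -> Q z != 0 -> f z = P z / Q z].

(* lne is the logarithm with values in the extended reals, so that
   log 0 = -oo and the zero function has mean type -oo. *)
Definition mean_type f : \bar R :=
  limf_esup (fun y : R => ((y^-1)%:E * lne (cabs (f (0 +i* y)))%:E)%E)
            (pinfty_nbhs R).

Definition dB_norm2 E F : \bar R :=
  (\int[lebesgue_measure]_(x in setT)
     (cabs (F x%:C) ^+ 2 / cabs (E x%:C) ^+ 2)%:E)%E.

Definition bounded_type_nonpos_mean_type f :=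
  bounded_type f /\ (mean_type f <= 0)%E.

Definition dB_space E : set (C -> C) :=
  [set F | [/\ entire F,
               (dB_norm2 E F < +oo)%E,
               bounded_type_nonpos_mean_type (fun z => F z / E z) &
               bounded_type_nonpos_mean_type (fun z => sharp F z / E z)]].

Definition dB_inner E F G : C :=
  let h (x : R) : C := F x%:C * (G x%:C)^* * ((cabs (E x%:C) ^+ 2)^-1)%:C in
  (Rintegral lebesgue_measure setT (fun x => complex.Re (h x)))
  +i* (Rintegral lebesgue_measure setT (fun x => complex.Im (h x))).

(* K w is K(w, .), as a function of the second variable. *)
Definition is_reproducing_kernel E (K : C -> C -> C) :=
  forall w, dB_space E (K w) /\
            forall F, dB_space E F -> F w = dB_inner E F (K w).

Definition companionB E : C -> C := fun z => 'i / 2 * (E z - sharp E z).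

Definition real_zeros f : set R := [set t | f t%:C = 0].

Definition cexp z : C :=
  (expR (complex.Re z))%:C * (cos (complex.Im z) +i* sin (complex.Im z)).

(* phi takes real values on the real line, as a phase; without this only the
   real part of phi would be determined by the last condition. *)
Definition is_phase E phi :=
  (exists U : set C, [/\ open U, forall x : R, U x%:C & holomorphic_on U phi]) /\
  forall x : R, phi x%:C \is Num.real /\
                cexp ('i * phi x%:C) * E x%:C \is Num.real.

End HermiteBiehler.

(* Main.v *)
Require Import Defs.
From mathcomp Require Import measurable_realfun ring lra.

(* Let t be a zero of B, G = B / (z - t), n = nu - 1 and A = (E + E^* ) / 2. The
   function B^n G vanishes to order n at t and to order n + 1 at every other
   zero of B, so only its n-th derivative at t enters the sampling sum; the
   kernel at t is bounded from below by testing it against E^n G. This gives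
   ||B^n G||^2 <= const U phi'(t)^(2n) for every bound U of ||E^n G||^2. Since
   |B / E| = |sin phi| is Lipschitz, U can be chosen independently of t.

   If phi'(t) is small, take rho = kappa / phi'(t) with a small constant kappa.
   If A has a zero s with |s - t| <= rho, then |B / E| = 1 at s and ||B^n G||^2
   is at least const / rho^2, which is too large. Otherwise B / A is analytic in
   the disc of radius rho around t, with imaginary part of the sign of
   Im z, and Cauchy's formula shows that it is comparable to phi'(t) |x - t|
   for real x with |x - t| <= rho / 2; now U = const / rho is allowed while
   ||B^n G||^2 >= const kappa^(2n+2) / rho, which bounds phi'(t) from below. *)

(** The power of phi'(t) comes from counting factors of B'(t) = phi'(t) E(t). The surviving term of
    the sampling sum is |n! B'(t)^(n+1)|^2 / K(t,t), and E^n G takes the value E(t)^n B'(t) at t; so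
    |E(t)| cancels and 2n of the 2n + 2 factors phi'(t) remain. This is where nu >= 2 enters: for n
    = 0 the bound would not involve phi'(t) at all.

    The obstacle is that a small phi'(t) says nothing by itself about phi' nearby. On the real line
    B / A = tan phi, and it is the sign of its imaginary part off the line that transfers the speed
    at t to a whole interval of length comparable to 1 / phi'(t). A pole of B / A blocks this
    argument, whence the two cases. If A has a zero close to t and n = 1, both sides are of order
    phi'(t)^2 and only the smallness of kappa decides; kappa is therefore fixed before phi'(t) is
    known.

    The hypothesis on E'/E concerns the open half-plane while the norms live on the real line.
    Passing to the boundary uses that E' is continuous, which, like the analyticity of G, rests on
    Cauchy's formula. *)

Set Implicit Arguments.
Unset Strict Implicit.
Unset Printing Implicit Defensive.

(** * Complex modulus and derivative *)

Section ComplexModulus.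
Variable R : realType.
Local Notation C := (Cplx R).
Implicit Types z w : C.

Lemma cabsE z : (cabs z)%:C = `|z|.
Proof. by rewrite /cabs RRe_real ?normr_real. Qed.

Lemma cabs_lt z (x : R) : (cabs z < x) = (`|z| < x%:C :> C).
Proof. by rewrite -cabsE ltcR. Qed.

Lemma cabs_ge0 z : 0 <= cabs z.
Proof. by rewrite -ler0c cabsE. Qed.

Lemma cabs0 : cabs (0 : C) = 0.
Proof. by rewrite /cabs normr0. Qed.

Lemma cabs_i : cabs ('i : C) = 1.
Proof. by rewrite /cabs normc_def /= expr0n add0r expr1n sqrtr1. Qed.

Lemma cabs_eq0 z : (cabs z == 0) = (z == 0).
Proof. by rewrite -(inj_eq (@complexI R)) cabsE normr_eq0. Qed.

Lemma cabs_gt0 z : (0 < cabs z) = (z != 0).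
Proof. by rewrite lt0r cabs_ge0 andbT cabs_eq0. Qed.

Lemma cabsM z w : cabs (z * w) = cabs z * cabs w.
Proof. by apply: (@complexI R); rewrite rmorphM /= !cabsE normrM. Qed.

Lemma cabsV z : cabs z^-1 = (cabs z)^-1.
Proof. by apply: (@complexI R); rewrite fmorphV /= !cabsE normfV. Qed.

Lemma cabsX z n : cabs (z ^+ n) = cabs z ^+ n.
Proof. by apply: (@complexI R); rewrite rmorphXn /= !cabsE normrX. Qed.

Lemma cabsN z : cabs (- z) = cabs z.
Proof. by rewrite /cabs normrN. Qed.

Lemma cabs_distC z w : cabs (z - w) = cabs (w - z).
Proof. by rewrite -cabsN opprB. Qed.

Lemma cabsD z w : cabs (z + w) <= cabs z + cabs w.
Proof. by rewrite -lecR rmorphD /= !cabsE ler_normD. Qed.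

Lemma cabsB z w : cabs (z - w) <= cabs z + cabs w.
Proof. by rewrite -(cabsN w) cabsD. Qed.

Lemma cabs_real (x : R) : cabs (x%:C : C) = `|x|.
Proof. by rewrite /cabs normc_def /= expr0n addr0 sqrtr_sqr. Qed.

Lemma cabs_conj z : cabs z^* = cabs z.
Proof. by rewrite /cabs normcJ. Qed.

Lemma sqr_cabs z : cabs z ^+ 2 = complex.Re z ^+ 2 + complex.Im z ^+ 2.
Proof. by apply: (@complexI R); rewrite rmorphXn /= cabsE -add_Re2_Im2. Qed.

Lemma Re_cabs z : `|complex.Re z| <= cabs z.
Proof. by rewrite -lecR cabsE normc_ge_Re. Qed.

Lemma Im_cabs z : `|complex.Im z| <= cabs z.
Proof.
by rewrite -(ler_pXn2r (n := 2)) ?nnegrE ?cabs_ge0// sqr_cabs real_normK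
  ?num_real// lerDr sqr_ge0.
Qed.

Lemma cabs_le_ReIm z : cabs z <= `|complex.Re z| + `|complex.Im z|.
Proof.
rewrite [X in cabs X <= _](complexE z) (le_trans (cabsD _ _))// cabsM !cabs_real.
by rewrite cabs_i mul1r.
Qed.

End ComplexModulus.

Section ComplexTopology.
Variable R : realType.
Local Notation C := (Cplx R).
Implicit Types z w : C.

(** A positive element of [R[i]] is real, so the complex-valued radii of the topology of [C] can be
    traded for radii in [R]. *)
Lemma cvgCP (T : Type) (F : set_system T) {FF : Filter F} (f : T -> C) (l : C) :
  f @ F --> l <-> forall e : R, 0 < e -> \forall x \near F, cabs (f x - l) < e.
Proof.
split=> [/cvgrPdist_lt fl e e0|fl].
  have := fl e%:C; rewrite ltcR => /(_ e0); apply: filterS => x.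
  by rewrite -cabs_lt cabs_distC.
apply/cvgrPdist_lt => e e0.
have er : e = (complex.Re e)%:C by rewrite RRe_real// gtr0_real.
have {}e0 : 0 < complex.Re e by rewrite -ltcR -er.
by have := fl _ e0; apply: filterS => x; rewrite cabs_lt -er distrC.
Qed.

Lemma cvg_cabs (T : Type) (F : set_system T) {FF : Filter F} (f : T -> C) (l : C) :
  f @ F --> l -> (fun x => cabs (f x)) @ F --> cabs l.
Proof.
move=> /cvgCP fl; apply/cvgrPdist_lt => e e0; have := fl _ e0.
apply: filterS => x; apply: le_lt_trans; rewrite ler_norml.
have := cabsD (l - f x) (f x); have := cabsD (f x - l) l.
rewrite !subrK (cabs_distC l) => h1 h2; apply/andP; split; lra.
Qed.

Lemma cvg_Re (T : Type) (F : set_system T) {FF : Filter F} (f : T -> C) (l : C) :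
  f @ F --> l -> (fun x => complex.Re (f x)) @ F --> complex.Re l.
Proof.
move=> /cvgCP fl; apply/cvgrPdist_lt => e e0; have := fl _ e0.
apply: filterS => x; apply: le_lt_trans; rewrite distrC.
by rewrite -raddfB Re_cabs.
Qed.

Lemma cvg_Im (T : Type) (F : set_system T) {FF : Filter F} (f : T -> C) (l : C) :
  f @ F --> l -> (fun x => complex.Im (f x)) @ F --> complex.Im l.
Proof.
move=> /cvgCP fl; apply/cvgrPdist_lt => e e0; have := fl _ e0.
apply: filterS => x; apply: le_lt_trans; rewrite distrC.
by rewrite -raddfB Im_cabs.
Qed.

Lemma cvg_ReIm (T : Type) (F : set_system T) {FF : Filter F} (f : T -> C) (l : C) :
  (fun x => complex.Re (f x)) @ F --> complex.Re l ->
  (fun x => complex.Im (f x)) @ F --> complex.Im l -> f @ F --> l.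
Proof.
move=> /cvgrPdist_lt fr /cvgrPdist_lt fi; apply/cvgCP => e e0.
have e2 : 0 < e / 2 by rewrite divr_gt0.
apply: filterS2 (fr _ e2) (fi _ e2) => x xr xi.
rewrite (le_lt_trans (cabs_le_ReIm _))// !raddfB /= (splitr e).
by rewrite ltrD// distrC.
Qed.

Lemma cvg_real (T : Type) (F : set_system T) {FF : Filter F} (f : T -> R) (l : R) :
  f @ F --> l -> (fun x => (f x)%:C : C) @ F --> (l%:C : C).
Proof. by move=> fl; apply: cvg_ReIm => //=; exact: cvg_cst. Qed.

Lemma cvg_conj (T : Type) (F : set_system T) {FF : Filter F} (f : T -> C) (l : C) :
  f @ F --> l -> (fun x => (f x)^* : C) @ F --> (l^* : C).
Proof.
move=> /cvgCP fl; apply/cvgCP => e e0; have := fl _ e0.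
by apply: filterS => x; rewrite -rmorphB cabs_conj.
Qed.

Lemma continuousCP (f : C -> C) z : {for z, continuous f} <->
  forall e : R, 0 < e -> exists2 d : R, 0 < d &
    forall w, cabs (w - z) < d -> cabs (f w - f z) < e.
Proof.
split=> [/cvgCP fz e e0|fz].
  have /nbhs_ballP[d /= d0 dfe] := fz _ e0.
  have dr : d = (complex.Re d)%:C by rewrite RRe_real// gtr0_real.
  exists (complex.Re d); first by rewrite -ltcR -dr.
  move=> w; rewrite cabs_lt -dr => zw; apply: dfe => /=.
  by rewrite -ball_normE /ball_ /= distrC.
suff: f @ z --> f z by [].
apply: (cvgCP (FF := nbhs_filter z) f (f z)).2 => e e0.
have [d d0 dfe] := fz _ e0.
apply/nbhs_ballP; exists d%:C => /=; first by rewrite ltcR.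
move=> w zw; apply: dfe; rewrite cabs_lt distrC.
by move: zw; rewrite -ball_normE.
Qed.

(** Remainder form, without division: the point [w = z] is not excluded, and such estimates can be
    added, conjugated or restricted to a line. *)
Lemma is_deriveCP (f : C -> C) z d : is_derive z 1 f d <->
  forall e : R, 0 < e -> exists2 r : R, 0 < r &
    forall w, cabs (w - z) < r ->
      cabs (f w - f z - d * (w - z)) <= e * cabs (w - z).
Proof.
split=> [[df <-] e e0|fz].
  have /cvgCP /(_ _ e0) := df.
  move=> /nbhs_ballP[r /= r0 dfe].
  have rr : r = (complex.Re r)%:C by rewrite RRe_real// gtr0_real.
  exists (complex.Re r); first by rewrite -ltcR -rr.
  move=> w wr; have [->|wz] := eqVneq w z.
    by rewrite !subrr mulr0 subr0 cabs0 mulr0.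
  have wz0 : w - z != 0 by rewrite subr_eq0.
  have := dfe (w - z); rewrite /ball /= sub0r normrN.
  rewrite rr -cabs_lt => /(_ wr wz0).
  rewrite /= /GRing.scale /= mulr1 subrK.
  set q := _ * _ => qe.
  rewrite -(divfK wz0 (f w - f z)) -mulrBl cabsM ler_wpM2r ?cabs_ge0//.
  by rewrite ltW// [_ / _]mulrC.
have cv : (fun h : C => h^-1 *: (f (h *: 1 + z) - f z)) @ 0^' --> d.
  apply/cvgCP => e e0; have e2 : 0 < e / 2 by rewrite divr_gt0.
  have [r r0 re] := fz _ e2.
  apply/nbhs_ballP; exists r%:C => /=; first by rewrite ltcR.
  move=> h; rewrite -ball_normE /ball_ /= sub0r normrN -cabs_lt => hr h0.
  have := re (h + z); rewrite addrK /GRing.scale /= mulr1 => /(_ hr) H.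
  rewrite -(ltr_pM2r (x := cabs h)) ?cabs_gt0// -cabsM mulrBl.
  rewrite mulrAC mulVf// mul1r (le_lt_trans H)//.
  by rewrite ltr_pM2r ?cabs_gt0//; lra.
by split; [apply/cvg_ex; exists d | exact/cvg_lim].
Qed.

End ComplexTopology.

(** * Integrals of continuous functions *)

Section Primitive.
Variable R : realType.
Implicit Types (f g F G : R -> R) (a b c x : R).

Lemma is_derive_increment F g a b : a <= b ->
  (forall x, a <= x <= b -> is_derive x 1 F (g x)) ->
  exists2 c, a <= c <= b & F b - F a = g c * (b - a).
Proof.
move=> ab dF.
have [x /andP[ax xb]|x|c] := @MVT_segment R F g a b ab.
- by apply: dF; rewrite !ltW.
- apply: derivable_within_continuous => y; rewrite in_itv /= => /dF dy.
  by have [] := dy.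
- by rewrite in_itv /= => cab E; exists c.
Qed.

Lemma is_derive_continuous F x d : is_derive x 1 F d -> {for x, continuous F}.
Proof. by case=> /derivable1_diffP /differentiable_continuous. Qed.

Lemma is_derive_integral_above g u x : continuous g -> u < x ->
  is_derive x 1 (fun y : R => \int[lebesgue_measure]_(t in `[u, y]) g t) (g x).
Proof.
move=> cg ux.
have gi : lebesgue_measure.-integrable `[u, x + 1] (EFin \o g).
  apply: continuous_compact_integrable; first exact: segment_compact.
  exact: continuous_subspaceT.
have x1 : x < x + 1 by rewrite ltrDl.
have [d1 d2] := continuous_FTC1_closed x1 gi ux (cg x).
by rewrite -d2 derive1E; exact: derivableP.
Qed.

(** An integral with variable upper limit gives a primitive only to the right of its base point. Two
    are glued: the integral from -1, for x > -1, and its mirror image through [h], for x < 1. *)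
Lemma ex_primitive g : continuous g ->
  exists G, forall x, is_derive x 1 G (g x).
Proof.
move=> cg.
pose h := fun x => g (- x).
have ch : continuous h by move=> x; apply: continuous_comp; [exact: opp_continuous|exact: cg].
pose P (k : R -> R) (y : R) := \int[lebesgue_measure]_(t in `[-1, y]) k t.
have dP : forall x, -1 < x -> is_derive x 1 (P g) (g x).
  by move=> x x1; exact: is_derive_integral_above.
have dQ : forall x, x < 1 -> is_derive x 1 (fun y => - P h (- y)) (g x).
  move=> x x1.
  have d1 : is_derive (- x) 1 (P h) (h (- x)).
    by apply: is_derive_integral_above => //; rewrite ltrN2.
  have := is_derive1_comp d1 (is_deriveNid x 1).
  move=> /is_deriveN; rewrite mulrN1 opprK /h opprK.
  exact.
(* The sum is the integral of [g] from -1 to x plus that from x to 1, hence constant on the overlap;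
   this makes the two branches of [G] agree. *)
have E : forall x, -1 < x -> x < 1 -> P g x + P h (- x) = P g 0 + P h 0.
  have dS : forall x, -1 < x -> x < 1 ->
      is_derive x 1 (P g \- (fun y => - P h (- y))) 0.
    move=> x x1 x2; have := is_deriveB (dP x x1) (dQ x x2).
    by rewrite subrr.
  move=> x x1 x2.
  have [x0|x0] := lerP 0 x.
    have [|c _] := @is_derive_increment (P g \- (fun y => - P h (- y))) (cst 0) 0 x x0.
      by move=> y /andP[y1 y2]; apply: dS; lra.
    by rewrite mul0r /= oppr0 !opprK => /eqP; rewrite subr_eq0 => /eqP.
  have [|c _] := @is_derive_increment (P g \- (fun y => - P h (- y))) (cst 0) x 0 (ltW x0).
    by move=> y /andP[y1 y2]; apply: dS; lra.
  by rewrite mul0r /= oppr0 !opprK => /eqP; rewrite subr_eq0 => /eqP.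
pose G x := if 0 < x then P g x - P g 0 else P h 0 - P h (- x).
have GP x : -1 < x -> P g x - P g 0 = G x.
  rewrite /G; have [//|x0] := ltrP 0 x => x1.
  by have := E x x1 (le_lt_trans x0 ltr01); lra.
have GQ x : x < 0 -> - P h (- x) + P h 0 = G x.
  by rewrite /G; have [x0|_] := ltrP 0 x => x1; lra.
exists G => x; have [x0|x0] := ltrP x 0.
  apply: (@near_eq_is_derive _ _ _ (fun y => - P h (- y) + P h 0)).
    by near=> y; apply: GQ; near: y; exact: lt_nbhsl.
  by rewrite -[g x]addr0; apply: is_deriveD; apply: dQ; lra.
apply: (@near_eq_is_derive _ _ _ (fun y => P g y - P g 0)).
  by near=> y; apply: GP; near: y; apply: lt_nbhsr; lra.
by rewrite -[g x]subr0; apply: is_deriveB; apply: dP; lra.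
Unshelve. all: by end_near. Qed.

Definition primitive g : R -> R := xget (cst 0) [set G | forall x, is_derive x 1 G (g x)].

Lemma is_derive_primitive g x : continuous g -> is_derive x 1 (primitive g) (g x).
Proof.
move=> /ex_primitive[G dG]; rewrite /primitive.
by case: xgetP => [F _ /(_ x)//|/(_ G)].
Qed.

(* Oriented integral, of continuous integrands only: it needs no hypothesis
   [a <= b] to be additive in the interval. *)
Definition oint a b g := primitive g b - primitive g a.

Lemma ointE a b g G : (forall x, is_derive x 1 G (g x)) -> continuous g ->
  oint a b g = G b - G a.
Proof.
move=> dG cg.
have d0 x : is_derive x 1 (primitive g \- G) 0.
  by have := is_deriveB (is_derive_primitive x cg) (dG x); rewrite subrr.
have := @is_derive_0_is_cst R _ a b d0; rewrite /oint /=; lra.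
Qed.

Lemma oint_cst a b k : oint a b (fun=> k) = k * (b - a).
Proof.
have dG x : is_derive x 1 ( *%R k) k.
  have := is_deriveZ k (is_derive_id x (1 : R)).
  by rewrite /GRing.scale /= mulr1.
by rewrite (ointE _ _ dG) ?mulrBr// => x; exact: cvg_cst.
Qed.

Lemma oint_split a b c g : oint a b g + oint b c g = oint a c g.
Proof. by rewrite /oint; lra. Qed.

Lemma ointD a b f g : continuous f -> continuous g ->
  oint a b (f \+ g) = oint a b f + oint a b g.
Proof.
move=> cf cg.
have dS x : is_derive x 1 (primitive f \+ primitive g) ((f \+ g) x).
  by apply: is_deriveD; exact: is_derive_primitive.
rewrite (ointE _ _ dS); first by rewrite /oint /=; lra.
by move=> x; apply: cvgD; [exact: cf|exact: cg].
Qed.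

Lemma ointZ a b k f : continuous f ->
  oint a b (fun x => k * f x) = k * oint a b f.
Proof.
move=> cf.
have dS x : is_derive x 1 (k \*: primitive f) (k * f x).
  by apply: is_deriveZ; exact: is_derive_primitive.
rewrite (ointE _ _ dS); first by rewrite /oint /= /GRing.scale /= mulrBr.
by move=> x; apply: cvgMr; exact: cf.
Qed.

Lemma ointB a b f g : continuous f -> continuous g ->
  oint a b (f \- g) = oint a b f - oint a b g.
Proof.
move=> cf cg; rewrite -[oint a b g]mul1r -mulNr -ointZ// -ointD//.
  by congr oint; apply/funext => x /=; rewrite mulN1r.
by move=> x; apply: cvgMr; exact: cg.
Qed.

Lemma oint_le_bound a b f M : a <= b -> continuous f ->
  (forall x, a <= x <= b -> f x <= M) -> oint a b f <= M * (b - a).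
Proof.
move=> ab cf fM; rewrite /oint.
have [x _|c cab E] := @is_derive_increment (primitive f) f a b ab.
  exact: is_derive_primitive.
by rewrite E ler_wpM2r ?fM// subr_ge0.
Qed.

Lemma oint_abs_bound a b f M : a <= b -> continuous f ->
  (forall x, a <= x <= b -> `|f x| <= M) -> `|oint a b f| <= M * (b - a).
Proof.
move=> ab cf fM; rewrite /oint.
have [x _|c cab] := @is_derive_increment (primitive f) f a b ab.
  exact: is_derive_primitive.
move=> ->; rewrite normrM [`|b - a|]ger0_norm ?subr_ge0//.
by rewrite ler_wpM2r ?fM// subr_ge0.
Qed.

Lemma le_oint a b f g : a <= b -> continuous f -> continuous g ->
  (forall x, a <= x <= b -> f x <= g x) -> oint a b f <= oint a b g.
Proof.
move=> ab cf cg fg; rewrite -subr_le0 -ointB//.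
rewrite (le_trans (@oint_le_bound a b _ 0 ab _ _)) ?mul0r//.
  by move=> x; apply: cvgB; [exact: cf|exact: cg].
by move=> x /fg; rewrite /= subr_le0.
Qed.

Lemma oint_gt0 a b c f : a < c < b -> continuous f ->
  (forall x, a <= x <= b -> 0 <= f x) -> 0 < f c -> 0 < oint a b f.
Proof.
move=> /andP[ac cb] cf f0 fc.
have [d d0 dc] : exists2 d, 0 < d & forall x, `|x - c| <= d -> f c / 2 <= f x.
  have /cvgrPdist_lt /(_ (f c / 2)) := cf c.
  rewrite divr_gt0// => /(_ isT) /nbhs_ballP[d /= d0 df].
  exists (d / 2); first by rewrite divr_gt0.
  move=> x xd; have := df x; rewrite /= -ball_normE /ball_ /= distrC => H.
  have /H : `|x - c| < d by lra.
  by rewrite ltr_norml; lra.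
pose u := Num.max a (c - d); pose v := Num.min b (c + d).
have ua : a <= u by rewrite le_max lexx.
have vb : v <= b by rewrite ge_min lexx.
have uc : u < c by rewrite gt_max ac; lra.
have cv : c < v by rewrite lt_min cb; lra.
have ud : c - d <= u by rewrite le_max lexx orbT.
have vd : v <= c + d by rewrite ge_min lexx orbT.
have int0 x y : a <= x -> x <= y -> y <= b -> 0 <= oint x y f.
  move=> ax xy yb; have [z _|z /andP[z1 z2]] := @is_derive_increment (primitive f) f x y xy.
    exact: is_derive_primitive.
  by rewrite /oint => ->; rewrite mulr_ge0 ?subr_ge0// f0//; lra.
rewrite -(oint_split _ u) -(oint_split u v b).
rewrite ltr_wpDl ?int0//; first lra.
rewrite ltr_pwDl ?int0//; last lra.
have [z _|z /andP[z1 z2]] := @is_derive_increment (primitive f) f u v (ltW (lt_trans uc cv)).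
  exact: is_derive_primitive.
rewrite /oint => ->; rewrite mulr_gt0 ?subr_gt0 ?(lt_trans uc)//.
by apply: lt_le_trans (dc z _); [rewrite divr_gt0|rewrite ler_norml; lra].
Qed.

End Primitive.

(** * Cauchy's formula on a circle *)

Section Green.
Variable R : realType.
Implicit Types (a b x y : R).

Lemma nested_intervals (a w : nat -> R) : (forall n, 0 <= w n) ->
  (forall n, a n <= a n.+1) -> (forall n, a n.+1 + w n.+1 <= a n + w n) ->
  exists c, forall n, a n <= c <= a n + w n.
Proof.
move=> w0 ai bd.
have am m n : (m <= n)%N -> a m <= a n.
  by move=> mn; apply: (homo_leq (r := <=%R)) mn => //; exact: le_trans.
have bm m n : (m <= n)%N -> a n + w n <= a m + w m.
  move=> /subnKC <-; elim: (n - m)%N => [|i IH]; first by rewrite addn0.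
  by rewrite addnS (le_trans (bd _)).
have ab m n : a m <= a n + w n.
  rewrite (le_trans (am _ _ (leq_maxl m n)))//.
  by rewrite (le_trans _ (bm _ _ (leq_maxr m n)))// lerDl.
have ub n : ubound (range a) (a n + w n) by move=> _ [m _ <-]; exact: ab.
have hs : has_sup (range a).
  by split; [exists (a 0); exists 0|exists (a 0 + w 0); exact: ub].
exists (sup (range a)) => n; apply/andP; split.
  by apply: ub_le_sup; [exact: hs.2|exists n].
by apply: ge_sup; [exact: hs.1|exact: ub].
Qed.

Variables (p q : R -> R -> R) (x1 y1 dx dy : R).
Hypotheses (dx0 : 0 < dx) (dy0 : 0 < dy).
Hypothesis pc : forall y, continuous (p^~ y).
Hypothesis qc : forall x, continuous (q x).
Hypothesis closed_form : forall x0 y0,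
  x1 <= x0 <= x1 + dx -> y1 <= y0 <= y1 + dy ->
  exists c, forall e : R, 0 < e -> exists2 d : R, 0 < d & forall x y,
    x1 <= x <= x1 + dx -> y1 <= y <= y1 + dy ->
    `|x - x0| < d -> `|y - y0| < d ->
    `|p x y - p x y0 - c * (y - y0)| <= e * (`|x - x0| + `|y - y0|) /\
    `|q x y - q x0 y - c * (x - x0)| <= e * (`|x - x0| + `|y - y0|).

(* Circulation of p dx + q dy around the rectangle [a, a'] x [b, b']. *)
Let circ a b a' b' : R :=
  oint a a' (p^~ b) + oint b b' (q a') - oint a a' (p^~ b') - oint b b' (q a).

Let circ_quarter a b a' b' m n :
  circ a b a' b' = circ a b m n + circ m b a' n + circ a n m b' + circ m n a' b'.
Proof. rewrite /circ /oint; lra. Qed.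

Let h n := dx / 2 ^+ n.
Let k n := dy / 2 ^+ n.
Let hS n : h n = h n.+1 + h n.+1.
Proof. by rewrite /h exprS; field; rewrite expf_neq0. Qed.
Let kS n : k n = k n.+1 + k n.+1.
Proof. by rewrite /k exprS; field; rewrite expf_neq0. Qed.
Let h0 n : 0 < h n. Proof. by rewrite divr_gt0// exprn_gt0. Qed.
Let k0 n : 0 < k n. Proof. by rewrite divr_gt0// exprn_gt0. Qed.

(* u is the lower left corner of a rectangle of the n-th bisection. *)
Let bad e n (u : R * R) : Prop :=
  e * (h n * k n) < `|circ u.1 u.2 (u.1 + h n) (u.2 + k n)|.

(** The circulation is additive over the four quarters while the area, hence the threshold, divides
    exactly by four: some quarter is again bad. The implication stands under the existential so that
    choice yields a total step function. *)
Let bad_step e n (u : R * R) : exists v : R * R, bad e n u ->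
  [/\ bad e n.+1 v, u.1 <= v.1, v.1 + h n.+1 <= u.1 + h n,
     u.2 <= v.2 & v.2 + k n.+1 <= u.2 + k n].
Proof.
have [B|?] := pselect (bad e n u); last by exists u.
have := h0 n.+1; have := k0 n.+1 => k1 h1; have hn := hS n; have kn := kS n.
pose a := u.1; pose b := u.2; pose a' := a + h n.+1; pose b' := b + k n.+1.
suff [B1|[B1|[B1|B1]]] : bad e n.+1 (a, b) \/ bad e n.+1 (a', b) \/
   bad e n.+1 (a, b') \/ bad e n.+1 (a', b').
- by exists (a, b) => _; split => //=; rewrite /a' /b' /a /b; lra.
- by exists (a', b) => _; split => //=; rewrite /a' /b' /a /b; lra.
- by exists (a, b') => _; split => //=; rewrite /a' /b' /a /b; lra.
- by exists (a', b') => _; split => //=; rewrite /a' /b' /a /b; lra.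
apply: contrapT => /not_orP[B1 /not_orP[B2 /not_orP[B3 B4]]].
move: B1 B2 B3 B4 B; rewrite /bad /= => /negP + /negP + /negP + /negP.
rewrite -!leNgt -/a -/b -/a' -/b' => B1 B2 B3 B4.
rewrite (circ_quarter a b _ _ a' b').
have -> : a + h n = a' + h n.+1 by rewrite hS addrA.
have -> : b + k n = b' + k n.+1 by rewrite kS addrA.
rewrite hS kS ltNge => /negP; apply.
apply: le_trans (ler_normD _ _) _; apply: le_trans (lerD (ler_normD _ _) (lexx _)) _.
apply: le_trans (lerD (lerD (ler_normD _ _) (lexx _)) (lexx _)) _.
have -> : e * ((h n.+1 + h n.+1) * (k n.+1 + k n.+1)) =
  e * (h n.+1 * k n.+1) + e * (h n.+1 * k n.+1) + e * (h n.+1 * k n.+1)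
  + e * (h n.+1 * k n.+1) by ring.
by rewrite !lerD.
Qed.

Let circ_small (e : R) : 0 < e -> `|circ x1 y1 (x1 + dx) (y1 + dy)| <= e * (dx * dy).
Proof.
move=> e0; rewrite leNgt; apply/negP => B0.
pose step n u := projT1 (cid (@bad_step e n u)).
have stepP n u := projT2 (cid (@bad_step e n u)).
pose fix us n := if n is m.+1 then step m (us m) else (x1, y1).
have badus n : bad e n (us n).
  elim: n => [|n /stepP[]//]; by rewrite /bad /h /k /= expr0 !divr1.
have us_step n := stepP n (us n) (badus n).
have [x0 x0P] : exists c, forall n, (us n).1 <= c <= (us n).1 + h n.
  apply: nested_intervals => n; [exact: ltW|by case: (us_step n)|by case: (us_step n)].
have [y0 y0P] : exists c, forall n, (us n).2 <= c <= (us n).2 + k n.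
  apply: nested_intervals => n; [exact: ltW|by case: (us_step n)|by case: (us_step n)].
have us1 n : x1 <= (us n).1 /\ (us n).1 + h n <= x1 + dx.
  elim: n => [|n [i1 i2]]; first by rewrite /h expr0 divr1.
  by have [_ j1 j2 _ _] := us_step n; split; [apply: le_trans j1|apply: le_trans i2].
have us2 n : y1 <= (us n).2 /\ (us n).2 + k n <= y1 + dy.
  elim: n => [|n [i1 i2]]; first by rewrite /k expr0 divr1.
  by have [_ _ _ j1 j2] := us_step n; split; [apply: le_trans j1|apply: le_trans i2].
have [c cP] : exists c, forall e : R, 0 < e -> exists2 d : R, 0 < d & forall x y,
    x1 <= x <= x1 + dx -> y1 <= y <= y1 + dy ->
    `|x - x0| < d -> `|y - y0| < d ->
    `|p x y - p x y0 - c * (y - y0)| <= e * (`|x - x0| + `|y - y0|) /\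
    `|q x y - q x0 y - c * (x - x0)| <= e * (`|x - x0| + `|y - y0|).
  have := x0P 0; have := y0P 0; rewrite /h /k expr0 !divr1 /=.
  by move=> hy hx; exact: closed_form.
(* All rectangles of the bisection are similar, so [(H + K)^2] is a fixed multiple of the area; [e']
   is set so that the total error [2 e' (H + K)^2] is exactly [e H K]. *)
pose e' : R := e * (dx * dy) / (2 * (dx + dy) ^+ 2).
have e'0 : 0 < e'.
  by rewrite divr_gt0 ?mulr_gt0// ?exprn_gt0// addr_gt0.
have [d d0 dP] := cP _ e'0.
have [n nd] : exists n, h n + k n < d.
  exists (Num.trunc ((dx + dy) / d)).+1.
  rewrite /h /k -mulrDl ltr_pdivrMr ?exprn_gt0// mulrC -ltr_pdivrMr//.
  apply: lt_trans (truncnS_gt _) _.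
  by rewrite -natrX ltr_nat ltn_expl.
have := badus n; rewrite /bad; set a := (us n).1; set b := (us n).2.
have [a1 a2] := us1 n; have [b1 b2] := us2 n.
have /andP[ax xa] := x0P n; have /andP[by_ yb] := y0P n.
rewrite -/a -/b in a1 a2 b1 b2 ax xa by_ yb.
have := h0 n; have := k0 n; set H := h n; set K := k n => K0 H0.
rewrite -/H -/K in a2 b2 xa yb nd.
have Hd : H < d by apply: lt_trans nd; rewrite ltrDl.
have Kd : K < d by apply: lt_trans nd; rewrite ltrDr.
have in_x x : a <= x <= a + H -> x1 <= x <= x1 + dx.
  by move=> /andP[h1 h2]; rewrite (le_trans a1 h1) (le_trans h2 a2).
have in_y y : b <= y <= b + K -> y1 <= y <= y1 + dy.
  by move=> /andP[h1 h2]; rewrite (le_trans b1 h1) (le_trans h2 b2).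
have near_x x : a <= x <= a + H -> `|x - x0| <= H by rewrite ler_norml; lra.
have near_y y : b <= y <= b + K -> `|y - y0| <= K by rewrite ler_norml; lra.
have dPP x y : a <= x <= a + H -> b <= y <= b + K ->
    `|p x y - p x y0 - c * (y - y0)| <= e' * (H + K) /\
    `|q x y - q x0 y - c * (x - x0)| <= e' * (H + K).
  move=> hx hy; have hx' := near_x _ hx; have hy' := near_y _ hy.
  have [i1 i2] := dP x y (in_x _ hx) (in_y _ hy) (le_lt_trans hx' Hd) (le_lt_trans hy' Kd).
  have le : e' * (`|x - x0| + `|y - y0|) <= e' * (H + K).
    by rewrite ler_wpM2l ?(ltW e'0)// lerD.
  by split; apply: le_trans le.
have aH : a <= a + H by rewrite lerDl ltW.
have bK : b <= b + K by rewrite lerDl ltW.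
(* Opposite sides are subtracted pointwise. The term [p x y0] cancels, leaving [- c K] along the
   horizontal sides; [I2] leaves [c H] along the vertical ones, and the two main terms [c H K]
   cancel in the circulation. *)
have I1 : `|oint a (a + H) (p^~ b \- p^~ (b + K)) - c * (- K) * H|
   <= 2 * e' * (H + K) * H.
  pose g (_ : R) : R := c * - K.
  have cg : continuous g by move=> ?; exact: cvg_cst.
  have cpp : continuous (p^~ b \- p^~ (b + K)).
    by move=> x; apply: cvgB; exact: pc.
  have -> : c * - K * H = oint a (a + H) g.
    rewrite oint_cst; ring.
  rewrite -ointB//.
  have -> : 2 * e' * (H + K) * H = 2 * e' * (H + K) * (a + H - a) by ring.
  apply: oint_abs_bound => //.
    by move=> x; apply: cvgB; [exact: cpp|exact: cg].
  move=> x hx /=; rewrite /g.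
  have [|i1 _] := dPP x b hx; first by rewrite lexx.
  have [|i2 _] := dPP x (b + K) hx; first by rewrite lexx andbT.
  have -> : p x b - p x (b + K) - c * - K =
    (p x b - p x y0 - c * (b - y0)) - (p x (b + K) - p x y0 - c * (b + K - y0)) by ring.
  by rewrite (le_trans (ler_normB _ _))//; lra.
have I2 : `|oint b (b + K) (q (a + H) \- q a) - c * H * K|
   <= 2 * e' * (H + K) * K.
  pose g (_ : R) : R := c * H.
  have cg : continuous g by move=> ?; exact: cvg_cst.
  have cpp : continuous (q (a + H) \- q a).
    by move=> x; apply: cvgB; exact: qc.
  have -> : c * H * K = oint b (b + K) g.
    rewrite oint_cst; ring.
  rewrite -ointB//.
  have -> : 2 * e' * (H + K) * K = 2 * e' * (H + K) * (b + K - b) by ring.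
  apply: oint_abs_bound => //.
    by move=> x; apply: cvgB; [exact: cpp|exact: cg].
  move=> y hy /=; rewrite /g.
  have [|_ i1] := dPP a y _ hy; first by rewrite lexx.
  have [|_ i2] := dPP (a + H) y _ hy; first by rewrite lexx andbT.
  have -> : q (a + H) y - q a y - c * H =
    (q (a + H) y - q x0 y - c * (a + H - x0)) - (q a y - q x0 y - c * (a - x0)) by ring.
  by rewrite (le_trans (ler_normB _ _))//; lra.
apply/negP; rewrite -leNgt.
have -> : circ a b (a + H) (b + K) =
  (oint a (a + H) (p^~ b \- p^~ (b + K)) - c * (- K) * H) +
  (oint b (b + K) (q (a + H) \- q a) - c * H * K).
  by rewrite /circ ointB ?ointB//; ring.
rewrite (le_trans (ler_normD _ _))// (le_trans (lerD I1 I2))//.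
have -> : 2 * e' * (H + K) * H + 2 * e' * (H + K) * K = 2 * e' * (H + K) ^+ 2 by ring.
rewrite le_eqVlt; apply/orP; left; apply/eqP.
rewrite /e' /H /K /h /k; field.
by rewrite expf_neq0//= gt_eqF// addr_gt0.
Qed.

(* Goursat's bisection. [closed_form] says that p dx + q dy is closed without
   differentiating p in x or q in y: only the mixed first order terms agree. *)
Lemma green_goursat :
  oint x1 (x1 + dx) (p^~ y1) + oint y1 (y1 + dy) (q (x1 + dx)) =
  oint x1 (x1 + dx) (p^~ (y1 + dy)) + oint y1 (y1 + dy) (q x1).
Proof.
suff : circ x1 y1 (x1 + dx) (y1 + dy) = 0 by rewrite /circ; lra.
apply/eqP; rewrite -normr_le0; apply/ler_addgt0Pl => e e0; rewrite addr0.
have := @circ_small (e / (dx * dy)); rewrite divfK ?mulf_neq0 ?gt_eqF//; apply.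
by rewrite divr_gt0// mulr_gt0.
Qed.

End Green.

Section ComplexIntegral.
Variable R : realType.
Local Notation C := (Cplx R).
Implicit Types (f g : R -> C) (a b : R).

Definition cint a b g : C :=
  oint a b (fun x => complex.Re (g x)) +i* oint a b (fun x => complex.Im (g x)).

Lemma continuous_Re g : continuous g -> continuous (fun x => complex.Re (g x)).
Proof. by move=> cg x; apply: cvg_Re; exact: cg. Qed.

Lemma continuous_Im g : continuous g -> continuous (fun x => complex.Im (g x)).
Proof. by move=> cg x; apply: cvg_Im; exact: cg. Qed.

Lemma eq_cint a b f g : f =1 g -> cint a b f = cint a b g.
Proof. by move=> /funext ->. Qed.

Lemma cintD a b f g : continuous f -> continuous g ->
  cint a b (fun x => f x + g x) = cint a b f + cint a b g.
Proof.
move=> cf cg; apply/eqP; rewrite eq_complex /=; apply/andP; split; apply/eqP.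
- transitivity (oint a b ((fun x => complex.Re (f x)) \+ (fun x => complex.Re (g x)))).
    by congr oint; apply/funext => x /=; rewrite raddfD.
  exact: (ointD a b (continuous_Re cf) (continuous_Re cg)).
- transitivity (oint a b ((fun x => complex.Im (f x)) \+ (fun x => complex.Im (g x)))).
    by congr oint; apply/funext => x /=; rewrite raddfD.
  exact: (ointD a b (continuous_Im cf) (continuous_Im cg)).
Qed.

Lemma cintZ a b (k : C) f : continuous f ->
  cint a b (fun x => k * f x) = k * cint a b f.
Proof.
move=> cf; have cR := continuous_Re cf; have cI := continuous_Im cf.
have cZ (l : R) (u : R -> R) : continuous u -> continuous (fun x : R => l * u x).
  by move=> cu x; apply: cvgMr; exact: cu.
apply/eqP; rewrite eq_complex; apply/andP; split; apply/eqP.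
- transitivity (oint a b ((fun x => complex.Re k * complex.Re (f x))
      \- (fun x => complex.Im k * complex.Im (f x)))).
    by congr oint; apply/funext => x /=; case: k (f x) => [? ?] [? ?].
  by rewrite ointB ?ointZ//; [case: k|exact: cZ|exact: cZ].
- transitivity (oint a b ((fun x => complex.Re k * complex.Im (f x))
      \+ (fun x => complex.Im k * complex.Re (f x)))).
    by congr oint; apply/funext => x /=; case: k (f x) => [? ?] [? ?].
  by rewrite ointD ?ointZ//; [case: k|exact: cZ|exact: cZ].
Qed.

Lemma cintB a b f g : continuous f -> continuous g ->
  cint a b (fun x => f x - g x) = cint a b f - cint a b g.
Proof.
move=> cf cg; transitivity (cint a b (fun x => f x + -1 * g x)).
  by apply: eq_cint => x; rewrite mulN1r.
have cN : continuous (fun x => -1 * g x) by move=> x; apply: cvgMr; exact: cg.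
by rewrite (cintD a b cf cN) (cintZ a b (-1) cg) mulN1r.
Qed.

Lemma cint_conj a b f : continuous f ->
  cint a b (fun x => (f x)^*) = (cint a b f)^*.
Proof.
move=> cf; apply/eqP; rewrite eq_complex; apply/andP; split; apply/eqP => /=.
  by congr oint; apply/funext => x /=; case: (f x).
rewrite -[RHS]mulN1r -ointZ; last exact: continuous_Im.
by congr oint; apply/funext => x /=; rewrite mulN1r; case: (f x).
Qed.

Lemma cint_cst a b (k : C) : cint a b (fun=> k) = k * (b - a)%:C.
Proof.
apply/eqP; rewrite eq_complex /cint !oint_cst; case: k => ? ? /=.
by rewrite !mulr0 subr0 add0r !eqxx.
Qed.

(* The factor 2 comes from bounding the two parts separately. *)
Lemma cint_bound a b f (M : R) : a <= b -> continuous f ->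
  (forall x, a <= x <= b -> cabs (f x) <= M) ->
  cabs (cint a b f) <= 2 * M * (b - a).
Proof.
move=> ab cf fM; rewrite (le_trans (cabs_le_ReIm _))// -mulrA mulr_natl mulr2n.
rewrite lerD//; apply: oint_abs_bound => //; try exact: continuous_Re;
  try exact: continuous_Im.
- by move=> x /fM; apply: le_trans; exact: Re_cabs.
- by move=> x /fM; apply: le_trans; exact: Im_cabs.
Qed.

Lemma green_goursat_complex (p q : R -> R -> C) (x1 y1 dx dy : R) :
  0 < dx -> 0 < dy ->
  (forall y, continuous (p^~ y)) -> (forall x, continuous (q x)) ->
  (forall x0 y0, x1 <= x0 <= x1 + dx -> y1 <= y0 <= y1 + dy ->
    exists c : C, forall e : R, 0 < e -> exists2 d : R, 0 < d & forall x y,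
    x1 <= x <= x1 + dx -> y1 <= y <= y1 + dy ->
    `|x - x0| < d -> `|y - y0| < d ->
    cabs (p x y - p x y0 - c * (y - y0)%:C) <= e * (`|x - x0| + `|y - y0|) /\
    cabs (q x y - q x0 y - c * (x - x0)%:C) <= e * (`|x - x0| + `|y - y0|)) ->
  cint x1 (x1 + dx) (p^~ y1) + cint y1 (y1 + dy) (q (x1 + dx)) =
  cint x1 (x1 + dx) (p^~ (y1 + dy)) + cint y1 (y1 + dy) (q x1).
Proof.
move=> dx0 dy0 pc qc cf.
have ReM (k : C) (l : R) : complex.Re (k * l%:C) = complex.Re k * l.
  by case: k => ? ? /=; rewrite mulr0 subr0.
have ImM (k : C) (l : R) : complex.Im (k * l%:C) = complex.Im k * l.
  by case: k => ? ? /=; rewrite mulr0 add0r.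
apply/eqP; rewrite eq_complex; apply/andP; split; apply/eqP => /=.
- apply: (green_goursat (p := fun x y => complex.Re (p x y))
    (q := fun x y => complex.Re (q x y))) => //.
  + by move=> y; exact: continuous_Re.
  + by move=> x; exact: continuous_Re.
  move=> x0 y0 hx hy; have [c cP] := cf x0 y0 hx hy.
  exists (complex.Re c) => e e0; have [d d0 dP] := cP e e0.
  exists d => // x y hx' hy' xd yd; have [i1 i2] := dP x y hx' hy' xd yd.
  by split; [apply: le_trans i1|apply: le_trans i2];
    rewrite -ReM -!raddfB Re_cabs.
- apply: (green_goursat (p := fun x y => complex.Im (p x y))
    (q := fun x y => complex.Im (q x y))) => //.
  + by move=> y; exact: continuous_Im.
  + by move=> x; exact: continuous_Im.
  move=> x0 y0 hx hy; have [c cP] := cf x0 y0 hx hy.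
  exists (complex.Im c) => e e0; have [d d0 dP] := cP e e0.
  exists d => // x y hx' hy' xd yd; have [i1 i2] := dP x y hx' hy' xd yd.
  by split; [apply: le_trans i1|apply: le_trans i2];
    rewrite -ImM -!raddfB Im_cabs.
Qed.

End ComplexIntegral.

Section UnitCircle.
Variable R : realType.
Local Notation C := (Cplx R).

Lemma is_deriveRP (f : R -> R) (x d : R) : is_derive x 1 f d ->
  forall e : R, 0 < e -> exists2 r : R, 0 < r &
    forall y, `|y - x| < r -> `|f y - f x - d * (y - x)| <= e * `|y - x|.
Proof.
move=> [df <-] e e0.
have /cvgrPdist_lt /(_ _ e0) := df.
move=> /nbhs_ballP[r /= r0 dfe]; exists r => // y yr.
have [->|yx] := eqVneq y x; first by rewrite !subrr mulr0 subr0 normr0 mulr0.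
have yx0 : y - x != 0 by rewrite subr_eq0.
have := dfe (y - x); rewrite /ball /= sub0r normrN => /(_ yr yx0).
rewrite /= /GRing.scale /= mulr1 subrK.
set q := _ * _ => qe.
rewrite -(divfK yx0 (f y - f x)) -mulrBl normrM ler_wpM2r//.
by rewrite ltW// [_ / _]mulrC distrC.
Qed.

Definition circle_pt (x : R) : C := cos x +i* sin x.

Lemma cabs_circle_pt x : cabs (circle_pt x) = 1.
Proof. by rewrite /cabs normc_def /= cos2Dsin2 sqrtr1. Qed.

Lemma circle_pt_neq0 x : circle_pt x != 0.
Proof. by rewrite -cabs_gt0 cabs_circle_pt. Qed.

Lemma circle_pt_conj x : (circle_pt x)^* = (circle_pt x)^-1.
Proof.
apply: (mulIf (circle_pt_neq0 x)); rewrite mulVf ?circle_pt_neq0// mulrC.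
apply/eqP; rewrite eq_complex /=; apply/andP; split; apply/eqP; last by ring.
by rewrite -[RHS](cos2Dsin2 x); ring.
Qed.

Lemma circle_pt0 : circle_pt 0 = 1.
Proof. by rewrite /circle_pt cos0 sin0. Qed.

Lemma circle_pt2pi : circle_pt (2 * pi) = 1.
Proof. by rewrite /circle_pt mulr_natl cos2pi sin2pi. Qed.

Lemma continuous_circle_pt : continuous circle_pt.
Proof.
by move=> x; apply: cvg_ReIm => /=; [exact: continuous_cos|exact: continuous_sin].
Qed.

Lemma circle_pt_derive x (e : R) : 0 < e -> exists2 d : R, 0 < d &
  forall y, `|y - x| < d ->
    cabs (circle_pt y - circle_pt x - 'i * circle_pt x * (y - x)%:C)
    <= e * `|y - x|.
Proof.
move=> e0; have e2 : 0 < e / 2 by rewrite divr_gt0.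
have [d1 d10 h1] := is_deriveRP (is_derive_cos x) e2.
have [d2 d20 h2] := is_deriveRP (is_derive_sin x) e2.
exists (Num.min d1 d2); first by rewrite lt_min d10.
move=> y; rewrite lt_min => /andP[/h1 i1 /h2 i2].
rewrite (le_trans (cabs_le_ReIm _))// [e]splitr mulrDl /=.
apply: lerD.
- apply: le_trans i1; rewrite le_eqVlt; apply/orP; left; apply/eqP.
  by congr (`| _ |); ring.
- apply: le_trans i2; rewrite le_eqVlt; apply/orP; left; apply/eqP.
  by congr (`| _ |); ring.
Qed.

End UnitCircle.

Section CauchyFormula.
Variable R : realType.
Local Notation C := (Cplx R).
Implicit Types (f : C -> C).

Lemma derivable_cvg f (z : C) : derivable f z 1 -> {for z, continuous f}.
Proof. by move=> /derivable1_diffP /differentiable_continuous. Qed.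

Section Homotopy.
Variables (f : C -> C) (c w : C) (r : R).
Hypotheses (r0 : 0 < r) (wr : cabs w < r).
Hypothesis df : forall z, cabs (z - c) <= r -> derivable f z 1.

Let k1 (x : R) : C := r%:C * circle_pt x - w.
Let k (x : R) : C := r%:C * circle_pt x / k1 x.
(* Contraction of the circle of centre c onto its interior point c + w. The
   pullback of f dz / (z - c - w) is the closed form p ds + q dx below. *)
Let z (s x : R) : C := c + w + s%:C * k1 x.

Let cabs_re x : cabs (r%:C * circle_pt x : C) = r.
Proof. by rewrite cabsM cabs_real cabs_circle_pt mulr1 gtr0_norm. Qed.

Let k1_ge x : r - cabs w <= cabs (k1 x).
Proof. by have := cabsD (k1 x) w; rewrite /k1 subrK cabs_re; lra. Qed.

Let k1_le x : cabs (k1 x) <= 2 * r.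
Proof. by have := cabsB (r%:C * circle_pt x) w; rewrite -/(k1 x) cabs_re; have := wr; lra. Qed.

Let k1_neq0 x : k1 x != 0.
Proof. by rewrite -cabs_gt0; have := k1_ge x; have := wr; lra. Qed.

Let k_le x : cabs (k x) <= r / (r - cabs w).
Proof.
have h1 : 0 < cabs (k1 x) by rewrite cabs_gt0.
have h2 : 0 < r - cabs w by rewrite subr_gt0.
by rewrite cabsM cabsV cabs_re ler_pM2l// lef_pV2 ?posrE.
Qed.

Let k1_cont : continuous k1.
Proof.
move=> x; apply: cvgB; last exact: cvg_cst.
by apply: cvgMr; exact: continuous_circle_pt.
Qed.

Let k_cont : continuous k.
Proof.
move=> x; apply: cvgM.
  by apply: cvgMr; exact: continuous_circle_pt.
by apply: cvgV; [exact: k1_neq0|exact: k1_cont].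
Qed.

Let z_disc (s x : R) : 0 <= s <= 1 -> cabs (z s x - c) <= r.
Proof.
move=> /andP[s0 s1].
have -> : z s x - c = (1 - s)%:C * w + s%:C * (r%:C * circle_pt x).
  by rewrite /z /k1 rmorphB rmorph1; ring.
rewrite (le_trans (cabsD _ _))// !cabsM cabs_circle_pt !cabs_real mulr1.
rewrite !ger0_norm ?(ltW r0)// ?subr_ge0//.
have : (1 - s) * cabs w <= (1 - s) * r by rewrite ler_wpM2l ?subr_ge0// ltW.
by lra.
Qed.

Let fz_cont (s : R) : 0 <= s <= 1 -> continuous (fun x => f (z s x)).
Proof.
move=> s01 x; apply: (@cvg_comp _ _ _ (z s) f _ (nbhs (z s x))).
  apply: cvgD; first exact: cvg_cst.
  by apply: cvgMr; exact: k1_cont.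
exact: derivable_cvg (df (z_disc x s01)).
Qed.

Section Clamped.
Variable s1 : R.
Hypothesis s1P : 0 < s1 < 1.

(* [s] is clamped to [s1, 1] so that p and q are continuous on all of R. *)
Let cl (s : R) : R := Num.max s1 (Num.min 1 s).

Let cl_id s : s1 <= s <= 1 -> cl s = s.
Proof. by move=> /andP[h1 h2]; rewrite /cl min_r// max_r. Qed.

Let cl_itv s : s1 <= cl s <= 1.
Proof. by rewrite /cl le_max lexx ge_max ge_min lexx/= andbT; have := s1P; lra. Qed.

Let cl01 s : 0 <= cl s <= 1.
Proof. by have := cl_itv s; have := s1P; lra. Qed.

Let cl_cont : continuous cl.
Proof.
move=> x; apply: continuous_max; first exact: cvg_cst.
by apply: continuous_min; [exact: cvg_cst|exact: cvg_id].
Qed.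

(** Along [z s x] one has [dz = k1 ds + i s r e^(ix) dx] and [z - c - w = s k1]; the quotient is
    [ds / s + i k dx]. *)
Let p s x : C := f (z (cl s) x) / (cl s)%:C.
Let q s x : C := f (z (cl s) x) * ('i * k x).

Let p_cont x : continuous (p^~ x).
Proof.
move=> s; apply: cvgM.
  apply: (@cvg_comp _ _ _ (fun s => z (cl s) x) f _ (nbhs (z (cl s) x))).
    apply: cvgD; first exact: cvg_cst.
    by apply: cvgMl; apply: cvg_real; exact: cl_cont.
  exact: derivable_cvg (df (z_disc x (cl01 s))).
apply: cvgV; last by apply: cvg_real; exact: cl_cont.
by rewrite -cabs_gt0 cabs_real gtr0_norm; have := cl_itv s; have := s1P; lra.
Qed.

Let q_cont s : continuous (q s).
Proof.
move=> x; apply: cvgM; first exact: (fz_cont (cl01 s)).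
by apply: cvgMr; exact: k_cont.
Qed.

(** Both mixed derivatives [dp/dx] and [dq/ds] equal [f'(z) i r e^(ix)]: the factor s of [dz/dx]
    cancels against [1/s], and [k1 = dz/ds] against the denominator of [k]. *)
Let pq_closed (s0 x0 : R) : s1 <= s0 <= 1 ->
  exists b : C, forall e : R, 0 < e -> exists2 d : R, 0 < d & forall s x,
    s1 <= s <= 1 -> `|s - s0| < d -> `|x - x0| < d ->
    cabs (p s x - p s x0 - b * (x - x0)%:C) <= e * (`|s - s0| + `|x - x0|) /\
    cabs (q s x - q s0 x - b * (s - s0)%:C) <= e * (`|s - s0| + `|x - x0|).
Proof.
move=> s0P; have s1P' := s1P; have r0' := r0; have wr' := wr; pose z0 := z s0 x0.
have s001 : 0 <= s0 <= 1 by lra.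
have /derivableP := df (z_disc x0 s001); rewrite -/z0; set D := 'D_1 f z0.
move=> /is_deriveCP dfz.
exists (D * r%:C * 'i * circle_pt x0) => e e0.
pose m := r - cabs w; have m0 : 0 < m by rewrite subr_gt0.
pose Dr := cabs D * r; have Dr0 : 0 <= Dr by rewrite mulr_ge0 ?cabs_ge0// ltW.
(* The remainder of [f] is divided by [s >= s1] in [p] and multiplied by [|k| <= r / m] in [q]; with
   this [e1] either costs at most half of [e]. *)
pose e1 := e / (8 * r * (s1^-1 + r / m)).
have s10 : 0 < s1 by lra.
have den0 : 0 < 8 * r * (s1^-1 + r / m).
  by rewrite !mulr_gt0// addr_gt0 ?invr_gt0// divr_gt0.
have e10 : 0 < e1 by rewrite divr_gt0.
have e1P : 4 * e1 * r / s1 + 4 * e1 * r * (r / m) = e / 2.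
  by rewrite /e1; field; rewrite !gt_eqF//= addr_gt0// mulr_gt0.
have t1 : 0 <= 4 * e1 * r := mulr_ge0 (mulr_ge0 (ler0n _ 4) (ltW e10)) (ltW r0').
have e1a : 4 * e1 * r / s1 <= e / 2.
  by rewrite -e1P lerDl (mulr_ge0 t1)// divr_ge0// ltW.
have e1b : 4 * e1 * r * (r / m) <= e / 2.
  by rewrite -e1P lerDr (mulr_ge0 t1)// invr_ge0 ltW.
have [d1 d10 fP] := dfz _ e10.
(* [e2] pays for the remainder of [circle_pt] in [p], and [e2 <= 1] yields the increment bound
   [cx2]. The last term of [d] below absorbs the second order product of the increments of s and x
   in [q]. *)
pose e2 := Num.min 1 (e / (2 * (Dr + 1))).
have e20 : 0 < e2 by rewrite lt_min ltr01 divr_gt0// mulr_gt0//; lra.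
have e2a : e2 <= 1 by rewrite ge_min lexx.
have e2b : Dr * e2 <= e / 2.
  have : e2 <= e / (2 * (Dr + 1)) by rewrite ge_min lexx orbT.
  rewrite ler_pdivlMr ?mulr_gt0//; last lra.
  by move: (ltW e20); nra.
have [d2 d20 cP] := circle_pt_derive x0 e20.
pose d := Num.min (d1 / (4 * r)) (Num.min d2 (e / (4 * (Dr + 1)))).
have d0 : 0 < d by rewrite !lt_min d20 !divr_gt0// mulr_gt0//; lra.
exists d => // s x sP sd xd.
have sp : 0 < s by have /andP[h1 _] := sP; exact: lt_le_trans s10 h1.
have s0p : 0 < s0 by have /andP[h1 _] := s0P; exact: lt_le_trans s10 h1.
have s01 : 0 <= s <= 1 by have /andP[_ h2] := sP; rewrite h2 ltW.
move: sd xd; set S := `|s - s0|; set X := `|x - x0| => sd xd.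
have S0 : 0 <= S by exact: normr_ge0.
have X0 : 0 <= X by exact: normr_ge0.
have dd1 : d <= d1 / (4 * r) by rewrite ge_min lexx.
have dd2 : d <= d2 by rewrite !ge_min lexx orbT.
have dd3 : d <= e / (4 * (Dr + 1)) by rewrite !ge_min lexx !orbT.
have dr : 4 * r * d <= d1 by rewrite mulrC -ler_pdivlMr ?mulr_gt0.
have xd2 : X < d2 := lt_le_trans xd dd2.
have cx := cP x xd2.
have cx2 : cabs (circle_pt x - circle_pt x0) <= 2 * X.
  have := cabsD (circle_pt x - circle_pt x0 - 'i * circle_pt x0 * (x - x0)%:C)
    ('i * circle_pt x0 * (x - x0)%:C).
  rewrite subrK => /le_trans; apply.
  rewrite !cabsM cabs_circle_pt cabs_real.
  have -> : cabs ('i : C) = 1 := cabs_i R.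
  rewrite !mul1r -/X; rewrite -/X in cx; have : e2 * X <= 1 * X by rewrite ler_wpM2r.
  by lra.
have dz : forall u y, s1 <= u <= 1 -> `|u - s0| <= S -> `|y - x0| <= X ->
    cabs (circle_pt y - circle_pt x0) <= 2 * X ->
    cabs (f (z u y) - f z0 - D * (z u y - z0)) <= e1 * (2 * r * (S + X)).
  move=> u y uP uS yX cy.
  have zz : cabs (z u y - z0) <= 2 * r * (S + X).
    have -> : z u y - z0 = (u - s0)%:C * k1 y +
        s0%:C * (r%:C * (circle_pt y - circle_pt x0)).
      by rewrite /z0 /z /k1 rmorphB; ring.
    rewrite (le_trans (cabsD _ _))// !cabsM !cabs_real.
    rewrite (gtr0_norm r0) (gtr0_norm s0p).
    have h1 : `|u - s0| * cabs (k1 y) <= S * (2 * r).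
      by rewrite ler_pM ?cabs_ge0 ?k1_le.
    have h2 : s0 * (r * cabs (circle_pt y - circle_pt x0)) <= 1 * (r * (2 * X)).
      rewrite ler_pM ?(ltW s0p) ?mulr_ge0 ?cabs_ge0 ?(ltW r0)//.
        by case/andP: s0P.
      by rewrite (ler_pM2l r0').
    apply: le_trans (lerD h1 h2) _.
    by rewrite le_eqVlt; apply/orP; left; apply/eqP; ring.
  rewrite (le_trans (fP _ _)) ?ler_wpM2l ?(ltW e10)//.
  rewrite (le_lt_trans zz)// (lt_le_trans _ dr)//.
  have -> : 4 * r * d = 2 * r * (d + d) by ring.
  by rewrite (ltr_pM2l (mulr_gt0 (ltr0n _ 2) r0')) ltrD.
have zx := dz s x sP (lexx _) (lexx _) cx2.
have zx0 : cabs (f (z s x0) - f z0 - D * (z s x0 - z0)) <= e1 * (2 * r * (S + X)).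
  apply: dz => //; first by rewrite subrr normr0.
  by rewrite subrr cabs0 mulr_ge0.
have zs0 : cabs (f (z s0 x) - f z0 - D * (z s0 x - z0)) <= e1 * (2 * r * (S + X)).
  by apply: dz => //; rewrite subrr normr0.
have SX0 : 0 <= S + X by rewrite addr_ge0.
split.
- have -> : p s x - p s x0 - D * r%:C * 'i * circle_pt x0 * (x - x0)%:C =
    ((f (z s x) - f z0 - D * (z s x - z0)) -
     (f (z s x0) - f z0 - D * (z s x0 - z0))) / s%:C +
    D * r%:C * (circle_pt x - circle_pt x0 - 'i * circle_pt x0 * (x - x0)%:C).
    rewrite /p cl_id// /z /k1; field.
    by rewrite -cabs_gt0 cabs_real gtr0_norm.
  rewrite (le_trans (cabsD _ _))// !cabsM cabsV !cabs_real (gtr0_norm r0) -/Dr.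
  rewrite (gtr0_norm sp).
  rewrite [e in leRHS]splitr mulrDl lerD//; last first.
    rewrite (le_trans (ler_wpM2l Dr0 cx))// mulrA.
    by rewrite -/X (ler_pM (mulr_ge0 Dr0 (ltW e20)) X0 e2b)// lerDr.
  apply: le_trans (ler_wpM2r SX0 e1a).
  apply: (@le_trans _ _ ((4 * e1 * r * (S + X)) / s1)); last first.
    by rewrite le_eqVlt; apply/orP; left; apply/eqP; ring.
  have ss1 : s^-1 <= s1^-1 by rewrite lef_pV2 ?posrE//; case/andP: sP.
  rewrite (ler_pM _ _ _ ss1) ?cabs_ge0 ?invr_ge0 ?(ltW sp)//.
  rewrite (le_trans (cabsB _ _))// (le_trans (lerD zx zx0))//.
  by rewrite le_eqVlt; apply/orP; left; apply/eqP; ring.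
- have k1k : k1 x * k x = r%:C * circle_pt x.
    by rewrite /k mulrCA mulfV ?mulr1.
  have -> : q s x - q s0 x - D * r%:C * 'i * circle_pt x0 * (s - s0)%:C =
    ((f (z s x) - f z0 - D * (z s x - z0)) -
     (f (z s0 x) - f z0 - D * (z s0 x - z0))) * ('i * k x) +
    D * r%:C * 'i * (s - s0)%:C * (circle_pt x - circle_pt x0).
    rewrite /q cl_id// cl_id//.
    have -> : D * r%:C * 'i * (s - s0)%:C * (circle_pt x - circle_pt x0) =
      D * 'i * (s - s0)%:C * (k1 x * k x) - D * r%:C * 'i * (s - s0)%:C * circle_pt x0.
      by rewrite k1k; ring.
    by rewrite /z rmorphB; ring.
  move: (k x) (k_le x) => K Kle.
  have ci : cabs ('i : C) = 1 := cabs_i R.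
  rewrite (le_trans (cabsD _ _))// !cabsM !cabs_real (gtr0_norm r0) -/Dr ci !mul1r mulr1.
  rewrite -/S [e in leRHS]splitr mulrDl lerD//; last first.
    have h : Dr * d <= e / 4.
      move: dd3; rewrite ler_pdivlMr; last by rewrite mulr_gt0// ltr_wpDl.
      move=> h; rewrite ler_pdivlMr//; apply: le_trans h.
      have -> : d * (4 * (Dr + 1)) = Dr * d * 4 + d * 4 by ring.
      by rewrite lerDl mulr_ge0// ltW.
    rewrite (@le_trans _ _ (Dr * S * (2 * X)))//.
      by rewrite ler_wpM2l// mulr_ge0.
    have : Dr * X <= Dr * d by rewrite ler_wpM2l// ltW.
    move=> h'; have h3 : Dr * X * S <= e / 4 * S by rewrite ler_wpM2r// (le_trans h').
    have h4 : 0 <= e * X by rewrite mulr_ge0// ltW.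
    have -> : Dr * S * (2 * X) = 2 * (Dr * X * S) by ring.
    have -> : e / 2 * (S + X) = 2 * (e / 4 * S) + e * X / 2 by field.
    apply: le_trans (lerD (_ : _ <= 2 * (e / 4 * S)) (_ : 0 <= e * X / 2)).
    - by rewrite addr0.
    - by rewrite ler_pM2l.
    - by rewrite divr_ge0.
  apply: le_trans (ler_wpM2r SX0 e1b).
  apply: (@le_trans _ _ ((4 * e1 * r * (S + X)) * (r / m))); last first.
    by rewrite le_eqVlt; apply/orP; left; apply/eqP; ring.
  rewrite ler_pM ?cabs_ge0//.
  rewrite (le_trans (cabsB _ _))// (le_trans (lerD zx zs0))//.
  by rewrite le_eqVlt; apply/orP; left; apply/eqP; ring.
Qed.

(** Green's identity on the rectangle [s1, 1] x [0, 2 pi]: the sides x = 0 and x = 2 pi carry the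
    same integrand by periodicity and cancel. *)
Lemma circle_homotopy :
  cint 0 (2 * pi) (fun x => f (z s1 x) * ('i * k x)) =
  cint 0 (2 * pi) (fun x => f (z 1 x) * ('i * k x)).
Proof.
have s1P' := s1P; have ds : 0 < 1 - s1 by lra.
have dp : 0 < 2 * pi :> R by rewrite mulr_gt0// pi_gt0.
have := green_goursat_complex (x1 := s1) (y1 := 0) ds dp p_cont q_cont.
rewrite add0r addrC subrK => G.
have : forall s0 x0 : R, s1 <= s0 <= 1 -> 0 <= x0 <= 2 * pi ->
  exists b : C, forall e : R, 0 < e -> exists2 d : R, 0 < d & forall s x,
    s1 <= s <= 1 -> 0 <= x <= 2 * pi -> `|s - s0| < d -> `|x - x0| < d ->
    cabs (p s x - p s x0 - b * (x - x0)%:C) <= e * (`|s - s0| + `|x - x0|) /\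
    cabs (q s x - q s0 x - b * (s - s0)%:C) <= e * (`|s - s0| + `|x - x0|).
  move=> s0 x0 s0P _; have [b bP] := pq_closed x0 s0P.
  exists b => e e0; have [d d0 dP] := bP e e0.
  by exists d => // s x sP _; exact: dP.
move=> /G.
have -> : p^~ (2 * pi) = p^~ 0.
  by apply/funext => s; rewrite /p /z /k1 circle_pt0 circle_pt2pi.
by move=> /addrI; rewrite /q !cl_id//; lra.
Qed.

End Clamped.

(** By [circle_homotopy] the left side may be computed with an arbitrarily small [s] in place of 1;
    the contracted circle then lies where [f] is within [e'] of [f (c + w)]. *)
Lemma circle_homotopy_limit :
  cint 0 (2 * pi) (fun x => f (z 1 x) * ('i * k x)) =
  f (c + w) * cint 0 (2 * pi) (fun x => 'i * k x).
Proof.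
have ck : continuous (fun x => 'i * k x : C).
  by move=> x; apply: cvgMr; exact: k_cont.
have cfk s : 0 <= s <= 1 -> continuous (fun x => f (z s x) * ('i * k x)).
  by move=> s01 x; apply: cvgM; [exact: fz_cont|exact: ck].
have cfk2 : continuous (fun x => f (c + w) * ('i * k x)).
  by move=> x; apply: cvgMr; exact: ck.
apply/eqP; rewrite -subr_eq0 -cabs_eq0 -normr_le0; apply/ler_addgt0Pl => e e0.
rewrite addr0 ger0_norm ?cabs_ge0//.
have pi0 : 0 < pi :> R by exact: pi_gt0.
have r0' := r0; have wr' := wr.
have rm0 : 0 < r / (r - cabs w) by rewrite divr_gt0// subr_gt0.
pose e' : R := e / (2 * (r / (r - cabs w)) * (2 * pi)).
have e'0 : 0 < e' by exact: (divr_gt0 e0 (mulr_gt0 (mulr_gt0 (ltr0n _ 2) rm0) (mulr_gt0 (ltr0n _ 2) pi0))).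
have := derivable_cvg (df (z := c + w) _).
rewrite addrAC subrr add0r => /(_ (ltW wr)) /continuousCP /(_ _ e'0)[d d0 dP].
pose s := Num.min (2^-1) (d / (4 * r)).
have s0 : 0 < s by rewrite lt_min invr_gt0 ltr0n divr_gt0// mulr_gt0.
have s1 : s < 1 by rewrite gt_min; apply/orP; left; lra.
have sd : s * (4 * r) <= d by rewrite -ler_pdivlMr ?mulr_gt0// ge_min lexx orbT.
have s01 : 0 < s < 1 by rewrite s0.
have s001 : 0 <= s <= 1 by lra.
rewrite -(circle_homotopy s01) -(cintZ 0 (2 * pi) (f (c + w)) ck).
rewrite -(cintB 0 (2 * pi) (cfk _ s001) cfk2).
apply: (@le_trans _ _ (2 * (e' * (r / (r - cabs w))) * (2 * pi - 0))).
  apply: cint_bound.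
  - by rewrite mulr_ge0// ltW.
  - by move=> x; apply: cvgB; [apply: cfk; lra|exact: cfk2].
  move=> x _; rewrite -mulrBl cabsM ler_pM ?cabs_ge0//.
    apply/ltW/dP; rewrite /z addrAC subrr add0r cabsM cabs_real gtr0_norm//.
    have h := ler_wpM2l (ltW s0) (k1_le x); apply: le_lt_trans h _; apply: lt_le_trans sd.
    by rewrite (ltr_pM2l s0) (ltr_pM2r r0') ltr_nat.
  rewrite cabsM; have -> : cabs ('i : C) = 1 := cabs_i R.
  by rewrite mul1r.
rewrite le_eqVlt; apply/orP; left; apply/eqP.
have q0 := gt_eqF rm0; have p0 := gt_eqF pi0; rewrite /e' subr0.
move: (r / (r - cabs w)) (pi : R) q0 p0 => q P q0 p0; field.
by rewrite q0 p0.
Qed.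

(** The integral of the kernel is left unevaluated. For [w = 0] the kernel is 1, which gives the
    mean value property, and from that the integral for general [w] is deduced. *)
Lemma cauchy_circle :
  cint 0 (2 * pi) (fun x => f (c + r%:C * circle_pt x) *
    (r%:C * circle_pt x / (r%:C * circle_pt x - w))) =
  f (c + w) * cint 0 (2 * pi) (fun x => r%:C * circle_pt x / (r%:C * circle_pt x - w)).
Proof.
have i0 : 'i != 0 :> C by rewrite eq_complex /= oner_eq0 andbF.
apply: (mulfI i0).
rewrite [RHS]mulrCA -[X in X = _]cintZ; first rewrite -[X in _ = _ * X]cintZ.
- rewrite -circle_homotopy_limit; apply: eq_cint => x.
  rewrite mulrCA; congr (f _ * _).
  by rewrite /z /k1 mul1r; ring.
- exact: k_cont.
- move=> x; apply: cvgM; last exact: k_cont.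
  have E : (fun x => f (c + r%:C * circle_pt x)) = (fun x => f (z 1 x)).
    by apply/funext => y; congr f; rewrite /z /k1 mul1r; ring.
  have c1 : continuous (fun x => f (z 1 x)) by apply: fz_cont; rewrite ler01 lexx.
  by rewrite -E in c1; exact: c1.
Qed.

End Homotopy.

End CauchyFormula.

(** * Mean value property, Cauchy's formula and differentiation of Cauchy integrals *)

Section CauchyConsequences.
Variable R : realType.
Local Notation C := (Cplx R).
Implicit Types (f g : C -> C) (c w z : C) (r x : R).

Lemma conjM_cabs z : z * z^* = ((cabs z) ^+ 2)%:C.
Proof. by rewrite rmorphXn /= cabsE -sqr_normc. Qed.

Lemma conjCM z w : (z * w)^* = z^* * w^*.
Proof. exact: rmorphM. Qed.

Lemma conjCB z w : (z - w)^* = z^* - w^*.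
Proof. exact: rmorphB. Qed.

Lemma conjCr x : (x%:C : C)^* = x%:C.
Proof. exact: conjc_real. Qed.

Lemma is_derive_shiftC f c w (d : C) :
  is_derive w 1 f d -> is_derive (c + w) 1 (fun z => f (z - c)) d.
Proof.
move=> /is_deriveCP fw; apply/is_deriveCP => e /fw[s s0 sP]; exists s => // z.
have <- : z - c - w = z - (c + w) by ring.
have -> : c + w - c = w by ring.
exact: sP.
Qed.

Lemma circle_pt_in_disc c r x : 0 <= r ->
  cabs (c + r%:C * circle_pt x - c) <= r.
Proof.
by move=> r0; rewrite addrAC subrr add0r cabsM cabs_circle_pt cabs_real mulr1 ger0_norm.
Qed.

Lemma continuous_arc r : continuous (fun x => r%:C * circle_pt x : C).
Proof. by move=> x; apply: cvgMr; exact: continuous_circle_pt. Qed.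

Lemma continuous_on_circle f c r : 0 <= r ->
  (forall z, cabs (z - c) <= r -> derivable f z 1) ->
  continuous (fun x => f (c + r%:C * circle_pt x)).
Proof.
move=> r0 df x.
apply: (@cvg_comp _ _ _ (fun x => c + r%:C * circle_pt x) f _ (nbhs (c + r%:C * circle_pt x))).
  by apply: cvgD; [exact: cvg_cst|exact: continuous_arc].
exact: derivable_cvg (df _ (circle_pt_in_disc _ _ r0)).
Qed.

Lemma arc_sub_ge r x w : 0 < r -> r - cabs w <= cabs (r%:C * circle_pt x - w).
Proof.
move=> r0; have := cabsD (r%:C * circle_pt x - w) w.
by rewrite subrK cabsM cabs_circle_pt cabs_real mulr1 gtr0_norm//; lra.
Qed.

Lemma arc_sub_neq0 r x w : 0 < r -> cabs w < r -> r%:C * circle_pt x - w != 0.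
Proof.
by move=> r0 wr; rewrite -cabs_gt0; have := arc_sub_ge x w r0; lra.
Qed.

Lemma arc_neq0 r x : 0 < r -> r%:C * circle_pt x != 0 :> C.
Proof. by move=> r0; have := @arc_sub_neq0 r x 0 r0; rewrite cabs0 subr0; apply. Qed.

Lemma continuous_arc_inv r w : 0 < r -> cabs w < r ->
  continuous (fun x => (r%:C * circle_pt x - w)^-1 : C).
Proof.
move=> r0 wr x; apply: cvgV; first exact: arc_sub_neq0.
by apply: cvgB; [exact: continuous_arc|exact: cvg_cst].
Qed.

Lemma mean_value f c r : 0 < r ->
  (forall z, cabs (z - c) <= r -> derivable f z 1) ->
  cint 0 (2 * pi) (fun x => f (c + r%:C * circle_pt x)) = f c * (2 * pi)%:C.
Proof.
move=> r0 df; have w0 : cabs (0 : C) < r by rewrite cabs0.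
have := cauchy_circle r0 w0 df; rewrite addr0.
have E x : r%:C * circle_pt x / (r%:C * circle_pt x - 0) = 1 :> C.
  by rewrite subr0 mulfV ?arc_neq0.
under eq_cint do rewrite E mulr1.
move=> ->; congr (_ * _).
under eq_cint do rewrite E.
by rewrite cint_cst subr0 mul1r.
Qed.

Lemma cauchy_kernel_integral r w : 0 < r -> cabs w < r ->
  cint 0 (2 * pi) (fun x => r%:C * circle_pt x / (r%:C * circle_pt x - w)) =
  (2 * pi)%:C.
Proof.
move=> r0 wr.
(* The conjugate of z / (z - w) on |z| = r is r^2 / (r^2 - w^* z), which is
   holomorphic in the disc. *)
pose g (z : C) : C := (r ^+ 2)%:C * ((r ^+ 2)%:C - w^* * z)^-1.
have den z : cabs (z - 0) <= r -> (r ^+ 2)%:C - w^* * z != 0.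
  rewrite subr0 => zr; apply/negP => /eqP/subr0_eq H.
  have : cabs ((r ^+ 2)%:C : C) = cabs (w^* * z) by rewrite H.
  rewrite cabsM cabs_conj cabs_real ger0_norm ?sqr_ge0// => H2.
  have : cabs w * cabs z < r * r.
    apply: le_lt_trans (_ : cabs w * r < _); first by rewrite ler_wpM2l ?cabs_ge0.
    by rewrite ltr_pM2r.
  by rewrite -H2 expr2 ltxx.
have dg z : cabs (z - 0) <= r -> derivable g z 1.
  move=> zr; apply: derivableM; first exact: derivable_cst.
  apply: derivableV; first exact: den.
  apply: derivableB; first exact: derivable_cst.
  by apply: derivableM; [exact: derivable_cst|exact: derivable_id].
have cg := continuous_on_circle (ltW r0) dg.
have := mean_value r0 dg.
have -> : g 0 = 1.
  by rewrite /g mulr0 subr0 mulfV// -cabs_gt0 cabs_real normr_gt0 expf_neq0// gt_eqF.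
rewrite mul1r => gm.
have cc : ((2 * pi)%:C : C)^* = (2 * pi)%:C := conjCr _.
rewrite -[RHS]cc -gm -(cint_conj _ _ cg); apply: eq_cint => x.
rewrite add0r; have D0 := arc_sub_neq0 x r0 wr.
have E0 := arc_neq0 x r0.
have : r%:C * circle_pt x * (r%:C * circle_pt x)^* = (r ^+ 2)%:C :> C.
  by rewrite conjM_cabs cabsM cabs_circle_pt cabs_real mulr1 real_normK ?num_real.
move: (r%:C * circle_pt x) D0 E0 => a D0 E0 ar.
have E1 : (a / (a - w))^* = a^* / (a^* - w^*).
  apply: etrans (conjCM _ _) _; congr (_ * _).
  by apply: etrans (fmorphV _ _) _; congr (_^-1); exact: conjCB.
have D1 : a^* - w^* != 0.
  by rewrite -conjCB conjc_eq0.
rewrite -[LHS]conjcK; congr (_^*); rewrite E1 /g -ar.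
have -> : a * a^* - w^* * a = a * (a^* - w^*) by ring.
by rewrite -mulf_div mulfV// mul1r.
Qed.

Lemma cauchy_formula f c w r : 0 < r -> cabs w < r ->
  (forall z, cabs (z - c) <= r -> derivable f z 1) ->
  cint 0 (2 * pi) (fun x => f (c + r%:C * circle_pt x) *
    (r%:C * circle_pt x / (r%:C * circle_pt x - w))) = f (c + w) * (2 * pi)%:C.
Proof. by move=> r0 wr df; rewrite cauchy_circle// cauchy_kernel_integral. Qed.

(** A remainder quadratic in [v - w], uniformly in x, justifies differentiation under the integral
    sign. *)
Lemma is_derive_cint (k : C -> R -> C) (k' : R -> C) (b : R) w (d M : R) :
  0 <= b -> 0 < d -> 0 <= M ->
  (forall v, cabs (v - w) < d -> continuous (k v)) -> continuous k' ->
  (forall v x, 0 <= x <= b -> cabs (v - w) < d ->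
    cabs (k v x - k w x - k' x * (v - w)) <= M * cabs (v - w) ^+ 2) ->
  is_derive w 1 (fun v => cint 0 b (k v)) (cint 0 b k').
Proof.
move=> b0 d0 M0 ck ck' kP; apply/is_deriveCP => e e0.
have den0 : 0 < 2 * M * b + 1 by rewrite ltr_wpDl ?mulr_ge0.
exists (Num.min d (e / (2 * M * b + 1))); first by rewrite lt_min d0 divr_gt0.
move=> v; rewrite lt_min => /andP[vd ve].
have ww : cabs (w - w) < d by rewrite subrr cabs0.
have c1 : continuous (fun x => k v x - k w x).
  by move=> x; apply: cvgB; [exact: (ck v vd)|exact: (ck w ww)].
have c2 : continuous (fun x => (v - w) * k' x) by move=> x; apply: cvgMr; exact: ck'.
rewrite -(cintB 0 b (ck v vd) (ck w ww)) mulrC -(cintZ 0 b (v - w) ck') -(cintB 0 b c1 c2).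
have c3 : continuous (fun x => k v x - k w x - (v - w) * k' x).
  by move=> x; apply: cvgB; [exact: c1|exact: c2].
have H x : 0 <= x <= b -> cabs (k v x - k w x - (v - w) * k' x) <= M * cabs (v - w) ^+ 2.
  by move=> xb; rewrite [(v - w) * _]mulrC; exact: kP.
apply: le_trans (cint_bound b0 c3 H) _.
rewrite subr0 expr2.
have -> : 2 * (M * (cabs (v - w) * cabs (v - w))) * b = (2 * M * b) * cabs (v - w) * cabs (v - w) by ring.
rewrite ler_wpM2r ?cabs_ge0//.
move: ve; rewrite ltr_pdivlMr// => ve; apply: le_trans (ltW ve).
by rewrite mulrC ler_wpM2l ?cabs_ge0// lerDl.
Qed.

Lemma continuous_bounded (phi : R -> C) (b : R) : 0 <= b -> continuous phi ->
  exists2 M : R, 0 <= M & forall x, 0 <= x <= b -> cabs (phi x) <= M.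
Proof.
move=> b0 cphi.
have cc : {within `[0, b], continuous (fun x => cabs (phi x))}.
  by apply: continuous_subspaceT => x; apply: cvg_cabs; exact: cphi.
have [m _ mP] := EVT_max b0 cc.
by exists (cabs (phi m)); [exact: cabs_ge0|move=> x xb; apply: mP; rewrite in_itv].
Qed.

Lemma cauchy_transform_derive (phi : R -> C) r w : 0 < r -> cabs w < r ->
  continuous phi ->
  is_derive w 1 (fun v : C => cint 0 (2 * pi) (fun x => phi x * (r%:C * circle_pt x - v)^-1))
    (cint 0 (2 * pi) (fun x => phi x * (r%:C * circle_pt x - w)^-1 ^+ 2)).
Proof.
move=> r0 wr cphi.
have p0 : 0 <= 2 * pi :> R by rewrite mulr_ge0// pi_ge0.
have [B B0 BP] := continuous_bounded p0 cphi.
pose m := r - cabs w; have m0 : 0 < m by rewrite subr_gt0.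
have vr v : cabs (v - w) < m / 2 -> cabs v < r - m / 2.
  by have := cabsD (v - w) w; rewrite subrK /m; lra.
have d0 : 0 < m / 2 by rewrite divr_gt0.
(* From [1/(a-v) - 1/(a-w) - (v-w)/(a-w)^2 = (v-w)^2 / ((a-v) (a-w)^2)] with [|a-v| >= m/2] and
   [|a-w| >= m], where a is on the circle. *)
have M0 : 0 <= B * (2 / m ^+ 3) by rewrite mulr_ge0// divr_ge0// exprn_ge0// ltW.
refine (@is_derive_cint (fun v x => phi x * (r%:C * circle_pt x - v)^-1)
  (fun x => phi x * (r%:C * circle_pt x - w)^-1 ^+ 2) _ w _ _ p0 d0 M0 _ _ _).
- move=> v /vr v1 x; apply: cvgM; first exact: cphi.
  by apply: continuous_arc_inv => //; lra.
- move=> x; apply: cvgM; first exact: cphi.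
  by apply: cvgM; exact: continuous_arc_inv.
move=> v x xp vw; have v1 := vr _ vw.
have v2 : cabs v < r by lra.
have a0 := arc_sub_neq0 x r0 wr; have b0 := arc_sub_neq0 x r0 v2.
have -> : phi x * (r%:C * circle_pt x - v)^-1 - phi x * (r%:C * circle_pt x - w)^-1
   - phi x * (r%:C * circle_pt x - w)^-1 ^+ 2 * (v - w) =
  phi x * ((r%:C * circle_pt x - v)^-1 * (r%:C * circle_pt x - w)^-1 ^+ 2) * (v - w) ^+ 2.
  by field; rewrite a0 b0.
rewrite cabsM cabsX ler_wpM2r ?exprn_ge0 ?cabs_ge0// cabsM ler_pM ?cabs_ge0//.
  exact: BP.
rewrite cabsM cabsX !cabsV.
have h1 : (cabs (r%:C * circle_pt x - v))^-1 <= 2 / m.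
  rewrite -[2 / m]invf_div lef_pV2 ?posrE ?divr_gt0 ?cabs_gt0//.
  by have := arc_sub_ge x v r0; lra.
have h2 : (cabs (r%:C * circle_pt x - w))^-1 <= m^-1.
  by rewrite lef_pV2 ?posrE ?divr_gt0 ?cabs_gt0//; have := arc_sub_ge x w r0.
have -> : 2 / m ^+ 3 = (2 / m) * m^-1 ^+ 2 by field; rewrite gt_eqF.
by rewrite ler_pM ?exprn_ge0 ?invr_ge0 ?cabs_ge0// lerXn2r ?nnegrE ?invr_ge0 ?cabs_ge0// ltW.
Qed.

(** The centre suffices, since the circle is moved along with the point where a derivative is taken.
    The remainder is [(3a - 2v) v^2 / ((a-v)^2 a^3)] with [|a| = r] and [|a-v| >= r/2], whence the
    constant [16 / r^4]. *)
Lemma cauchy_transform_derive2 (phi : R -> C) r : 0 < r -> continuous phi ->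
  derivable (fun v : C => cint 0 (2 * pi) (fun x => phi x * (r%:C * circle_pt x - v)^-1 ^+ 2)) (0 : C) 1.
Proof.
move=> r0 cphi.
have p0 : 0 <= 2 * pi :> R by rewrite mulr_ge0// pi_ge0.
have [B B0 BP] := continuous_bounded p0 cphi.
have vr (v : C) : cabs (v - 0) < r / 2 -> cabs v < r / 2 by rewrite subr0.
have w0 : cabs (0 : C) < r by rewrite cabs0.
have [//] : is_derive (0 : C) 1
  (fun v : C => cint 0 (2 * pi) (fun x => phi x * (r%:C * circle_pt x - v)^-1 ^+ 2))
  (cint 0 (2 * pi) (fun x => phi x * (2 * (r%:C * circle_pt x - 0)^-1 ^+ 3))).
have d0 : 0 < r / 2 by rewrite divr_gt0.
have M0 : 0 <= B * (16 / r ^+ 4) by rewrite mulr_ge0// divr_ge0// exprn_ge0// ltW.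
refine (@is_derive_cint (fun v x => phi x * (r%:C * circle_pt x - v)^-1 ^+ 2)
  (fun x => phi x * (2 * (r%:C * circle_pt x - 0)^-1 ^+ 3)) _ 0 _ _ p0 d0 M0 _ _ _).
- move=> v /vr v1 x; apply: cvgM; first exact: cphi.
  by apply: cvgM; apply: continuous_arc_inv => //; lra.
- move=> x; apply: cvgM; first exact: cphi.
  apply: cvgMr; apply: cvgM; last apply: cvgM; exact: continuous_arc_inv.
move=> v x xp vw; have v1 := vr _ vw.
have v2 : cabs v < r by lra.
have a0 := arc_sub_neq0 x r0 w0; have b0 := arc_sub_neq0 x r0 v2.
rewrite !subr0 in a0 *.
set a := r%:C * circle_pt x in a0 b0 *.
have ar : cabs a = r by rewrite /a cabsM cabs_circle_pt cabs_real mulr1 gtr0_norm.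
have -> : phi x * (a - v)^-1 ^+ 2 - phi x * a^-1 ^+ 2 - phi x * (2 * a^-1 ^+ 3) * v =
  phi x * ((3 * a - 2 * v) * ((a - v)^-1 ^+ 2 * a^-1 ^+ 3)) * v ^+ 2.
  by field; rewrite a0 b0.
rewrite cabsM cabsX ler_wpM2r ?exprn_ge0 ?cabs_ge0// cabsM ler_pM ?cabs_ge0//.
  exact: BP.
rewrite cabsM [cabs (_ ^+ 2 * _)]cabsM !cabsX !cabsV ar.
have h1 : (cabs (a - v))^-1 <= 2 / r.
  rewrite -[2 / r]invf_div lef_pV2 ?posrE ?divr_gt0 ?cabs_gt0//.
  by have := arc_sub_ge x v r0; rewrite -/a; lra.
have h3 : cabs (3 * a - 2 * v) <= 4 * r.
  have n3 n : cabs (n%:R : C) = n%:R.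
    by rewrite -[n%:R in LHS](rmorph_nat (real_complex R)) cabs_real ger0_norm.
  by rewrite (le_trans (cabsB _ _))// (cabsM _ a) (cabsM _ v) !n3 ar; lra.
have h2 : (cabs (a - v))^-1 ^+ 2 <= (2 / r) ^+ 2.
  by rewrite lerXn2r ?nnegrE ?invr_ge0 ?cabs_ge0// divr_ge0// ltW.
have -> : 16 / r ^+ 4 = (4 * r) * ((2 / r) ^+ 2 * r^-1 ^+ 3) by field; rewrite gt_eqF.
have ri : 0 <= r^-1 ^+ 3 by rewrite exprn_ge0// invr_ge0 ltW.
rewrite ler_pM ?cabs_ge0//; last by rewrite ler_wpM2r.
by rewrite mulr_ge0// exprn_ge0// invr_ge0 cabs_ge0.
Qed.

End CauchyConsequences.

(** * Entire functions *)

Section EntireFunctions.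
Variable R : realType.
Local Notation C := (Cplx R).
Implicit Types (f g : C -> C) (c w z t : C) (r x : R).

Lemma near_cabs z (e : R) : 0 < e -> \forall v \near z, cabs (v - z) < e.
Proof.
move=> e0; apply/nbhs_ballP; exists e%:C => /=; first by rewrite ltcR.
move=> v zv; rewrite cabs_lt distrC.
by move: zv; rewrite -ball_normE.
Qed.

Lemma entire_is_derive f z : entire f -> is_derive z 1 f (derive1 f z).
Proof. by move=> ef; rewrite derive1E; apply: derivableP; exact: ef. Qed.

Lemma entire_continuous f : entire f -> continuous f.
Proof. by move=> ef z; apply: derivable_cvg; exact: ef. Qed.

Lemma entireM f g : entire f -> entire g -> entire (fun z => f z * g z).
Proof. by move=> ef eg z _; apply: derivableM; [exact: ef|exact: eg]. Qed.

Lemma entireD f g : entire f -> entire g -> entire (fun z => f z + g z).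
Proof. by move=> ef eg z _; apply: derivableD; [exact: ef|exact: eg]. Qed.

Lemma entireB f g : entire f -> entire g -> entire (fun z => f z - g z).
Proof. by move=> ef eg z _; apply: derivableB; [exact: ef|exact: eg]. Qed.

Lemma entire_cst (k : C) : entire (fun=> k).
Proof. by move=> z _; exact: derivable_cst. Qed.

Lemma entireX f n : entire f -> entire (fun z => f z ^+ n).
Proof.
move=> ef; elim: n => [|n IH].
  by under eq_fun do rewrite expr0; exact: entire_cst.
by under eq_fun do rewrite exprS; exact: entireM.
Qed.

Let pi2_neq0 : (2 * pi)%:C != 0 :> C.
Proof. by rewrite -cabs_gt0 cabs_real normr_gt0 mulf_neq0// gt_eqF// pi_gt0. Qed.

Lemma entire_cauchy f c w : entire f -> cabs w < 1 ->
  f (c + w) = (2 * pi)%:C^-1 * cint 0 (2 * pi)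
   (fun x => f (c + 1%:C * circle_pt x) * (1%:C * circle_pt x)
     * (1%:C * circle_pt x - w)^-1).
Proof.
move=> ef w1; under eq_cint do rewrite -mulrA.
have H := @cauchy_formula R f c w 1 ltr01 w1 (fun z _ => ef z I).
by apply: (mulfI pi2_neq0); rewrite mulVKf// mulrC -H.
Qed.

Let phi f c x : C := f (c + 1%:C * circle_pt x) * (1%:C * circle_pt x).

Let phi_cont f c : entire f -> continuous (phi f c).
Proof.
move=> ef x; apply: cvgM; last exact: continuous_arc.
by apply: continuous_on_circle => // z _; exact: ef.
Qed.

Let near_disc c z : cabs (z - c) < 1 -> \near z, cabs (z - c) < 1.
Proof.
move=> zc; have d0 : 0 < 1 - cabs (z - c) by rewrite subr_gt0.
near=> v.
have : cabs (v - z) < 1 - cabs (z - c).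
  by near: v; exact: near_cabs.
by have := cabsD (v - z) (z - c); rewrite addrA subrK; lra.
Unshelve. all: by end_near. Qed.

(** On the unit disc around [c] Cauchy's formula makes [f] a Cauchy transform, so [f'] is the
    transform with squared kernel on that whole disc, and the latter is derivable at its centre. *)
Lemma entire_derive1 f : entire f -> entire (derive1 f).
Proof.
move=> ef c _.
have cphi := @phi_cont f c ef.
have D z : cabs (z - c) < 1 ->
  derive1 f z = (2 * pi)%:C^-1 * cint 0 (2 * pi)
   (fun x => phi f c x * (1%:C * circle_pt x - (z - c))^-1 ^+ 2).
  move=> zc; rewrite derive1E.
  have := cauchy_transform_derive ltr01 zc cphi.
  move=> /(is_derive_shiftC c); rewrite subrKC.
  move=> /(@is_deriveZ _ _ _ _ (2 * pi)%:C^-1) H.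
  apply: derive_val; apply: (near_eq_is_derive _ H).
  have := near_disc zc; apply: filterS => v vc.
  by rewrite -[v in RHS](subrKC c) (entire_cauchy _ ef vc).
apply: (@near_eq_derivable _ _ _ (fun z : C => (2 * pi)%:C^-1 * cint 0 (2 * pi)
   (fun x => phi f c x * (1%:C * circle_pt x - (z - c))^-1 ^+ 2) : C)).
  have cc : cabs (c - c) < 1 by rewrite subrr cabs0.
  by have := near_disc cc; apply: filterS => v /D.
apply: derivableM; first exact: derivable_cst.
have /derivableP := cauchy_transform_derive2 ltr01 cphi.
by move=> /(is_derive_shiftC c); rewrite addr0 => -[].
Qed.

Definition slope f t z : C := if z == t then derive1 f t else (f z - f t) / (z - t).

(** Away from [t] this is the quotient rule. Near [t], [(1/(a-u) - 1/a) / u = 1/(a (a-u))] turns the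
    difference quotient of Cauchy's formula into the Cauchy transform of [psi]; at [u = 0] the same
    transform gives [f'(t)], so the singularity is removable. *)
Lemma entire_slope f t : entire f -> entire (slope f t).
Proof.
move=> ef z _; have [->{z}|zt] := eqVneq z t; last first.
  apply: (@near_eq_derivable _ _ _ (fun z => (f z - f t) / (z - t))).
    have zt0 : 0 < cabs (z - t) by rewrite cabs_gt0 subr_eq0.
    near=> v; rewrite /slope ifN//.
    have : cabs (v - z) < cabs (z - t).
      by near: v; exact: near_cabs.
    by apply: contraPneq => ->; rewrite cabs_distC ltxx.
  apply: derivableM.
    by apply: derivableB; [exact: ef|exact: derivable_cst].
  apply: derivableV; first by rewrite subr_eq0.
  by apply: derivableB; [exact: derivable_id|exact: derivable_cst].
have cphi := @phi_cont f t ef.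
pose psi x : C := phi f t x * (1%:C * circle_pt x - 0)^-1.
have w0 : cabs (0 : C) < 1 by rewrite cabs0.
have cpsi : continuous psi.
  by move=> x; apply: cvgM; [exact: cphi|exact: continuous_arc_inv].
have cker (w : C) : cabs w < 1 -> continuous (fun x => phi f t x * (1%:C * circle_pt x - w)^-1).
  by move=> w1 x; apply: cvgM; [exact: cphi|exact: continuous_arc_inv].
have cker2 (w : C) : cabs w < 1 -> continuous (fun x => psi x * (1%:C * circle_pt x - w)^-1).
  by move=> w1 x; apply: cvgM; [exact: cpsi|exact: continuous_arc_inv].
have D z : cabs (z - t) < 1 ->
  slope f t z = (2 * pi)%:C^-1 * cint 0 (2 * pi)
   (fun x => psi x * (1%:C * circle_pt x - (z - t))^-1).
  move=> zc; rewrite /slope; case: ifPn => [/eqP ->|zt].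
    rewrite subrr derive1E.
    have := cauchy_transform_derive ltr01 w0 cphi.
    move=> /(is_derive_shiftC t); rewrite addr0.
    move=> /(@is_deriveZ _ _ _ _ (2 * pi)%:C^-1) H.
    transitivity ((2 * pi)%:C^-1 * cint 0 (2 * pi)
     (fun x => phi f t x * (1%:C * circle_pt x - 0)^-1 ^+ 2)).
      apply: derive_val; apply: (near_eq_is_derive _ H).
      have cc : cabs (t - t) < 1 by rewrite subrr cabs0.
      have := near_disc cc; apply: filterS => v vc.
      by rewrite -[v in RHS](subrKC t) (entire_cauchy _ ef vc).
    by congr (_ * _); apply: eq_cint => x; rewrite /psi expr2 mulrA.
  have zt0 : z - t != 0 by rewrite subr_eq0.
  rewrite -[z in LHS](subrKC t) [in X in _ / X]subrKC (entire_cauchy _ ef zc).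
  rewrite -[t in f t]addr0 (entire_cauchy _ ef w0) -mulrBr -mulrA; congr (_ * _).
  rewrite -(cintB _ _ (cker _ zc) (cker _ w0)) mulrC.
  apply: (mulfI zt0); rewrite mulVKf// -(cintZ _ _ _ (cker2 _ zc)).
  apply: eq_cint => x; rewrite /psi.
  have a0 := arc_sub_neq0 x ltr01 zc; have b0 := arc_sub_neq0 x ltr01 w0.
  rewrite subr0 in b0 *.
  move: (1%:C * circle_pt x) (z - t) (phi f t x) a0 b0 => a u F a0 b0.
  by field; rewrite a0 b0.
apply: (@near_eq_derivable _ _ _ (fun z : C => (2 * pi)%:C^-1 * cint 0 (2 * pi)
   (fun x => psi x * (1%:C * circle_pt x - (z - t))^-1) : C)).
  have cc : cabs (t - t) < 1 by rewrite subrr cabs0.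
  by have := near_disc cc; apply: filterS => v /D.
apply: derivableM; first exact: derivable_cst.
have := cauchy_transform_derive ltr01 w0 cpsi.
by move=> /(is_derive_shiftC t); rewrite addr0 => -[].
Unshelve. all: by end_near. Qed.

End EntireFunctions.

(** * Typically real functions *)

Section TypicallyReal.
Variable R : realType.
Local Notation C := (Cplx R).

Variables (f : C -> C) (c : C) (r : R).
Hypothesis r0 : 0 < r.
Hypothesis df : forall z, cabs (z - c) <= r -> derivable f z 1.

Let v x := complex.Im (f (c + r%:C * circle_pt x)).

Let cf : continuous (fun x => f (c + r%:C * circle_pt x)).
Proof. exact: continuous_on_circle (ltW r0) df. Qed.

Let cv : continuous (fun x => v x * sin x).
Proof.
move=> x; apply: cvgM; last exact: continuous_sin.
by apply: cvg_Im; exact: cf.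
Qed.

Let continuous_arc_dist (w : C) : continuous (fun x => cabs (r%:C * circle_pt x - w)).
Proof.
move=> x; have h : (fun x => r%:C * circle_pt x - w : C) @ x --> (r%:C * circle_pt x - w : C).
  by apply: cvgB; [exact: continuous_arc|exact: cvg_cst].
exact: cvg_cabs h.
Qed.

(* Subtracting from Cauchy's formula the mean value of an analytic function
   makes the kernel purely imaginary, so that the real part of f drops out. *)
Lemma typically_real_derive : complex.Re (derive1 f c) =
  (pi * r)^-1 * oint 0 (2 * pi) (fun x => v x * sin x).
Proof.
have p0 := pi_gt0 R; have r0' := r0.
have w0 : cabs (0 : C) < r by rewrite cabs0.
have cphi : continuous (fun x => f (c + r%:C * circle_pt x) * (r%:C * circle_pt x)).
  by move=> x; apply: cvgM; [exact: cf|exact: continuous_arc].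
have E1 : (2 * pi)%:C * derive1 f c = cint 0 (2 * pi)
   (fun x => f (c + r%:C * circle_pt x) * (r%:C * circle_pt x) *
     (r%:C * circle_pt x - 0)^-1 ^+ 2).
  have := cauchy_transform_derive r0 w0 cphi.
  move=> /(is_derive_shiftC c); rewrite addr0 => H.
  have [df0 fE] : is_derive c 1 f ('D_1 f c).
    by apply: derivableP; apply: df; rewrite subrr cabs0 ltW.
  rewrite derive1E.
  have Hf : is_derive c 1 (fun z : C => (2 * pi)%:C * f z : C) ((2 * pi)%:C * 'D_1 f c).
    exact: (@is_deriveZ _ _ _ f (2 * pi)%:C).
  suff H2 : is_derive c 1 (fun z : C => (2 * pi)%:C * f z : C) (cint 0 (2 * pi)
     (fun x => f (c + r%:C * circle_pt x) * (r%:C * circle_pt x) *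
       (r%:C * circle_pt x - 0)^-1 ^+ 2)).
    by rewrite -(@derive_val _ _ _ _ _ _ _ Hf) (@derive_val _ _ _ _ _ _ _ H2).
  apply: (near_eq_is_derive _ H); near=> z.
  have zc : cabs (z - c) < r.
    by near: z; exact: near_cabs.
  have := cauchy_formula r0 zc df; rewrite subrKC => H3; rewrite [RHS]mulrC -H3.
  by apply: eq_cint => x; apply: esym; exact: mulrA.
have E2 : 0 = cint 0 (2 * pi)
   (fun x => f (c + r%:C * circle_pt x) * (c + r%:C * circle_pt x - c)).
  have dg z : cabs (z - c) <= r -> derivable (fun z => f z * (z - c)) z 1.
    move=> zc; apply: derivableM; first exact: df.
    by apply: derivableB; [exact: derivable_id|exact: derivable_cst].
  by rewrite (mean_value r0 dg) subrr mulr0 mul0r.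
have c1 : continuous (fun x => f (c + r%:C * circle_pt x) * (r%:C * circle_pt x) *
     (r%:C * circle_pt x - 0)^-1 ^+ 2).
  move=> x; apply: cvgM; first exact: cphi.
  by apply: cvgM; exact: continuous_arc_inv.
have c2 : continuous (fun x => f (c + r%:C * circle_pt x) * (c + r%:C * circle_pt x - c)).
  move=> x; apply: cvgM; first exact: cf.
  apply: cvgB; last exact: cvg_cst.
  by apply: cvgD; [exact: cvg_cst|exact: continuous_arc].
have c3 : continuous (fun x => (r ^+ 2)%:C^-1 * (f (c + r%:C * circle_pt x) * (c + r%:C * circle_pt x - c)) : C).
  by move=> x; apply: cvgMr; exact: c2.
have E3 : (2 * pi)%:C * derive1 f c = cint 0 (2 * pi)
   (fun x => f (c + r%:C * circle_pt x) * (r%:C * circle_pt x) *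
     (r%:C * circle_pt x - 0)^-1 ^+ 2 -
    (r ^+ 2)%:C^-1 * (f (c + r%:C * circle_pt x) * (c + r%:C * circle_pt x - c))).
  by rewrite (cintB _ _ c1 c3) (cintZ _ _ _ c2) -E1 -E2 mulr0 subr0.
have : complex.Re ((2 * pi)%:C * derive1 f c) = oint 0 (2 * pi) (fun x => 2 / r * (v x * sin x)).
  rewrite E3 /cint /=; congr oint; apply/funext => x.
  have [e eE ec] : exists2 e : C, circle_pt x * e = 1 & e = cos x +i* (- sin x).
    exists (circle_pt x)^* => //.
    by rewrite circle_pt_conj mulfV// circle_pt_neq0.
  have -> : f (c + r%:C * circle_pt x) * (r%:C * circle_pt x) *
     (r%:C * circle_pt x - 0)^-1 ^+ 2 -
    (r ^+ 2)%:C^-1 * (f (c + r%:C * circle_pt x) * (c + r%:C * circle_pt x - c)) =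
    f (c + r%:C * circle_pt x) * (e - circle_pt x) * (r^-1)%:C.
    have E0 := circle_pt_neq0 x.
    have -> : e = (circle_pt x)^-1 by apply: (mulfI E0); rewrite eE mulfV.
    rewrite fmorphV rmorphXn /=.
    have rC : r%:C != 0 :> C by rewrite -cabs_gt0 cabs_real normr_gt0 gt_eqF.
    by field; rewrite E0 rC.
  rewrite /v ec; case: (f _) => a b; rewrite /circle_pt /=.
  by ring.
rewrite (ointZ _ _ _ cv) => E4.
have : complex.Re ((2 * pi)%:C * derive1 f c) = 2 * pi * complex.Re (derive1 f c).
  by case: (derive1 f c) => a b /=; rewrite mul0r subr0.
rewrite E4 => E5.
have pi20 : 2 * pi != 0 :> R by rewrite mulf_neq0// gt_eqF.
apply: (mulfI pi20); rewrite -E5 mulrA; congr (_ * _).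
by move: (pi : R) p0 => P p0; field; rewrite !gt_eqF.
Unshelve. all: by end_near. Qed.

(** For a on the circle, Cauchy's kernel minus 1 is [x0 / (a - x0)]. The function [g] vanishes at
    [c], so it has mean zero, and on the circle its kernel is the conjugate of [x0 / (a - x0)]. The
    difference is purely imaginary, and only Im f is left in the real part. *)
Lemma typically_real_increment (x0 : R) : `|x0| < r ->
  complex.Re (f (c + x0%:C) - f c) =
  x0 * (pi^-1 * oint 0 (2 * pi) (fun x => v x * sin x *
     (r / cabs (r%:C * circle_pt x - x0%:C) ^+ 2))).
Proof.
move=> x0r; have p0 := pi_gt0 R; have r0' := r0.
have w0 : cabs (x0%:C : C) < r by rewrite cabs_real.
have dg0 z : cabs (z - c) <= r -> (r ^+ 2)%:C - x0%:C * (z - c) != 0.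
  move=> zr; apply/negP => /eqP/subr0_eq H.
  have : cabs ((r ^+ 2)%:C : C) = cabs (x0%:C * (z - c)) by rewrite H.
  rewrite cabsM !cabs_real ger0_norm ?sqr_ge0// => H2.
  have : `|x0| * cabs (z - c) < r * r.
    apply: le_lt_trans (_ : `|x0| * r < _); first by rewrite ler_wpM2l.
    by rewrite ltr_pM2r.
  by rewrite -H2 expr2 ltxx.
pose g z : C := f z * (x0%:C * (z - c) / ((r ^+ 2)%:C - x0%:C * (z - c))).
have dg z : cabs (z - c) <= r -> derivable g z 1.
  move=> zc; apply: derivableM; first exact: df.
  have dl : derivable (fun z : C => x0%:C * (z - c) : C) z 1.
    apply: derivableM; first exact: derivable_cst.
    by apply: derivableB; [exact: derivable_id|exact: derivable_cst].
  apply: derivableM; first exact: dl.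
  apply: derivableV; first exact: dg0.
  by apply: derivableB; [exact: derivable_cst|exact: dl].
have E1 := cauchy_formula r0 w0 df.
have E2 := mean_value r0 df.
have E3 := mean_value r0 dg; rewrite {2}/g subrr mulr0 mul0r mulr0 mul0r in E3.
have c1 : continuous (fun x => f (c + r%:C * circle_pt x) *
    (r%:C * circle_pt x / (r%:C * circle_pt x - x0%:C))).
  move=> x; apply: cvgM; first exact: cf.
  by apply: cvgM; [exact: continuous_arc|exact: continuous_arc_inv].
have c3 := continuous_on_circle (ltW r0) dg.
have c12 : continuous (fun x => f (c + r%:C * circle_pt x) *
    (r%:C * circle_pt x / (r%:C * circle_pt x - x0%:C)) - f (c + r%:C * circle_pt x)).
  by move=> x; apply: cvgB; [exact: c1|exact: cf].
have E4 : (f (c + x0%:C) - f c) * (2 * pi)%:C =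
   cint 0 (2 * pi) (fun x => f (c + r%:C * circle_pt x) *
    (r%:C * circle_pt x / (r%:C * circle_pt x - x0%:C)) - f (c + r%:C * circle_pt x)
    - g (c + r%:C * circle_pt x)).
  by rewrite (cintB _ _ c12 c3) (cintB _ _ c1 cf) E1 E2 E3 subr0 mulrBl.
have cw : continuous (fun x => v x * sin x * (r / cabs (r%:C * circle_pt x - x0%:C) ^+ 2)).
  move=> x; apply: cvgM; first exact: cv.
  apply: cvgMr; apply: cvgV.
    by rewrite expf_neq0// cabs_eq0 arc_sub_neq0.
  by apply: cvgM; exact: continuous_arc_dist.
have : complex.Re ((f (c + x0%:C) - f c) * (2 * pi)%:C) =
  oint 0 (2 * pi) (fun x => 2 * x0 * (v x * sin x * (r / cabs (r%:C * circle_pt x - x0%:C) ^+ 2))).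
  rewrite E4 /cint /=; congr oint; apply/funext => x.
  have D0 := arc_sub_neq0 x r0 w0; have E0 := circle_pt_neq0 x.
  have D1 := dg0 _ (circle_pt_in_disc c x (ltW r0)).
  have rC : r%:C != 0 :> C by rewrite -cabs_gt0 cabs_real normr_gt0 gt_eqF.
  have [e eE ec] : exists2 e : C, circle_pt x * e = 1 & e = cos x +i* (- sin x).
    exists (circle_pt x)^* => //.
    by rewrite circle_pt_conj mulfV.
  have N : (r%:C * circle_pt x - x0%:C) * (r%:C * e - x0%:C) =
      (cabs (r%:C * circle_pt x - x0%:C) ^+ 2)%:C.
    rewrite -conjM_cabs; congr (_ * _); apply/eqP; rewrite ec eq_complex /=.
    by apply/andP; split; apply/eqP; ring.
  have D2 : r%:C * e - x0%:C != 0.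
    apply: contraNneq D0 => H; have := N; rewrite H mulr0 => /esym/eqP.
    by rewrite -cabs_eq0 cabs_real normr_eq0 sqrf_eq0 cabs_eq0.
  have B : x0%:C * (r%:C * circle_pt x) / ((r ^+ 2)%:C - x0%:C * (r%:C * circle_pt x))
      = x0%:C / (r%:C * e - x0%:C).
    rewrite [c + _ - c]addrAC subrr add0r in D1.
    apply/eqP; rewrite eqr_div//; apply/eqP.
    have -> : x0%:C * (r%:C * circle_pt x) * (r%:C * e - x0%:C) =
      x0%:C * (r%:C ^+ 2 * (circle_pt x * e) - x0%:C * (r%:C * circle_pt x)) by ring.
    by rewrite eE mulr1 rmorphXn.
  have -> : f (c + r%:C * circle_pt x) *
    (r%:C * circle_pt x / (r%:C * circle_pt x - x0%:C)) - f (c + r%:C * circle_pt x)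
    - g (c + r%:C * circle_pt x) =
    f (c + r%:C * circle_pt x) * (e - circle_pt x) *
    (x0 * r / cabs (r%:C * circle_pt x - x0%:C) ^+ 2)%:C.
    rewrite /g [c + _ - c]addrAC subrr add0r B rmorphM fmorphV rmorphM /= -N.
    move: (circle_pt x) (f _) D0 D2 => e' F D0 D2.
    by field; rewrite D0 D2.
  rewrite /v ec; case: (f _) => a b; move: (cabs _) => n; rewrite /circle_pt /=.
  by ring.
rewrite (ointZ _ _ _ cw) => E5.
have : complex.Re ((f (c + x0%:C) - f c) * (2 * pi)%:C) = 2 * pi * complex.Re (f (c + x0%:C) - f c).
  by case: (f (c + x0%:C) - f c) => a b /=; rewrite mulr0 subr0 mulrC.
rewrite E5 => E6.
have pi20 : 2 * pi != 0 :> R by rewrite mulf_neq0// gt_eqF.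
apply: (mulfI pi20); rewrite -E6; move: (oint _ _ _) => I.
by move: (pi : R) p0 => P p0; field; rewrite !gt_eqF.
Qed.

(* f is typically real: Im f has the sign of Im (z - c) on the circle. *)
Hypothesis v0 : forall x, 0 <= v x * sin x.

(* Both integrals have the same nonnegative weight [v x * sin x]; the kernels
   are compared pointwise. *)
Lemma typically_real_growth (x0 : R) : `|x0| < r ->
  exists2 S : R, complex.Re (f (c + x0%:C) - f c) = x0 * S &
    complex.Re (derive1 f c) * (r / (r + `|x0|)) ^+ 2 <= S
      <= complex.Re (derive1 f c) * (r / (r - `|x0|)) ^+ 2.
Proof.
move=> x0r; have p0 := pi_gt0 R; have r0' := r0.
have w0 : cabs (x0%:C : C) < r by rewrite cabs_real.
have p2 : 0 <= 2 * pi :> R by rewrite mulr_ge0// ltW.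
have cw : continuous (fun x => v x * sin x * (r / cabs (r%:C * circle_pt x - x0%:C) ^+ 2)).
  move=> x; apply: cvgM; first exact: cv.
  apply: cvgMr; apply: cvgV.
    by rewrite expf_neq0// cabs_eq0 arc_sub_neq0.
  by apply: cvgM; exact: continuous_arc_dist.
eexists; first exact: typically_real_increment.
have lo : 0 < r + `|x0| by rewrite ltr_wpDr.
have hi : 0 < r - `|x0| by rewrite subr_gt0.
have scale (k : R) : k != 0 -> complex.Re (derive1 f c) * (r / k) ^+ 2 =
  pi^-1 * oint 0 (2 * pi) (fun x => r / k ^+ 2 * (v x * sin x)).
  move=> k0; rewrite (ointZ _ _ _ cv) typically_real_derive.
  move: (oint _ _ _) => I; move: (pi : R) p0 => P p0.
  by field; rewrite k0 !gt_eqF.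
have cz (k : R) : continuous (fun x => k * (v x * sin x)).
  by move=> x; apply: cvgMr; exact: cv.
have D0 x := arc_sub_neq0 x r0 w0.
have up x : cabs (r%:C * circle_pt x - x0%:C) <= r + `|x0|.
  rewrite (le_trans (cabsB _ _))// cabsM cabs_circle_pt !cabs_real mulr1.
  by rewrite gtr0_norm.
have dn x : r - `|x0| <= cabs (r%:C * circle_pt x - x0%:C).
  by have := arc_sub_ge x x0%:C r0; rewrite cabs_real.
rewrite !scale ?gt_eqF//; apply/andP; split; rewrite ler_pM2l ?invr_gt0//;
  apply: le_oint => // x _; rewrite [X in X <= _]mulrC || rewrite [X in _ <= X]mulrC.
- apply: ler_wpM2l => //; rewrite ler_pM2l// lef_pV2 ?posrE ?exprn_gt0 ?cabs_gt0//.
  by rewrite lerXn2r ?nnegrE ?cabs_ge0 ?(ltW lo).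
- rewrite mulrC [in leRHS]mulrC; apply: ler_wpM2l => //.
  rewrite ler_pM2l// lef_pV2 ?posrE ?exprn_gt0 ?cabs_gt0//.
  by rewrite lerXn2r ?nnegrE ?cabs_ge0 ?(ltW hi).
Qed.

(** The weight is continuous, nonnegative, and positive at [x = pi / 2], where the circle passes
    through [c + i r]. *)
Lemma typically_real_derive_gt0 : 0 < complex.Im (f (c + r%:C * 'i)) ->
  0 < complex.Re (derive1 f c).
Proof.
move=> vi; rewrite typically_real_derive mulr_gt0 ?invr_gt0 ?mulr_gt0 ?pi_gt0//.
have p0 := pi_gt0 R.
apply: (@oint_gt0 _ _ _ (pi / 2)) => //.
  by apply/andP; split; lra.
by rewrite /v /circle_pt cos_pihalf sin_pihalf mulr1.
Qed.

End TypicallyReal.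

(** * Hermite-Biehler functions *)

Section LineDerivatives.
Variable R : realType.
Local Notation C := (Cplx R).
Implicit Types (f : C -> C) (p dir d : C).

Lemma half_i : 'i / 2 = (0 : R) +i* (2^-1 : R) :> C.
Proof.
have -> : (2 : C)^-1 = ((2^-1 : R)%:C) by rewrite fmorphV rmorph_nat.
by apply/eqP; rewrite eq_complex /=; apply/andP; split; apply/eqP; ring.
Qed.

Lemma cabs_half_i : cabs ('i / 2 : C) = 2^-1.
Proof.
have -> : 'i / 2 = 'i * (2^-1 : R)%:C :> C by rewrite fmorphV rmorph_nat.
by rewrite cabsM cabs_real cabs_i mul1r ger0_norm.
Qed.

Lemma continuous_entire_line f p dir : entire f ->
  continuous (fun s : R => f (p + s%:C * dir)).
Proof.
move=> ef s.
have h : (fun s : R => p + s%:C * dir : C) @ s --> (p + s%:C * dir : C).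
  apply: cvgD; first exact: cvg_cst.
  by apply: cvgMl; apply: cvg_real; exact: cvg_id.
apply: (@cvg_comp _ _ _ (fun s : R => p + s%:C * dir) f _ (nbhs (p + s%:C * dir))).
  exact: h.
exact: (entire_continuous ef).
Qed.

Lemma is_deriveR_of_bound (f : R -> R) (x d : R) :
  (forall e : R, 0 < e -> exists2 r : R, 0 < r &
    forall y, `|y - x| < r -> `|f y - f x - d * (y - x)| <= e * `|y - x|) ->
  is_derive x 1 f d.
Proof.
move=> fx.
have cv : (fun h : R => h^-1 *: (f (h *: 1 + x) - f x)) @ 0^' --> d.
  apply/cvgrPdist_lt => e e0; have e2 : 0 < e / 2 by rewrite divr_gt0.
  have [r r0 re] := fx _ e2.
  apply/nbhs_ballP; exists r => //=.
  move=> h; rewrite -ball_normE /ball_ /= sub0r normrN => hr h0.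
  have := re (h + x); rewrite addrK /GRing.scale /= mulr1 => /(_ hr) H.
  have hp : 0 < `|h| by rewrite normr_gt0.
  rewrite -(ltr_pM2r hp) -normrM mulrBl mulrAC mulVf// mul1r distrC.
  by rewrite (le_lt_trans H)// ltr_pM2r//; lra.
by split; [apply/cvg_ex; exists d | exact/cvg_lim].
Qed.

(** [L] stands for the real or the imaginary part; only its real linearity and the bound by the
    modulus matter. *)
Lemma is_derive_line f p dir d (s : R) (L : C -> R) :
  (forall z w, L (z - w) = L z - L w) -> (forall z, `|L z| <= cabs z) ->
  (forall z (x : R), L (z * x%:C) = L z * x) ->
  is_derive (p + s%:C * dir) 1 f d ->
  is_derive s 1 (fun u : R => L (f (p + u%:C * dir))) (L (d * dir)).
Proof.
move=> LB Lle LM /is_deriveCP fd; apply: is_deriveR_of_bound => e e0.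
have k0 : 0 < cabs dir + 1 by have := cabs_ge0 dir; lra.
have [r r0 rP] := fd _ (divr_gt0 e0 k0).
exists (r / (cabs dir + 1)); first exact: divr_gt0.
move=> y; rewrite ltr_pdivlMr// => yr.
have E : p + y%:C * dir - (p + s%:C * dir) = dir * (y - s)%:C.
  by rewrite rmorphB; ring.
have := rP (p + y%:C * dir); rewrite E cabsM cabs_real => H.
have /H {}H : cabs dir * `|y - s| < r.
  by apply: le_lt_trans yr; rewrite mulrC ler_wpM2l//; lra.
have -> : L (f (p + y%:C * dir)) - L (f (p + s%:C * dir)) - L (d * dir) * (y - s) =
   L (f (p + y%:C * dir) - f (p + s%:C * dir) - d * (dir * (y - s)%:C)).
  by rewrite !LB mulrA LM.
rewrite (le_trans (Lle _))// (le_trans H)// mulrA ler_wpM2r//.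
rewrite mulrAC ler_pdivrMr// ler_wpM2l ?(ltW e0)//; lra.
Qed.

Let ReM (k : C) (l : R) : complex.Re (k * l%:C) = complex.Re k * l.
Proof. by case: k => ? ? /=; rewrite mulr0 subr0. Qed.

Let ImM (k : C) (l : R) : complex.Im (k * l%:C) = complex.Im k * l.
Proof. by case: k => ? ? /=; rewrite mulr0 add0r. Qed.

Lemma is_derive_line_Re f p dir d (s : R) : is_derive (p + s%:C * dir) 1 f d ->
  is_derive s 1 (fun u : R => complex.Re (f (p + u%:C * dir))) (complex.Re (d * dir)).
Proof.
by apply: is_derive_line => // [z w|z]; [rewrite raddfB|exact: Re_cabs].
Qed.

Lemma is_derive_line_Im f p dir d (s : R) : is_derive (p + s%:C * dir) 1 f d ->
  is_derive s 1 (fun u : R => complex.Im (f (p + u%:C * dir))) (complex.Im (d * dir)).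
Proof.
by apply: is_derive_line => // [z w|z]; [rewrite raddfB|exact: Im_cabs].
Qed.

(** The mean value theorem is applied to the real and imaginary parts separately, whence the factor
    2. The derivative is bounded on the open segment only, so that a segment may start at a real
    point when the bound is known in the upper half-plane. *)
Lemma lipschitz_line f p dir (a b M : R) : a < b ->
  (forall s, a <= s <= b -> derivable f (p + s%:C * dir) 1) ->
  (forall s, a < s < b -> cabs ('D_1 f (p + s%:C * dir) * dir) <= M) ->
  cabs (f (p + b%:C * dir) - f (p + a%:C * dir)) <= 2 * M * (b - a).
Proof.
move=> ab df dM.
have half (L : C -> R) : (forall z w, L (z - w) = L z - L w) ->
    (forall z, `|L z| <= cabs z) -> (forall z (x : R), L (z * x%:C) = L z * x) ->
    `|L (f (p + b%:C * dir) - f (p + a%:C * dir))| <= M * (b - a).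
  move=> LB Lle LM.
  have dL s : a <= s <= b -> is_derive s 1 (fun u : R => L (f (p + u%:C * dir)))
      (L ('D_1 f (p + s%:C * dir) * dir)).
    move=> sab; exact: (is_derive_line LB Lle LM (derivableP (df _ sab))).
  have [x|x|c] := @MVT R (fun u : R => L (f (p + u%:C * dir))) (fun s => L ('D_1 f (p + s%:C * dir) * dir)) a b ab.
  - by rewrite in_itv /= => /andP[x1 x2]; apply: dL; rewrite !ltW.
  - apply: derivable_within_continuous => y; rewrite in_itv /= => /dL dy.
    by have [] := dy.
  rewrite in_itv /= => cab E; rewrite LB E normrM [`|b - a|]gtr0_norm ?subr_gt0//.
  by rewrite ler_wpM2r ?subr_ge0 ?(ltW ab)// (le_trans (Lle _))// dM.
rewrite (le_trans (cabs_le_ReIm _))// -mulrA mulr_natl mulr2n lerD//; apply: half => //.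
- by move=> z w; rewrite raddfB.
- by move=> z; exact: Re_cabs.
- by move=> z w; rewrite raddfB.
- by move=> z; exact: Im_cabs.
Qed.

Let cabs_conjB (z w : C) : cabs (z^* - w^*) = cabs (z - w).
Proof. by rewrite -[RHS]cabs_conj; congr cabs; apply: esym; exact: conjCB. Qed.

Let conj_increment (a b d w z : C) :
  (a^* - b^* - d^* * (w - z))^* = a - b - d * (w^* - z^*).
Proof.
case: a b d w z => [a1 a2] [b1 b2] [d1 d2] [w1 w2] [z1 z2].
by apply/eqP; rewrite eq_complex /=; apply/andP; split; apply/eqP; ring.
Qed.

Let le_of_eq (x y : R) : x = y -> x <= y. Proof. by move->. Qed.

Lemma is_derive_sharp f (z d : C) : is_derive (z^* : C) 1 f d ->
  is_derive z 1 (sharp f) (d^* : C).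
Proof.
move=> /is_deriveCP fd; apply/is_deriveCP => e /fd[r r0 rP]; exists r => // w wr.
have h : cabs (w^* - z^*) < r by rewrite cabs_conjB.
have H := rP _ h.
have E1 : cabs (sharp f w - sharp f z - d^* * (w - z)) =
    cabs (f w^* - f z^* - d * (w^* - z^*)).
  by rewrite -[LHS]cabs_conj; congr cabs; exact: conj_increment.
have E2 : e * cabs (w^* - z^*) = e * cabs (w - z) by rewrite cabs_conjB.
by apply: le_trans (le_of_eq E1) (le_trans H (le_of_eq E2)).
Qed.

Lemma entire_sharp f : entire f -> entire (sharp f).
Proof.
by move=> ef z _; have [] := is_derive_sharp (entire_is_derive (z^* : C) ef).
Qed.

Lemma sharp_real f (x : R) : sharp f x%:C = (f x%:C)^*.
Proof. by rewrite /sharp conjCr. Qed.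

End LineDerivatives.

Section HermiteBiehlerFunctions.
Variable R : realType.
Local Notation C := (Cplx R).
Variables (E : C -> C) (M : R).
Hypothesis HB : hermite_biehler E.
Hypothesis ME : forall z, upper_half_plane z -> cabs (derive1 E z / E z) <= M.

Let B := companionB E.
Let A z : C := (E z + sharp E z) / 2.

Let eE : entire E. Proof. by case: HB. Qed.

Lemma HB_bound_ge0 : 0 <= M.
Proof.
apply: le_trans (ME (z := 'i) _); first exact: cabs_ge0.
by rewrite /upper_half_plane /=.
Qed.

Lemma HB_neq0_upper z : upper_half_plane z -> E z != 0.
Proof.
by move=> /(HB.2 z) h; rewrite -cabs_gt0 (le_lt_trans (cabs_ge0 _) h).
Qed.

Lemma HB_derive_bound_upper z : upper_half_plane z ->
  cabs (derive1 E z) <= M * cabs (E z).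
Proof.
move=> zu; have := ME zu; rewrite cabsM cabsV ler_pdivrMr//.
by rewrite cabs_gt0 HB_neq0_upper.
Qed.

Let upper_ray (x s : R) : 0 < s -> upper_half_plane (x%:C + s%:C * 'i : C).
Proof. by move=> s0; rewrite /upper_half_plane /= mulr1 !mul0r !add0r addr0. Qed.

(* Starting from a real zero, the bound |E'| <= M |E| on a short vertical
   segment makes the maximum of |E| there at most half of itself. *)
Lemma HB_neq0_real (x : R) : E x%:C != 0.
Proof.
apply/negP => /eqP E0; have M0 := HB_bound_ge0.
pose d := (4 * (M + 1))^-1; have d0 : 0 < d by rewrite invr_gt0 mulr_gt0//; lra.
pose g (s : R) := cabs (E (x%:C + s%:C * 'i)).
have cg : continuous g.
  by move=> s; apply: cvg_cabs; exact: continuous_entire_line.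
have cgw : {within `[0, d], continuous g} by apply: continuous_subspaceT.
have [s0] := EVT_max (ltW d0) cgw; rewrite in_itv /= => /andP[s00 s0d] gm.
have gd : 0 < g d by rewrite cabs_gt0 HB_neq0_upper//; exact: upper_ray.
have gs0 : 0 < g s0 by apply: lt_le_trans gd (gm _ _); rewrite in_itv/= lexx ltW.
have s0p : 0 < s0.
  rewrite lt_neqAle s00 andbT eq_sym; apply: contraTneq gs0 => ->.
  by rewrite /g mul0r addr0 E0 cabs0 ltxx.
have := @lipschitz_line R E x%:C 'i 0 s0 (M * g s0) s0p.
rewrite mul0r addr0 E0 subr0 subr0 -/(g s0) => H.
have {}H : g s0 <= 2 * (M * g s0) * s0.
  apply: H => [s _|s /andP[s1 s2]]; first exact: eE.
  rewrite cabsM cabs_i mulr1 -derive1E.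
  rewrite (le_trans (HB_derive_bound_upper (upper_ray x s1)))// ler_wpM2l//.
  by apply: gm; rewrite in_itv /= (ltW s1)/= (le_trans (ltW s2)).
have : 2 * (M * g s0) * s0 <= 2 * (M * g s0) * d.
  by rewrite ler_wpM2l// mulr_ge0// mulr_ge0// ltW.
have : 4 * M * d < 1 by rewrite ltr_pdivrMr ?mulr_gt0//; lra.
move: (d) (g s0) gs0 H => D G G0 H H1 H2.
have : 4 * M * D * G < 1 * G by rewrite ltr_pM2r.
by lra.
Qed.

(** The bound in the upper half-plane passes to the boundary because [E] and [E'] are continuous. *)
Lemma HB_derive_bound_real (x : R) : cabs (derive1 E x%:C) <= M * cabs (E x%:C).
Proof.
have M0 := HB_bound_ge0.
have aux (a b c k f e' m : R) : k < e' -> c <= f -> a <= k + c ->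
    f <= m * (e' + b) -> (m + 1) * e' = a - m * b -> False by lra.
rewrite leNgt; apply/negP => H.
(* If the bound failed, the gap would be [(M + 1) e]. Moving up vertically changes [|E'|] by less
   than [e] and [M |E|] by at most [M e], which cannot close it. *)
pose e := (cabs (derive1 E x%:C) - M * cabs (E x%:C)) / (M + 1).
have e0 : 0 < e by rewrite divr_gt0 ?subr_gt0//; lra.
have eP : (M + 1) * e = cabs (derive1 E x%:C) - M * cabs (E x%:C).
  by rewrite mulrC divfK// gt_eqF//; lra.
have : {for (x%:C : C), continuous E} by exact: entire_continuous.
move=> /continuousCP/(_ _ e0)[d1 d10 h1].
have : {for (x%:C : C), continuous (derive1 E)}.
  exact: (entire_continuous (entire_derive1 eE)).
move=> /continuousCP/(_ _ e0)[d2 d20 h2].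
pose s := Num.min d1 d2 / 2.
have s0 : 0 < s by rewrite divr_gt0// lt_min d10.
have sd1 : s < d1.
  by rewrite /s ltr_pdivrMr// gt_min; apply/orP; left; lra.
have sd2 : s < d2.
  by rewrite /s ltr_pdivrMr// gt_min; apply/orP; right; lra.
have zz : cabs (x%:C + s%:C * 'i - x%:C) = s.
  by rewrite addrAC subrr add0r cabsM cabs_i mulr1 cabs_real gtr0_norm.
have := h1 (x%:C + s%:C * 'i); rewrite zz => /(_ sd1) k1.
have := h2 (x%:C + s%:C * 'i); rewrite zz => /(_ sd2) k2.
have k3 := HB_derive_bound_upper (upper_ray x s0).
have k4 := cabsD (E (x%:C + s%:C * 'i) - E x%:C) (E x%:C).
have k5 := cabsD (derive1 E x%:C - derive1 E (x%:C + s%:C * 'i)) (derive1 E (x%:C + s%:C * 'i)).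
rewrite !subrK in k4 k5; rewrite cabs_distC in k5.
have k6 : M * cabs (E (x%:C + s%:C * 'i)) <= M * (e + cabs (E x%:C)).
  by rewrite ler_wpM2l// (le_trans k4)// lerD2r ltW.
exact: aux k2 k3 k5 k6 eP.
Qed.

Lemma companionB_real (x : R) : B x%:C = (- complex.Im (E x%:C))%:C.
Proof.
rewrite /B /companionB sharp_real; case: (E _) => a b.
apply/eqP; rewrite eq_complex.
rewrite half_i.
by rewrite /=; apply/andP; split; apply/eqP; field.
Qed.

Lemma companionA_real (x : R) : A x%:C = (complex.Re (E x%:C))%:C.
Proof.
rewrite /A sharp_real; case: (E _) => a b.
apply/eqP; rewrite eq_complex.
have -> : (2 : C)^-1 = ((2^-1 : R)%:C) by rewrite fmorphV rmorph_nat.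
by rewrite /=; apply/andP; split; apply/eqP; field.
Qed.

Lemma companion_decomp z : E z = A z - 'i * B z.
Proof.
have i2 : 'i * 'i = -1 :> C by rewrite -expr2 sqr_i.
rewrite /A /B /companionB.
have -> : (E z + sharp E z) / 2 - 'i * ('i / 2 * (E z - sharp E z)) =
  (E z + sharp E z) / 2 - ('i * 'i) / 2 * (E z - sharp E z) by field.
by rewrite i2; field.
Qed.

Lemma entire_companionB : entire B.
Proof.
by apply: entireM; [exact: entire_cst|exact: (entireB eE (entire_sharp eE))].
Qed.

Lemma entire_companionA : entire A.
Proof.
by apply: entireM; [exact: (entireD eE (entire_sharp eE))|exact: entire_cst].
Qed.

Lemma sharp_companionB z : sharp B z = B z.
Proof.
rewrite /B /sharp /companionB /sharp conjcK half_i.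
move: (E z^*) (E z) => [a b] [c d]; apply/eqP; rewrite eq_complex /=.
by apply/andP; split; apply/eqP; ring.
Qed.

Lemma sharp_real_cabs (x : R) : cabs (sharp E x%:C) = cabs (E x%:C).
Proof. by rewrite sharp_real cabs_conj. Qed.

Lemma sharp_upper_cabs z : upper_half_plane z -> cabs (sharp E z) <= cabs (E z).
Proof. by move=> /(HB.2 z)/ltW. Qed.

Lemma companionB_le z : cabs (sharp E z) <= cabs (E z) -> cabs (B z) <= cabs (E z).
Proof.
move=> h; rewrite /B /companionB cabsM cabs_half_i.
by have := cabsB (E z) (sharp E z); lra.
Qed.

Lemma companionB_le_real (x : R) : cabs (B x%:C) <= cabs (E x%:C).
Proof. by apply: companionB_le; rewrite sharp_real_cabs. Qed.

Lemma companionA_le_real (x : R) : cabs (A x%:C) <= cabs (E x%:C).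
Proof.
rewrite companionA_real cabs_real; exact: Re_cabs.
Qed.

Lemma HB_le_companions (x : R) : cabs (E x%:C) <= cabs (A x%:C) + cabs (B x%:C).
Proof.
have := cabsB (A x%:C) ('i * B x%:C).
by rewrite -companion_decomp (cabsM 'i) cabs_i mul1r.
Qed.

(* |sin phi(x)| for the phase phi of E. *)
Definition sin_phase (x : R) : R := cabs (B x%:C) / cabs (E x%:C).

Lemma sin_phase_ge0 x : 0 <= sin_phase x.
Proof. by rewrite divr_ge0// cabs_ge0. Qed.

Lemma sin_phase_le1 x : sin_phase x <= 1.
Proof.
by rewrite ler_pdivrMr ?cabs_gt0 ?HB_neq0_real// mul1r companionB_le_real.
Qed.

(** On the real line [sharp E] is the conjugate of E, so (B/E)' = (i/2) (conj(E) E' - conj(E') E) /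
    E^2, of modulus at most M. The factor 2 is that of [lipschitz_line]. *)
Lemma sin_phase_lipschitz x y : `|sin_phase y - sin_phase x| <= 2 * M * `|y - x|.
Proof.
have Eq u : sin_phase u = cabs (B u%:C / E u%:C).
  by rewrite cabsM cabsV.
have ch (a b : C) : `|cabs a - cabs b| <= cabs (a - b).
  have := cabsD (a - b) b; have := cabsD (b - a) a.
  by rewrite !subrK (cabs_distC b) ler_norml => h1 h2; apply/andP; split; lra.
rewrite !Eq (le_trans (ch _ _))//.
wlog xy : x y / x < y.
  move=> H; have [xy|yx|->] := ltgtP x y; first exact: H.
    by rewrite cabs_distC distrC; exact: H.
  by rewrite !subrr cabs0 normr0 mulr0.
rewrite (gtr0_norm (x := y - x)) ?subr_gt0//.
have dBE (s : R) : is_derive (s%:C : C) 1 (fun z => B z / E z)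
   ((B s%:C) *: (- (E s%:C) ^- 2 *: derive1 E s%:C) + (E s%:C)^-1 *: derive1 B s%:C).
  have dE := entire_is_derive s%:C eE.
  have dB := entire_is_derive s%:C entire_companionB.
  have dV : is_derive (s%:C : C) 1 (fun z => (E z)^-1) (- (E s%:C) ^- 2 *: derive1 E s%:C).
    split; first by apply: derivableV; [exact: HB_neq0_real|exact: eE].
    by rewrite deriveV; [rewrite derive1E|exact: HB_neq0_real|exact: eE].
  exact: is_deriveM dB dV.
have := @lipschitz_line R (fun z => B z / E z) 0 1 x y M xy.
rewrite !add0r !mulr1; apply => s _; rewrite add0r mulr1.
  by have [] := dBE s.
rewrite mulr1 (@derive_val _ _ _ _ _ _ _ (dBE s)).
have E0 := HB_neq0_real s.
have [ac acE] : exists ac : C, ac = (E s%:C)^* by eexists.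
have [bc bcE] : exists bc : C, bc = (derive1 E s%:C)^* by eexists.
have SE : sharp E s%:C = ac by rewrite acE; exact: sharp_real.
have dBv : derive1 B s%:C = 'i / 2 * (derive1 E s%:C - bc).
  have dS : is_derive (s%:C : C) 1 (sharp E) bc.
    by rewrite bcE; apply: is_derive_sharp; rewrite conjCr; exact: entire_is_derive.
  have dE := entire_is_derive s%:C eE.
  have := is_deriveZ ('i / 2 : C) (is_deriveB dE dS).
  by move=> H; rewrite derive1E; exact: (@derive_val _ _ _ _ _ _ _ H).
have acN : cabs ac = cabs (E s%:C) by rewrite acE cabs_conj.
have bcN : cabs bc = cabs (derive1 E s%:C) by rewrite bcE cabs_conj.
have -> : (B s%:C) *: (- (E s%:C) ^- 2 *: derive1 E s%:C) + (E s%:C)^-1 *: derive1 B s%:C =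
  'i / 2 * (ac * derive1 E s%:C - bc * E s%:C) / E s%:C ^+ 2.
  rewrite dBv /B /companionB SE /GRing.scale /=.
  by field.
rewrite cabsM cabsV cabsX ler_pdivrMr ?exprn_gt0 ?cabs_gt0// cabsM cabs_half_i.
have := cabsB (ac * derive1 E s%:C) (bc * E s%:C).
rewrite !cabsM acN bcN.
have := HB_derive_bound_real s; have := cabs_ge0 (E s%:C).
move: (cabs (E s%:C)) (cabs (derive1 E s%:C)) (cabs (_ - _)) => a b c a0 ba cab.
have : a * b <= a * (M * a) by rewrite ler_wpM2l.
by rewrite expr2; lra.
Qed.

End HermiteBiehlerFunctions.

Section RealLine.
Variable R : realType.
Local Notation C := (Cplx R).
Implicit Types (f : C -> C).

Lemma is_derive_real_Re f (d : C) (s : R) : is_derive (s%:C : C) 1 f d ->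
  is_derive s 1 (fun u : R => complex.Re (f u%:C)) (complex.Re d).
Proof.
move=> fd; have fd' : is_derive (0 + s%:C * 1 : C) 1 f d by rewrite add0r mulr1.
have := is_derive_line_Re fd'; rewrite mulr1.
by under eq_fun do rewrite add0r mulr1.
Qed.

Lemma is_derive_real_Im f (d : C) (s : R) : is_derive (s%:C : C) 1 f d ->
  is_derive s 1 (fun u : R => complex.Im (f u%:C)) (complex.Im d).
Proof.
move=> fd; have fd' : is_derive (0 + s%:C * 1 : C) 1 f d by rewrite add0r mulr1.
have := is_derive_line_Im fd'; rewrite mulr1.
by under eq_fun do rewrite add0r mulr1.
Qed.

End RealLine.

(** * The quotient B / A and the derivative of the phase *)

Section CompanionQuotient.
Variable R : realType.
Local Notation C := (Cplx R).
Variables (E : C -> C) (M : R).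
Hypothesis HB : hermite_biehler E.
Hypothesis ME : forall z, upper_half_plane z -> cabs (derive1 E z / E z) <= M.

Let B := companionB E.
Let A z : C := (E z + sharp E z) / 2.
(** On the real line A = Re E and B = - Im E, so [W] is tan phi there. *)
Let W z : C := B z / A z.

Let eE : entire E. Proof. by case: HB. Qed.
Let eB : entire B. Proof. exact: entire_companionB. Qed.
Let eA : entire A. Proof. exact: entire_companionA. Qed.

Let BE (x : R) : B x%:C = (- complex.Im (E x%:C))%:C.
Proof. exact: companionB_real. Qed.

Let AE (x : R) : A x%:C = (complex.Re (E x%:C))%:C.
Proof. exact: companionA_real. Qed.

(* phi'(t) for the phase phi of E. *)
Definition phase_speed (t : R) : R := - complex.Im (derive1 E t%:C / E t%:C).

Lemma companionB_derive_real (t : R) : complex.Im (derive1 B t%:C) = 0 /\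
  complex.Re (derive1 B t%:C) = - complex.Im (derive1 E t%:C).
Proof.
have dB := entire_is_derive t%:C eB; have dE := entire_is_derive t%:C eE.
have BR u : complex.Re (B u%:C) = - complex.Im (E u%:C) by rewrite BE.
have BI u : complex.Im (B u%:C) = 0 by rewrite BE.
split.
  have := is_derive_real_Im dB; under eq_fun do rewrite BI; move=> H.
  by rewrite -(@derive_val _ _ _ _ _ _ _ H) derive_cst.
have := is_derive_real_Re dB; under eq_fun do rewrite BR; move=> H.
have H2 := is_deriveN (is_derive_real_Im dE).
by rewrite -(@derive_val _ _ _ _ _ _ _ H) (@derive_val _ _ _ _ _ _ _ H2).
Qed.

Section AtZero.
Variable t : R.
Hypothesis Bt : B t%:C = 0.

Lemma zero_ImE : complex.Im (E t%:C) = 0.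
Proof.
by have := Bt; rewrite BE => -[/eqP]; rewrite oppr_eq0 => /eqP.
Qed.

Lemma zero_E_real : E t%:C = (complex.Re (E t%:C))%:C.
Proof. by have := zero_ImE; case: (E _) => a b /= ->. Qed.

Lemma zero_ReE_neq0 : complex.Re (E t%:C) != 0.
Proof.
have := HB_neq0_real HB ME t; rewrite zero_E_real; apply: contraNneq => /= ->.
by [].
Qed.

Lemma zero_A : A t%:C = E t%:C.
Proof. by rewrite AE -zero_E_real. Qed.

Lemma phase_speed_zero :
  phase_speed t = - complex.Im (derive1 E t%:C) / complex.Re (E t%:C).
Proof.
rewrite /phase_speed zero_E_real -fmorphV /=.
case: (derive1 _ _) => a b /=; by rewrite mulr0 add0r mulNr.
Qed.

Lemma zero_derive_B : derive1 B t%:C = (phase_speed t)%:C * E t%:C.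
Proof.
rewrite phase_speed_zero {2}zero_E_real -rmorphM /=.
rewrite divfK ?zero_ReE_neq0//; have := companionB_derive_real t.
by move: (derive1 B t%:C) (derive1 E t%:C) => [a b] [c d] /= [-> ->].
Qed.

(* Im (B / A) has the sign of |E|^2 - |E^*|^2, hence of Im z. *)
Let ImW z : A z != 0 ->
  complex.Im (W z) * cabs (E z + sharp E z) ^+ 2 =
  cabs (E z) ^+ 2 - cabs (sharp E z) ^+ 2.
Proof.
move=> A0; have S0 : E z + sharp E z != 0.
  by apply: contraNneq A0 => H; rewrite /A H mul0r.
have : W z * (E z + sharp E z) = 'i * (E z - sharp E z).
  by rewrite /W /A /B /companionB; field.
move: (W z) (E z) (sharp E z) => [w1 w2] [a1 a2] [b1 b2].
rewrite !sqr_cabs => /= -[H1 H2].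
have -> : w2 * ((a1 + b1) ^+ 2 + (a2 + b2) ^+ 2) =
  (w1 * (a2 + b2) + w2 * (a1 + b1)) * (a1 + b1) -
  (w1 * (a1 + b1) - w2 * (a2 + b2)) * (a2 + b2) by ring.
by rewrite H1 H2; ring.
Qed.

Let cabs_lower z : complex.Im z < 0 -> cabs (E z) < cabs (sharp E z).
Proof.
move=> z0; have : upper_half_plane z^*.
  by move: z0; case: z => a b; rewrite /upper_half_plane /= oppr_gt0.
move=> /(HB.2 z^*).
have -> : sharp E z^* = (E z)^* by rewrite /sharp conjcK.
by rewrite cabs_conj /sharp cabs_conj.
Qed.

(** Off the real line |E| and |sharp E| differ strictly, so E + sharp E cannot vanish: zeros of A
    need only be excluded on the real diameter of the disc. *)
Let A_neq0 (r : R) : (forall x : R, `|x - t| <= r -> A x%:C != 0) ->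
  forall z, cabs (z - t%:C) <= r -> A z != 0.
Proof.
move=> Ar z zr; have [z0|z0|z0] := ltgtP 0 (complex.Im z).
- apply/negP => /eqP; have := HB.2 z z0 => H /eqP.
  rewrite /A mulf_eq0 invr_eq0 pnatr_eq0 orbF addr_eq0 => /eqP Ez.
  by move: H; rewrite Ez cabsN ltxx.
- apply/negP => /eqP; have := cabs_lower z0 => H /eqP.
  rewrite /A mulf_eq0 invr_eq0 pnatr_eq0 orbF addr_eq0 => /eqP Ez.
  by move: H; rewrite Ez cabsN ltxx.
have zR : z = (complex.Re z)%:C by move: z0; case: z {zr} => a b /= <-.
by rewrite zR; apply: Ar; rewrite -(cabs_real (complex.Re z - t)) rmorphB /= -zR.
Qed.

Section Disc.
Variable r : R.
Hypothesis r0 : 0 < r.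
Hypothesis Ar : forall x : R, `|x - t| <= r -> A x%:C != 0.

Let dW z : cabs (z - t%:C) <= r -> derivable W z 1.
Proof.
move=> zr; apply: derivableM; first exact: eB.
by apply: derivableV; [exact: A_neq0 zr|exact: eA].
Qed.

Let Wsin x : 0 <= complex.Im (W (t%:C + r%:C * circle_pt x)) * sin x.
Proof.
set z := t%:C + _.
have zr : cabs (z - t%:C) <= r := circle_pt_in_disc _ _ (ltW r0).
have A0 := A_neq0 Ar zr; have H := ImW A0.
have S0 : 0 < cabs (E z + sharp E z) ^+ 2.
  rewrite exprn_gt0// cabs_gt0.
  by apply: contraNneq A0 => H0; rewrite /A H0 mul0r.
have Iz : complex.Im z = r * sin x by rewrite /z /=; ring.
have [s0|s0|s0] := ltgtP 0 (sin x); last by rewrite -s0 mulr0.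
- have zu : upper_half_plane z.
    by change (0 < complex.Im z); rewrite Iz mulr_gt0.
  have h := ltW (HB.2 z zu).
  rewrite mulr_ge0 ?(ltW s0)// -(pmulr_lge0 _ S0) H subr_ge0.
  by rewrite lerXn2r ?nnegrE ?cabs_ge0.
- have h : cabs (E z) <= cabs (sharp E z).
    by apply/ltW/cabs_lower; rewrite Iz pmulr_rlt0.
  rewrite mulr_le0 ?(ltW s0)// -(pmulr_lle0 _ S0) H subr_le0.
  by rewrite lerXn2r ?nnegrE ?cabs_ge0.
Qed.

Lemma derive1_companion_quotient : derive1 W t%:C = (phase_speed t)%:C.
Proof.
have E0 := HB_neq0_real HB ME t.
have A0 : A t%:C != 0 by rewrite zero_A.
have dB := entire_is_derive t%:C eB.
have dA := entire_is_derive t%:C eA.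
have dV : is_derive (t%:C : C) 1 (fun z => (A z)^-1) (- (A t%:C) ^- 2 *: derive1 A t%:C).
  split; first by apply: derivableV; [exact: A0|exact: eA].
  by rewrite deriveV; [rewrite derive1E|exact: A0|exact: eA].
have H : is_derive (t%:C : C) 1 W (B t%:C *: (- (A t%:C) ^- 2 *: derive1 A t%:C)
   + (A t%:C)^-1 *: derive1 B t%:C) := is_deriveM dB dV.
rewrite derive1E (@derive_val _ _ _ _ _ _ _ H) Bt scale0r add0r.
by rewrite zero_derive_B zero_A /GRing.scale /= mulrCA mulVf ?mulr1.
Qed.

Lemma phase_speed_gt0 : 0 < phase_speed t.
Proof.
have := typically_real_derive_gt0 r0 dW Wsin.
rewrite derive1_companion_quotient /=; apply.
set z := t%:C + _.
have zr : cabs (z - t%:C) <= r.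
  by rewrite /z addrAC subrr add0r cabsM cabs_i mulr1 cabs_real gtr0_norm.
have A0 := A_neq0 Ar zr; have H := ImW A0.
have S0 : 0 < cabs (E z + sharp E z) ^+ 2.
  rewrite exprn_gt0// cabs_gt0.
  by apply: contraNneq A0 => H0; rewrite /A H0 mul0r.
have zu : upper_half_plane z by rewrite /upper_half_plane /z /= mulr1 mul0r !add0r addr0.
rewrite -(pmulr_lgt0 _ S0) H subr_gt0.
by rewrite ltrXn2r ?nnegrE ?cabs_ge0 ?HB.2.
Qed.

Lemma companion_growth (x : R) : `|x - t| <= r / 2 ->
  phase_speed t * `|x - t| / 4 * cabs (A x%:C) <= cabs (B x%:C)
    <= 4 * phase_speed t * `|x - t| * cabs (A x%:C).
Proof.
move=> xr; have r0' := r0.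
have xr' : `|x - t| < r by lra.
have A0 : A x%:C != 0 by apply: Ar; lra.
have := typically_real_growth r0 dW Wsin xr'.
rewrite derive1_companion_quotient /=.
have -> : t%:C + (x - t)%:C = x%:C :> C by rewrite rmorphB addrC subrK.
have -> : W t%:C = 0 by rewrite /W Bt mul0r.
rewrite subr0 => -[S WS].
have e0 := phase_speed_gt0.
have WR : cabs (B x%:C) = `|complex.Re (W x%:C)| * cabs (A x%:C).
  have WW : W x%:C = (complex.Re (W x%:C))%:C.
    rewrite /W BE AE -fmorphV -rmorphM /=.
    by [].
  by rewrite -cabs_real -WW -cabsM /W divfK.
rewrite WR WS normrM.
move: (phase_speed t) e0 (`|x - t|) (normr_ge0 (x - t)) xr xr' => e e0 h h0 hr hr'.
(* For [h <= r / 2] the two distortion factors of [typically_real_growth] lie between 1/2 and 2;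
   their squares give the constants 1/4 and 4. *)
have l1 : 1 / 4 <= (r / (r + h)) ^+ 2.
  have : 1 / 2 <= r / (r + h) by rewrite ler_pdivlMr; lra.
  by move=> k; rewrite (le_trans _ (lerXn2r 2 _ _ k)) ?nnegrE//; lra.
have u1 : (r / (r - h)) ^+ 2 <= 4.
  have k : r / (r - h) <= 2 by rewrite ler_pdivrMr; lra.
  rewrite (le_trans (lerXn2r 2 _ _ k)) ?nnegrE ?divr_ge0//; lra.
move=> /andP[s1 s2].
have S1 : e / 4 <= S.
  apply: le_trans s1; have := ler_wpM2l (ltW e0) l1; lra.
have S2 : S <= 4 * e.
  by apply: le_trans s2 _; have := ler_wpM2l (ltW e0) u1; lra.
have -> : `|S| = S by rewrite ger0_norm//; lra.
have a0 := cabs_ge0 (A x%:C).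
apply/andP; split; rewrite ler_wpM2r//.
  by have := ler_wpM2l h0 S1; lra.
by have := ler_wpM2l h0 S2; lra.
Qed.

End Disc.

(** A disc without zeros of A around [t] exists by continuity, since A(t) = E(t) is not 0. *)
Lemma phase_speed_zero_gt0 : 0 < phase_speed t.
Proof.
have A0 : A t%:C != 0 by rewrite zero_A (HB_neq0_real HB ME).
have Ap : 0 < cabs (A t%:C) by rewrite cabs_gt0.
have : {for (t%:C : C), continuous A} by exact: entire_continuous.
move=> /continuousCP/(_ _ Ap)[d d0 dP].
apply: (@phase_speed_gt0 (d / 2)); first by rewrite divr_gt0.
move=> x xt; apply/negP => /eqP Ax.
have := dP x%:C; rewrite Ax sub0r cabsN ltxx -rmorphB cabs_real.
have h : `|x - t| < d by lra.
by move=> H; have := H h.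
Qed.

(** Reality of e^(i phi) E on the line reads cos phi Im E + sin phi Re E = 0. This is differentiated
    at [t], where Im E and hence sin phi vanish. Since phi is real on the line, phi' has no
    imaginary part, so the equality holds in [C]. *)
Lemma phase_derive (phi : C -> C) : is_phase E phi ->
  derive1 phi t%:C = (phase_speed t)%:C.
Proof.
(* The hypothesis of [aux] is the differentiated relation as the product rule delivers it, with the
   zero values of sin phi(t) and Im E(t) already inserted. *)
have aux (p i e c l : R) : c != 0 -> e != 0 ->
    0 = c * i + 0 * (- 0 * p) + (0 * l + e * (c * p)) -> p == - i / e.
  move=> c0 e0 eq0; have : c * (i + e * p) = 0 by rewrite eq0; ring.
  move/eqP; rewrite mulf_eq0 (negbTE c0) /= => /eqP eq1.
  by apply/eqP/(mulIf e0); rewrite divfK//; lra.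
move=> [[U [Uo UR Uh]] ph].
have dphi : is_derive (t%:C : C) 1 phi (derive1 phi t%:C).
  by rewrite derive1E; apply: derivableP; exact: (Uh _ (UR t)).
have dE := entire_is_derive t%:C eE.
have phR (u : R) : phi u%:C = (complex.Re (phi u%:C))%:C.
  by rewrite RRe_real//; case: (ph u).
have ImD : complex.Im (derive1 phi t%:C) = 0.
  have := is_derive_real_Im dphi.
  have -> : (fun u : R => complex.Im (phi u%:C)) = cst 0.
    by apply/funext => u; rewrite phR.
  by move=> H; rewrite -(@derive_val _ _ _ _ _ _ _ H) derive_cst.
have dg := is_derive_real_Re dphi.
set g := (fun u : R => complex.Re (phi u%:C)) in dg.
have rel (u : R) : cos (g u) * complex.Im (E u%:C) + sin (g u) * complex.Re (E u%:C) = 0.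
  have [_] := ph u; rewrite phR -/(g u).
  have -> : cexp ('i * (g u)%:C) = cos (g u) +i* sin (g u).
    have -> : 'i * (g u)%:C = 0 +i* g u :> C.
      by apply/eqP; rewrite eq_complex /=; apply/andP; split; apply/eqP; ring.
    rewrite /cexp /= expR0.
    by apply/eqP; rewrite eq_complex /=; apply/andP; split; apply/eqP; ring.
  by case: (E u%:C) => a b; rewrite complex_real => /eqP /=.
have dR := is_derive_real_Re dE; have dI := is_derive_real_Im dE.
have dc := is_derive1_comp (is_derive_cos (g t)) dg.
have ds := is_derive1_comp (is_derive_sin (g t)) dg.
have := is_deriveD (is_deriveM dc dI) (is_deriveM ds dR).
set F := (X in is_derive _ _ X _).
have -> : F = cst 0 by apply/funext => u; exact: rel.
move=> H; have := @derive_val _ _ _ _ _ _ _ H; rewrite derive_cst.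
rewrite /GRing.scale /= zero_ImE => EQ.
have sg : sin (g t) = 0.
  have := rel t; rewrite zero_ImE mulr0 add0r => /eqP.
  by rewrite mulf_eq0 (negbTE zero_ReE_neq0) orbF => /eqP.
have cg : cos (g t) != 0.
  apply/negP => /eqP c0; have := cos2Dsin2 (g t); rewrite c0 sg expr0n addr0 => /eqP.
  by rewrite eq_sym oner_eq0.
apply/eqP; rewrite eq_complex /= ImD eqxx andbT phase_speed_zero.
have k0 := zero_ReE_neq0.
by move: EQ; rewrite sg; exact: aux.
Qed.

End AtZero.

End CompanionQuotient.

(** * Membership in de Branges spaces *)

Section IntegralBounds.
Variable R : realType.
Notation mu := (@lebesgue_measure R).
Implicit Types (h : R -> R) (a b c t rho k : R).

Lemma integral_ge_itv h a b c : continuous h -> (forall x, 0 <= h x) ->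
  a <= b -> 0 <= c -> (forall x, a <= x <= b -> c <= h x) ->
  ((c * (b - a))%:E <= \int[mu]_(x in setT) (h x)%:E)%E.
Proof.
move=> ch h0 ab c0 hc.
have mh : measurable_fun [set: R] (fun x : R => (h x)%:E).
  by apply/measurable_EFinP; exact: continuous_measurable_fun.
have mI : measurable (`[a, b]%classic : set R) by exact: measurable_itv.
apply: (@le_trans _ _ (\int[mu]_(x in `[a, b]) (h x)%:E)%E); last first.
  by apply: ge0_subset_integral => // x _; rewrite lee_fin.
apply: (@le_trans _ _ (\int[mu]_(x in `[a, b]) (cst c%:E) x)%E).
  rewrite integral_cst//= lebesgue_measure_itv /= lte_fin.
  move: ab; rewrite le_eqVlt => /orP[/eqP->|ab].
    by rewrite ltxx subrr mulr0 mule0.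
  by rewrite ab -EFinB -EFinM.
apply: ge0_le_integral => //=.
- by apply: measurable_funS mh.
Qed.

(** Substitution u = (x - t) / rho in the integral of 1 / (1 + u^2), itself obtained from the
    half-line by evenness. *)
Lemma integral_lorentz t rho : 0 < rho ->
  (\int[mu]_(x in setT) ((rho ^+ 2 + (x - t) ^+ 2)^-1)%:E = (pi / rho)%:E)%E.
Proof.
move=> r0; have ri : 0 < rho^-1 by rewrite invr_gt0.
pose F (x : R) : R := rho^-1 * (x - t).
have dF (x : R) : is_derive x 1 F rho^-1.
  have h := is_deriveB (is_derive_id x (1 : R)) (is_derive_cst t x (1 : R)).
  by have := is_deriveZ rho^-1 h; rewrite subr0 /GRing.scale /= mulr1.
have dFE : F^`()%classic = cst rho^-1.
  by apply/funext => x; rewrite derive1E; exact: (@derive_val _ _ _ _ _ _ _ (dF x)).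
have evn : (\int[mu]_x ((oneDsqr x)^-1)%:E = pi%:E :> \bar R)%E.
  rewrite ge0_symfun_integralT.
  - rewrite -set_itvcy integral0y_oneDsqr -EFinM; congr (_%:E).
    by rewrite mulrC divfK.
  - by move=> x; rewrite invr_ge0 (le_trans ler01)// oneDsqr_ge1.
  - exact: continuous_oneDsqrV.
  - by move=> x; rewrite /oneDsqr /= sqrrN.
have := @increasing_ge0_integration_by_substitutionT R F (fun x => (oneDsqr x)^-1).
rewrite evn => S.
have {}S : (pi%:E = \int[mu]_x ((((fun x => (oneDsqr x)^-1) \o F) * F^`()%classic) x)%:E)%E.
  apply: S.
  - by move=> x y xy; rewrite /F ltr_pM2l// ltrD2r.
  - by rewrite dFE => x; exact: cvg_cst.
  - by rewrite dFE; apply/cvg_ex; exists rho^-1; exact: cvg_cst.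
  - by rewrite dFE; apply/cvg_ex; exists rho^-1; exact: cvg_cst.
  - by move=> x; have [] := dF x.
  - apply/cvgrNyPle => A; near=> x.
    rewrite /F mulrC ler_pdivrMr// lerBlDr.
    by near: x; apply: nbhs_ninfty_le; rewrite num_real.
  - apply/cvgryPge => A; near=> x.
    rewrite /F mulrC ler_pdivlMr// lerBrDr.
    by near: x; apply: nbhs_pinfty_ge; rewrite num_real.
  - exact: continuous_oneDsqrV.
  - by move=> x; rewrite invr_ge0 (le_trans ler01)// oneDsqr_ge1.
have E x : (rho ^+ 2 + (x - t) ^+ 2)^-1 =
    rho^-1 * ((((fun x => (oneDsqr x)^-1) \o F) * F^`()%classic) x).
  rewrite dFE /= /oneDsqr /F /GRing.mul /=.
  have d1 : 1 + (rho^-1 * (x - t)) ^+ 2 != 0.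
    by rewrite gt_eqF// ltr_pwDl// sqr_ge0.
  have d2 : rho ^+ 2 + (x - t) ^+ 2 != 0.
    by rewrite gt_eqF// ltr_pwDl ?exprn_gt0// sqr_ge0.
  have -> : rho ^+ 2 + (x - t) ^+ 2 = rho ^+ 2 * (1 + (rho^-1 * (x - t)) ^+ 2).
    by field; rewrite gt_eqF.
  rewrite -[RHS]/(rho^-1 * ((1 + (rho^-1 * (x - t)) ^+ 2)^-1 * rho^-1)).
  by rewrite invfM -exprVn expr2; ring.
under eq_integral do rewrite E EFinM.
rewrite ge0_integralZl_EFin//.
- by rewrite -S -EFinM mulrC.
- move=> x _; rewrite lee_fin dFE /GRing.mul /= mulr_ge0// ?ltW//.
- apply/measurable_EFinP; apply: continuous_measurable_fun => x.
  rewrite dFE; apply: cvgM; last exact: cvg_cst.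
  apply: continuous_comp; last exact: continuous_oneDsqrV.
  by apply: is_derive_continuous; exact: dF.
- exact: ltW.
Unshelve. all: by end_near. Qed.

(** The upper bounds for the norms of the test functions go through this majorant, which makes their
    dependence on the scale [rho] explicit. *)
Lemma integral_le_lorentz h t rho k : continuous h -> (forall x, 0 <= h x) ->
  0 < rho -> 0 <= k ->
  (forall x, h x <= k / (rho ^+ 2 + (x - t) ^+ 2)) ->
  (\int[mu]_(x in setT) (h x)%:E <= (k * (pi / rho))%:E)%E.
Proof.
move=> ch h0 r0 k0 hk.
have den x : 0 < rho ^+ 2 + (x - t) ^+ 2.
  by rewrite ltr_pwDl ?exprn_gt0// sqr_ge0.
have ml : measurable_fun [set: R] (fun x : R => (rho ^+ 2 + (x - t) ^+ 2)^-1).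
  apply: continuous_measurable_fun => x; apply: cvgV; first by rewrite gt_eqF.
  apply: cvgD; first exact: cvg_cst.
  by apply: cvgM; apply: cvgB; (exact: cvg_id || exact: cvg_cst).
rewrite EFinM -(integral_lorentz t r0) -ge0_integralZl_EFin//; last 2 first.
- by move=> x _; rewrite lee_fin invr_ge0 ltW.
- exact/measurable_EFinP.
apply: ge0_le_integral => //=.
- by move=> x _; rewrite lee_fin.
- by apply/measurable_EFinP; exact: continuous_measurable_fun.
- by apply: measurable_funeM; exact/measurable_EFinP.
- by move=> x _; rewrite -EFinM lee_fin.
Qed.

End IntegralBounds.

Section BoundedType.
Variable R : realType.
Local Notation C := (Cplx R).

Lemma upper_half_plane_open (z : C) : upper_half_plane z ->
  \near z, upper_half_plane z.
Proof.
rewrite /upper_half_plane /= => z0.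
have := near_cabs z z0; apply: filterS => v vz.
have := Im_cabs (v - z); rewrite raddfB /= ler_norml => /andP[h1 h2].
by rewrite /upper_half_plane /=; lra.
Qed.

Lemma holomorphic_on_upper_eq (f g : C -> C) :
  (forall z, upper_half_plane z -> f z = g z) ->
  holomorphic_on (@upper_half_plane R) f -> holomorphic_on (@upper_half_plane R) g.
Proof.
move=> fg hf z zu; apply: (@near_eq_derivable _ _ _ f); last exact: hf.
by have := upper_half_plane_open zu; apply: filterS => v /fg.
Qed.

Lemma upper_sub_neq0 (z : C) (t : R) : upper_half_plane z -> z - t%:C != 0.
Proof.
move=> z0; apply: contraTneq z0 => /subr0_eq ->.
by rewrite /upper_half_plane /= ltxx.
Qed.

(* f is the quotient of q / (z - t + i) by (z - t) / (z - t + i). *)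
Lemma bounded_type_simple_pole (f q : C -> C) (t : R) :
  holomorphic_on (@upper_half_plane R) q ->
  (forall z, upper_half_plane z -> cabs (q z) <= 1) ->
  (forall z, upper_half_plane z -> f z = q z / (z - t%:C)) ->
  bounded_type_nonpos_mean_type f.
Proof.
move=> hq q1 fq.
have dl (c : C) (z : C) : derivable (fun z => z - c) z 1.
  by apply: derivableB; [exact: derivable_id|exact: derivable_cst].
have hf : holomorphic_on (@upper_half_plane R) f.
  apply: (@holomorphic_on_upper_eq (fun z => q z / (z - t%:C))).
    by move=> z /fq.
  move=> z zu; apply: derivableM; first exact: hq.
  by apply: derivableV; [exact: upper_sub_neq0|exact: dl].
have big (z : C) : upper_half_plane z -> 1 <= cabs (z - (t%:C - 'i)) /\
    cabs (z - t%:C) <= cabs (z - (t%:C - 'i)).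
  case: z => a b; rewrite /upper_half_plane /= => b0; split.
    apply: le_trans (Im_cabs _) => /=.
    by rewrite ger0_norm; lra.
  rewrite -(ler_pXn2r (n := 2)) ?nnegrE ?cabs_ge0// !sqr_cabs /=.
  by rewrite lerD//; [|rewrite lerXn2r ?nnegrE//]; lra.
have big0 (z : C) : upper_half_plane z -> z - (t%:C - 'i) != 0.
  by move=> /big[h _]; rewrite -cabs_gt0; lra.
split.
  split => //.
  exists (fun z => q z / (z - (t%:C - 'i))), (fun z => (z - t%:C) / (z - (t%:C - 'i))).
  split.
  - split.
      move=> z zu; apply: derivableM; first exact: hq.
      by apply: derivableV; [exact: big0|exact: dl].
    exists 1 => z zu; have [h _] := big z zu.
    rewrite cabsM cabsV ler_pdivrMr; last by lra.
    by rewrite mul1r (le_trans (q1 _ zu)).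
  - split.
      move=> z zu; apply: derivableM; first exact: dl.
      by apply: derivableV; [exact: big0|exact: dl].
    exists 1 => z zu; have [h h'] := big z zu.
    rewrite cabsM cabsV ler_pdivrMr; last by lra.
    by rewrite mul1r.
  - have iu : upper_half_plane ('i : C) by rewrite /upper_half_plane /=.
    exists 'i => //.
    by rewrite mulf_neq0 ?invr_eq0 ?upper_sub_neq0 ?big0.
  - move=> z zu _; rewrite fq//.
    have := big0 _ zu; have := upper_sub_neq0 t zu.
    move: (z - t%:C) (z - (t%:C - 'i)) (q z) => a b c a0 b0.
    by field; rewrite a0 b0.
(* For y > 1, |f(iy)| <= 1 / |iy - t| and |iy - t| >= y, so |f(iy)| < 1 and its logarithm is
   negative; the upper limit is at most the supremum over y > 1. *)
rewrite /mean_type limf_esupE.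
apply: (@le_trans _ _ (ereal_sup ((fun y : R => ((y^-1)%:E * lne (cabs (f (0 +i* y)))%:E)%E)
   @` [set y : R | 1 < y]))).
  apply: ereal_inf_lbound; exists [set y : R | 1 < y] => //.
  by exists 1; split; [exact: num_real|].
apply: ge_ereal_sup => _ [y /= y1 <-].
have yu : upper_half_plane (0 +i* y : C) by rewrite /upper_half_plane /=; lra.
apply: mule_ge0_le0; first by rewrite lee_fin invr_ge0; lra.
apply/ltW; rewrite -/(lne (cabs (f (0 +i* y)))%:E) lne_lt0 lte_fin fq// cabsM cabsV.
have h : y <= cabs (0 +i* y - t%:C).
  apply: le_trans (Im_cabs _) => /=.
  by rewrite subr0 ger0_norm//; lra.
rewrite ltr_pdivrMr; last by lra.
by rewrite mul1r (le_lt_trans (q1 _ yu))//; lra.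
Qed.

End BoundedType.

Section IteratedDerivative.
Variable R : realType.
Local Notation C := (Cplx R).
Implicit Types (f h : C -> C).

Lemma is_derive_powC f (z d : C) m : is_derive z 1 f d ->
  is_derive z 1 (fun z => f z ^+ m.+1) (m.+1%:R * f z ^+ m * d).
Proof.
move=> fd; elim: m => [|m IH].
  by under eq_fun do rewrite expr1; rewrite expr0 mulr1 mul1r.
have := is_deriveM fd IH.
have -> : f * (fun z => f z ^+ m.+1) = (fun z => f z ^+ m.+2).
  by apply/funext => u; rewrite exprS; exact: erefl.
rewrite /GRing.scale /=.
have -> : f z * (m.+1%:R * f z ^+ m * d) + f z ^+ m.+1 * d = m.+2%:R * f z ^+ m.+1 * d.
  by rewrite exprS -[m.+2%:R]natr1; ring.
by [].
Qed.

(** Each derivative takes away one factor [f]: the next cofactor is [(n - j) f' g + f g'], whose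
    second term vanishes at the zeros of [f]. Tracking [g] on these zeros is all that the sampling
    sum asks for. *)
Lemma derive1n_powM f h n j : entire f -> entire h -> (j <= n)%N ->
  exists g, [/\ entire g,
    (forall z, derive1n j (fun z => f z ^+ n * h z) z = f z ^+ (n - j) * g z) &
    forall z, f z = 0 -> g z = (n ^_ j)%:R * derive1 f z ^+ j * h z].
Proof.
move=> ef eh.
have product_rule (a' a d b k : C) m :
    b ^+ m.+1 *: a' + a *: (k * b ^+ m * d) = b ^+ m * (k * d * a + b * a').
  by rewrite exprS /GRing.scale /=; ring.
elim: j => [_|j IH jn].
  by exists h; split=> // z; rewrite ?subn0// ffactn0 expr0 !mul1r.
have [g [eg gE g0]] := IH (ltnW jn).
have nj : (n - j = (n - j.+1).+1)%N by rewrite -subnSK.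
exists (fun z => (n - j)%:R * derive1 f z * g z + f z * derive1 g z); split.
- have e1 : entire (fun z => (n - j)%:R * derive1 f z * g z).
    have ec : entire (fun=> (n - j)%:R : C) by exact: entire_cst.
    have e3 := entireM ec (entire_derive1 ef).
    have e4 := entireM e3 eg.
    exact: e4.
  have e2 : entire (fun z => f z * derive1 g z) by exact: (entireM ef (entire_derive1 eg)).
  exact: entireD e1 e2.
- move=> z; rewrite derive1nS.
  have -> : derive1n j (fun z => f z ^+ n * h z) = (fun z => f z ^+ (n - j) * g z).
    by apply/funext.
  have df := is_derive_powC (n - j.+1) (entire_is_derive z ef).
  have H := is_deriveM df (entire_is_derive z eg).
  rewrite derive1E nj.
  transitivity (f z ^+ (n - j.+1).+1 *: derive1 g z +
    g z *: ((n - j.+1).+1%:R * f z ^+ (n - j.+1) * derive1 f z)).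
    exact: (@derive_val _ _ _ _ _ _ _ H).
  exact: product_rule.
- move=> z fz; rewrite fz mul0r addr0 g0// ffactnSr natrM exprS; ring.
Qed.

End IteratedDerivative.

(** * Lower bound for the kernel on the diagonal *)

Section ReproducingKernel.
Variable R : realType.
Local Notation C := (Cplx R).
Notation mu := (@lebesgue_measure R).

Lemma continuous_entire_real (F : C -> C) : entire F ->
  continuous (fun x : R => F x%:C).
Proof.
move=> eF; have := @continuous_entire_line R F 0 1 eF.
by under eq_fun do rewrite add0r mulr1.
Qed.

Lemma continuous_dB_density (F G : C -> C) : entire F -> entire G ->
  (forall x : R, G x%:C != 0) ->
  continuous (fun x : R => cabs (F x%:C) ^+ 2 / cabs (G x%:C) ^+ 2).
Proof.
move=> eF eG G0 x.
have cF : (fun x : R => cabs (F x%:C)) @ x --> cabs (F x%:C).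
  by apply: cvg_cabs; exact: (continuous_entire_real eF).
have cG : (fun x : R => cabs (G x%:C)) @ x --> cabs (G x%:C).
  by apply: cvg_cabs; exact: (continuous_entire_real eG).
apply: cvgM; first by apply: cvgM; exact: cF.
apply: cvgV; first by rewrite expf_neq0// cabs_eq0.
by apply: cvgM; exact: cG.
Qed.

Variables (E : C -> C) (K : C -> C -> C).
Hypothesis eE : entire E.
Hypothesis E0 : forall x : R, E x%:C != 0.

Let dens (F : C -> C) (x : R) : R := cabs (F x%:C) ^+ 2 / cabs (E x%:C) ^+ 2.

Let dens_ge0 F x : 0 <= dens F x.
Proof. by rewrite divr_ge0// sqr_ge0. Qed.

Let dens_integrable F : dB_space E F -> mu.-integrable setT (EFin \o dens F).
Proof.
move=> [eF nF _ _]; apply/integrableP; split.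
  apply/measurable_EFinP; apply: continuous_measurable_fun.
  exact: continuous_dB_density.
apply: le_lt_trans nF; rewrite le_eqVlt; apply/orP; left; apply/eqP.
by apply: eq_integral => x _ /=; rewrite ger0_norm// dens_ge0.
Qed.

Lemma Re_dB_inner_diag F : complex.Re (dB_inner E F F) =
  \int[mu]_(x in setT) (cabs (F x%:C) ^+ 2 / cabs (E x%:C) ^+ 2).
Proof.
rewrite /dB_inner /=; apply: eq_Rintegral => x _.
by rewrite conjM_cabs -rmorphM.
Qed.

Hypothesis KE : is_reproducing_kernel E K.

Lemma kernel_diag (t : R) : complex.Re (K t%:C t%:C) =
  \int[mu]_(x in setT) dens (K t%:C) x.
Proof. by have [hK rK] := KE t%:C; rewrite (rK _ hK) Re_dB_inner_diag. Qed.

Lemma kernel_diag_ge0 (t : R) : 0 <= complex.Re (K t%:C t%:C).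
Proof. by rewrite kernel_diag; apply: Rintegral_ge0 => x _; exact: dens_ge0. Qed.

(* AM-GM bounds the inner product by (l ||F||^2 + ||K_t||^2 / l) / 2 for every
   l > 0, separately for its real and imaginary parts. *)
Lemma kernel_diag_lower (F : C -> C) (t U : R) : dB_space E F -> 0 < U ->
  (dB_norm2 E F <= U%:E)%E ->
  cabs (F t%:C) ^+ 2 <= 4 * U * complex.Re (K t%:C t%:C).
Proof.
move=> hF U0 FU; have [hK rK] := KE t%:C.
have iF := dens_integrable hF; have iK := dens_integrable hK.
have [eF _ _ _] := hF; have [eK _ _ _] := hK.
have Ia : \int[mu]_(x in setT) dens F x <= U.
  rewrite -lee_fin /Rintegral fineK//.
  exact: integrable_fin_num.
rewrite kernel_diag; set Ib := Rintegral _ _ _.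
set Ia' := Rintegral mu setT (dens F) in Ia.
have key (l : R) : 0 < l -> cabs (F t%:C) <= l * U + Ib / l.
  move=> l0.
  pose m (x : R) : R := l / 2 * dens F x + (2 * l)^-1 * dens (K t%:C) x.
  have im1 : mu.-integrable setT (EFin \o (fun x => l / 2 * dens F x)).
    have := @integrableZl _ _ _ mu setT measurableT (l / 2) _ iF.
    by apply: eq_integrable => // x _ /=; rewrite EFinM.
  have im2 : mu.-integrable setT (EFin \o (fun x => (2 * l)^-1 * dens (K t%:C) x)).
    have := @integrableZl _ _ _ mu setT measurableT (2 * l)^-1 _ iK.
    by apply: eq_integrable => // x _ /=; rewrite EFinM.
  have im : mu.-integrable setT (EFin \o m).
    have := integrableD measurableT im1 im2.
    by apply: eq_integrable => // x _ /=; rewrite /m EFinD.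
  have m0 x : 0 <= m x.
    by rewrite addr_ge0// mulr_ge0// ?dens_ge0// ?invr_ge0 ?divr_ge0// ?mulr_ge0// ltW.
  have Im : \int[mu]_(x in setT) m x = l / 2 * Ia' + (2 * l)^-1 * Ib.
    rewrite /m RintegralD// RintegralZl// RintegralZl//.
  pose h (x : R) : C := F x%:C * (K t%:C x%:C)^* * ((cabs (E x%:C) ^+ 2)^-1)%:C.
  have hm x : cabs (h x) <= m x.
    rewrite /h !cabsM cabs_conj cabs_real ger0_norm ?invr_ge0 ?sqr_ge0//.
    rewrite /m /dens.
    have e0 : 0 <= (cabs (E x%:C) ^+ 2)^-1 by rewrite invr_ge0 sqr_ge0.
    move: (cabs (F _)) (cabs (K _ _)) ((cabs (E x%:C) ^+ 2)^-1) e0 => a b e e0.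
    rewrite !mulrA -mulrDl ler_wpM2r//.
    rewrite -subr_ge0.
    have -> : l / 2 * a * a + (2 * l)^-1 * b * b - a * b = (l * a - b) ^+ 2 / (2 * l).
      by field; rewrite gt_eqF.
    by rewrite divr_ge0 ?sqr_ge0// mulr_ge0// ltW.
  have ch : continuous h.
    move=> x; apply: cvgM; first apply: cvgM.
    - exact: continuous_entire_real.
    - by apply: cvg_conj; exact: (continuous_entire_real eK).
    apply: cvg_real; apply: cvgV; first by rewrite expf_neq0// cabs_eq0.
    have cE : (fun x : R => cabs (E x%:C)) @ x --> cabs (E x%:C).
      by apply: cvg_cabs; exact: (continuous_entire_real eE).
    by apply: cvgM; exact: cE.
  have part (g : R -> R) : continuous g -> (forall x, `|g x| <= m x) ->
      `|\int[mu]_(x in setT) g x| <= l / 2 * Ia' + (2 * l)^-1 * Ib.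
    move=> cg gm; rewrite -Im.
    have ig : mu.-integrable setT (EFin \o g).
      apply: le_integrable im => //.
        by apply/measurable_EFinP; exact: continuous_measurable_fun.
      by move=> x _ /=; rewrite lee_fin (ger0_norm (m0 x)).
    apply: le_trans (le_normr_Rintegral measurableT ig) _.
    apply: le_Rintegral => //.
    have := integrable_abse ig.
    by apply: eq_integrable => // x _ /=.
  have := cabs_le_ReIm (F t%:C); rewrite {2 3}(rK _ hF) /dB_inner /= -/h => H.
  apply: le_trans H _.
  have p1 := part (fun x => complex.Re (h x)) (continuous_Re ch) (fun x => le_trans (Re_cabs _) (hm x)).
  have p2 := part (fun x => complex.Im (h x)) (continuous_Im ch) (fun x => le_trans (Im_cabs _) (hm x)).
  apply: le_trans (lerD p1 p2) _.
  have -> : l / 2 * Ia' + (2 * l)^-1 * Ib + (l / 2 * Ia' + (2 * l)^-1 * Ib) =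
    l * Ia' + Ib / l by field; rewrite gt_eqF.
  by rewrite lerD2r ler_wpM2l// ltW.
have Ib0 : 0 <= Ib by apply: Rintegral_ge0 => x _; exact: dens_ge0.
have := cabs_ge0 (F t%:C); rewrite le_eqVlt => /orP[/eqP <-|c0].
  by rewrite expr0n /= mulr_ge0// mulr_ge0// ltW.
(* This l turns [l U] into |F(t)| / 2, which is absorbed by the left side. As l must be positive,
   F(t) = 0 was treated apart. *)
have := key (cabs (F t%:C) / (2 * U)).
move: (cabs (F t%:C)) c0 => c c0 {}key.
have {key} : c <= c / (2 * U) * U + Ib / (c / (2 * U)).
  by apply: key; rewrite divr_gt0// mulr_gt0.
have -> : c / (2 * U) * U + Ib / (c / (2 * U)) = c / 2 + 2 * U * Ib / c.
  by field; rewrite !gt_eqF.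
rewrite -lerBlDl ler_pdivlMr//.
by rewrite expr2; lra.
Qed.

End ReproducingKernel.

(** * The test functions P^n G with P = B or P = E *)

Section TestFunctions.
Variable R : realType.
Local Notation C := (Cplx R).
Variables (E : C -> C) (M : R).
Hypothesis HB : hermite_biehler E.
Hypothesis ME : forall z, upper_half_plane z -> cabs (derive1 E z / E z) <= M.
Variable t : R.
Let B := companionB E.
Hypothesis Bt : B t%:C = 0.

Let eE : entire E. Proof. by case: HB. Qed.
Let eB : entire B. Proof. exact: entire_companionB. Qed.
Let G := slope B t%:C.
Let eG : entire G. Proof. exact: entire_slope. Qed.
Let E0 x : E x%:C != 0. Proof. exact: (HB_neq0_real HB ME). Qed.

Lemma slope_zero (z : C) : z != t%:C -> G z = B z / (z - t%:C).
Proof. by move=> zt; rewrite /G /slope (negbTE zt) Bt subr0. Qed.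

Lemma slope_at : G t%:C = derive1 B t%:C.
Proof. by rewrite /G /slope eqxx. Qed.

Lemma cabs_slope_at : cabs (G t%:C) = phase_speed E t * cabs (E t%:C).
Proof.
rewrite slope_at (zero_derive_B HB ME Bt) cabsM cabs_real gtr0_norm//.
exact: (phase_speed_zero_gt0 HB ME Bt).
Qed.

Lemma sharp_slope z : sharp G z = G z.
Proof.
have BS w : sharp B w = B w by exact: sharp_companionB.
have [->|zt] := eqVneq z t%:C.
  rewrite sharp_real slope_at.
  have [h _] := companionB_derive_real HB t.
  by move: h; rewrite -/B; move: (derive1 B t%:C) => [a b] /= ->; rewrite oppr0.
have zt' : z^* != t%:C.
  by apply: contraNneq zt => H; rewrite -[z]conjcK H conjCr.
rewrite /sharp (slope_zero zt') (slope_zero zt).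
apply: etrans (conjCM _ _) _; congr (_ * _); first exact: BS.
apply: etrans (fmorphV _ _) _; congr (_^-1).
by case: (z) => a b; apply/eqP; rewrite eq_complex /= oppr0 !addr0 opprK !eqxx.
Qed.

(* The kernel of H(E) at t is a multiple of G; the powers of P = B create zeros
   of order n on the zeros of B, those of P = E create none. *)
Definition test_function (P : C -> C) n (z : C) : C := P z ^+ n * G z.

Let eEn n : entire (fpow E n). Proof. exact: entireX. Qed.
Let En0 n x : fpow E n x%:C != 0. Proof. exact: expf_neq0 (E0 x). Qed.

(** A common majorant, independent of n, for the densities of all [test_function P n] with |P| <=
    |E| on the real line. *)
Definition slope_density (x : R) : R := cabs (G x%:C) ^+ 2 / cabs (E x%:C) ^+ 2.

Lemma slope_density_zero x : x != t ->
  slope_density x = sin_phase E x ^+ 2 / (x - t) ^+ 2.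
Proof.
move=> xt; have xt' : x%:C != t%:C :> C by rewrite (inj_eq (@complexI R)).
rewrite /slope_density slope_zero// cabsM cabsV -rmorphB cabs_real.
rewrite exprMn exprVn real_normK ?num_real// /sin_phase exprMn exprVn -/B.
by rewrite mulrAC.
Qed.

Lemma slope_density_at : slope_density t = phase_speed E t ^+ 2.
Proof.
by rewrite /slope_density cabs_slope_at exprMn mulfK// expf_neq0// cabs_eq0.
Qed.

(** Up to distance [rho] the hypothesis bounds |sin phi| by [k |x - t| / rho]; beyond it |sin phi|
    <= 1 and [rho <= |x - t|] are used. In both regimes [(sin phi * rho)^2] and
    [(sin phi * (x - t))^2] are at most [k^2 (x - t)^2]. At x = t the density is phi'(t)^2. *)
Lemma slope_density_le (rho k : R) : 0 < rho -> 1 <= k ->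
  (forall x, `|x - t| <= rho -> sin_phase E x * rho <= k * `|x - t|) ->
  phase_speed E t * rho <= k ->
  forall x, slope_density x <= (2 * k ^+ 2) / (rho ^+ 2 + (x - t) ^+ 2).
Proof.
move=> r0 k1 hs he x.
have rr : 0 < rho ^+ 2 by rewrite exprn_gt0.
have den : 0 < rho ^+ 2 + (x - t) ^+ 2 by rewrite ltr_pwDl// sqr_ge0.
rewrite ler_pdivlMr//.
have k2 : 1 <= k ^+ 2 by rewrite exprn_ege1.
have [->|xt] := eqVneq x t.
  rewrite slope_density_at subrr expr0n addr0 -exprMn.
  have e0 := phase_speed_zero_gt0 HB ME Bt.
  have : (phase_speed E t * rho) ^+ 2 <= k ^+ 2.
    apply: lerXn2r he; rewrite nnegrE; first by rewrite mulr_ge0 ?ltW.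
    exact: le_trans ler01 k1.
  by lra.
rewrite slope_density_zero//.
have d0 : 0 < (x - t) ^+ 2 by rewrite exprn_even_gt0//= subr_eq0.
rewrite mulrAC ler_pdivrMr//.
have s0 := sin_phase_ge0 E x; have s1 := sin_phase_le1 HB ME x.
have ss : sin_phase E x ^+ 2 <= 1 by rewrite expr_le1.
have s2 : 0 <= sin_phase E x ^+ 2 by rewrite sqr_ge0.
rewrite mulrDr -!exprMn.
have [xr|xr] := lerP `|x - t| rho.
  have h : (sin_phase E x * rho) ^+ 2 <= k ^+ 2 * (x - t) ^+ 2.
    rewrite -(real_normK (num_real (x - t))) -exprMn.
    apply: lerXn2r (hs x xr); rewrite nnegrE mulr_ge0 ?(ltW r0)//.
    exact: le_trans ler01 k1.
  have h2 : (sin_phase E x * (x - t)) ^+ 2 <= k ^+ 2 * (x - t) ^+ 2.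
    by rewrite exprMn ler_wpM2r ?sqr_ge0// (le_trans ss).
  by lra.
have xr2 : rho ^+ 2 <= (x - t) ^+ 2.
  by rewrite -(real_normK (num_real (x - t))) lerXn2r ?nnegrE// ltW.
have h1 : (sin_phase E x * rho) ^+ 2 <= k ^+ 2 * (x - t) ^+ 2.
  by rewrite exprMn ler_pM// ?sqr_ge0// (le_trans ss).
have h2 : (sin_phase E x * (x - t)) ^+ 2 <= k ^+ 2 * (x - t) ^+ 2.
  by rewrite exprMn ler_wpM2r ?sqr_ge0// (le_trans ss).
by lra.
Qed.

Lemma test_density_le P n (x : R) : cabs (P x%:C) <= cabs (E x%:C) ->
  cabs (test_function P n x%:C) ^+ 2 / cabs (fpow E n.+1 x%:C) ^+ 2 <= slope_density x.
Proof.
move=> PE; rewrite /test_function /fpow cabsM !cabsX /slope_density.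
have e0 : 0 < cabs (E x%:C) by rewrite cabs_gt0.
rewrite ler_pdivrMr ?exprn_gt0// exprMn.
have -> : cabs (G x%:C) ^+ 2 / cabs (E x%:C) ^+ 2 * cabs (E x%:C) ^+ n.+1 ^+ 2 =
    cabs (E x%:C) ^+ n ^+ 2 * cabs (G x%:C) ^+ 2.
  have e20 : cabs (E x%:C) ^+ 2 != 0 by rewrite expf_neq0// gt_eqF.
  have -> : cabs (E x%:C) ^+ n.+1 ^+ 2 = cabs (E x%:C) ^+ 2 * cabs (E x%:C) ^+ n ^+ 2.
    by rewrite -!exprM mulSn exprD.
  by rewrite mulrA mulfVK// mulrC.
rewrite ler_wpM2r ?sqr_ge0//.
have h : cabs (P x%:C) ^+ n <= cabs (E x%:C) ^+ n.
  by apply: lerXn2r PE; rewrite nnegrE cabs_ge0.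
by apply: lerXn2r h; rewrite nnegrE exprn_ge0// cabs_ge0.
Qed.

Lemma entire_test P n : entire P -> entire (test_function P n).
Proof. by move=> eP; exact: (entireM (@entireX R P n eP) eG). Qed.

Lemma test_norm_le P n (rho k : R) : entire P ->
  (forall x : R, cabs (P x%:C) <= cabs (E x%:C)) ->
  0 < rho -> 1 <= k ->
  (forall x, `|x - t| <= rho -> sin_phase E x * rho <= k * `|x - t|) ->
  phase_speed E t * rho <= k ->
  (dB_norm2 (fpow E n.+1) (test_function P n) <= (2 * k ^+ 2 * (pi / rho))%:E)%E.
Proof.
move=> eP PE r0 k1 hs he; have eT := @entire_test P n eP.
apply: (@integral_le_lorentz R _ t) => //.
- have cd := continuous_dB_density eT (@eEn n.+1) (@En0 n.+1); exact: cd.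
- by move=> x; rewrite divr_ge0// sqr_ge0.
- by rewrite mulr_ge0// sqr_ge0.
- by move=> x; apply: le_trans (test_density_le n (PE x)) _; exact: slope_density_le.
Qed.

(** A scale independent of t: |sin phi| has Lipschitz constant 2 M and phi'(t) <= M; the added 1
    keeps the inverse meaningful for M = 0. It gives the finite norm of the test functions, and the
    bound U when A has a zero near t. *)
Lemma test_sin_phase_bound : let rho := (2 * M + 1)^-1 in
  (forall x, `|x - t| <= rho -> sin_phase E x * rho <= 1 * `|x - t|) /\
  phase_speed E t * rho <= 1.
Proof.
have M0 := HB_bound_ge0 ME.
have m0 : 0 < 2 * M + 1 by lra.
split.
  move=> x _; rewrite ler_pdivrMr// mul1r.
  have := sin_phase_lipschitz HB ME t x.
  have -> : sin_phase E t = 0 by rewrite /sin_phase -/B Bt cabs0 mul0r.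
  rewrite subr0 (ger0_norm (sin_phase_ge0 E x)) => h.
  by have := normr_ge0 (x - t); lra.
rewrite ler_pdivrMr// mul1r /phase_speed.
have := HB_derive_bound_real HB ME t; rewrite -ler_pdivrMr ?cabs_gt0// -cabsV -cabsM => h.
have := Im_cabs (derive1 E t%:C / E t%:C); rewrite ler_norml => /andP[h1 _].
by lra.
Qed.

(** In the upper half-plane the quotient by E^(n+1) is (P/E)^n (B/E) / (z - t), a function bounded
    by 1 over a simple pole. As [sharp G = G], passing to [sharp] only replaces [P] by [sharp P],
    whence the last hypothesis. *)
Lemma test_mem P n : entire P ->
  (forall x : R, cabs (P x%:C) <= cabs (E x%:C)) ->
  (forall z, upper_half_plane z -> cabs (P z) <= cabs (E z)) ->
  (forall z, upper_half_plane z -> cabs (sharp P z) <= cabs (E z)) ->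
  dB_space (fpow E n.+1) (test_function P n).
Proof.
move=> eP PR PU PsU.
have E0u z : upper_half_plane z -> E z != 0 by exact: HB_neq0_upper.
have pole Q : entire Q -> (forall z, upper_half_plane z -> cabs (Q z) <= cabs (E z)) ->
    bounded_type_nonpos_mean_type (fun z => (Q z ^+ n * G z) / fpow E n.+1 z).
  move=> eQ QE.
  apply: (@bounded_type_simple_pole R _ (fun z => Q z ^+ n * B z / fpow E n.+1 z) t).
  - move=> z zu; apply: derivableM.
      have e2 := entireM (@entireX R Q n eQ) eB.
      exact: e2.
    by apply: derivableV; [rewrite /fpow expf_neq0// E0u|exact: eEn].
  - move=> z zu; have ez : 0 < cabs (E z) by rewrite cabs_gt0 E0u.
    rewrite cabsM cabsV /fpow cabsM !cabsX ler_pdivrMr ?exprn_gt0// mul1r exprSr.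
    apply: ler_pM; rewrite ?exprn_ge0 ?cabs_ge0//.
      by rewrite lerXn2r ?nnegrE ?cabs_ge0// QE.
    by apply: companionB_le; apply: sharp_upper_cabs.
  - move=> z zu; rewrite slope_zero.
      move: (z - t%:C) (fpow E n.+1 z) (B z) (Q z ^+ n) => a b c d.
      by rewrite mulrA mulrAC.
    by rewrite -subr_eq0 upper_sub_neq0.
have eT := @entire_test P n eP.
split => //.
- have [h1 h2] := test_sin_phase_bound.
  have r0 : 0 < (2 * M + 1)^-1 by have := HB_bound_ge0 ME; rewrite invr_gt0; lra.
  by apply: le_lt_trans (test_norm_le n eP PR r0 (lexx 1) h1 h2) _; rewrite ltey.
- exact: pole.
- have := pole (sharp P) (entire_sharp eP) PsU.
  congr (bounded_type_nonpos_mean_type _); apply/funext => z; congr (_ / _).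
  rewrite /test_function /sharp; apply: esym; apply: etrans (conjCM _ _) _.
  by congr (_ * _); [exact: rmorphXn|exact: sharp_slope].
Qed.

Lemma test_mem_B n : dB_space (fpow E n.+1) (test_function B n).
Proof.
apply: test_mem => //.
- by move=> x; exact: companionB_le_real.
- by move=> z zu; apply: companionB_le; exact: sharp_upper_cabs.
- by move=> z zu; rewrite sharp_companionB; apply: companionB_le; exact: sharp_upper_cabs.
Qed.

Lemma test_mem_E n : dB_space (fpow E n.+1) (test_function E n).
Proof. by apply: test_mem => // z zu; exact: sharp_upper_cabs. Qed.

Lemma test_B_density n (x : R) : x != t ->
  cabs (test_function B n x%:C) ^+ 2 / cabs (fpow E n.+1 x%:C) ^+ 2 =
  sin_phase E x ^+ (n.+1 * 2) / (x - t) ^+ 2.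
Proof.
move=> xt; have xt' : x%:C != t%:C :> C by rewrite (inj_eq (@complexI R)).
rewrite /test_function /fpow slope_zero// /sin_phase -/B.
move: (B x%:C) (E x%:C) => b e.
rewrite !cabsM !cabsX cabsV -rmorphB cabs_real mulrA -exprSr exprMn exprVn.
by rewrite real_normK ?num_real// !exprMn !exprVn !exprM mulrAC.
Qed.

Lemma test_B_derive n j (s : R) : B s%:C = 0 -> (j <= n)%N ->
  (j < n)%N || (s != t) -> derive1n j (test_function B n) s%:C = 0.
Proof.
move=> Bs jn jst; have [g [_ gE g0]] := derive1n_powM eB eG jn.
rewrite gE Bs; have [jn'|nj] := ltnP j n.
  by rewrite expr0n subn_eq0 leqNgt jn' mul0r.
have st : s%:C != t%:C :> C.
  by rewrite (inj_eq (@complexI R)); move: jst; rewrite ltnNge nj.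
by rewrite g0// slope_zero// Bs mul0r !mulr0.
Qed.

(** The derivatives of B^n supply n factors B'(t), and G(t) = B'(t) supplies the last one. *)
Lemma test_B_derive_top n :
  cabs (derive1n n (test_function B n) t%:C) =
  n`!%:R * (phase_speed E t * cabs (E t%:C)) ^+ n.+1.
Proof.
have [g [_ gE g0]] := derive1n_powM eB eG (leqnn n).
rewrite gE subnn expr0 mul1r g0// ffactnn !cabsM cabsX cabs_slope_at.
rewrite -slope_at cabs_slope_at -mulrA -exprSr; congr (_ * _).
by rewrite -(rmorph_nat (real_complex R)) cabs_real ger0_norm.
Qed.

End TestFunctions.

(** * The sampling inequality *)

Section Constants.
Variable R : realType.
Variables (C0 M : R) (n : nat).
Hypotheses (C00 : 0 < C0) (M0 : 0 <= M).

(* If A vanishes at distance at most rho >= 1 from t, [far_constant] bounds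
   (phi'(t) rho)^2 from below; if it does not, [near_constant] bounds
   (phi'(t) rho)^(2n+2) from above by a multiple of phi'(t)^(2n). *)
Definition far_constant : R := (4 * (M + 1))^-1 * 2^-1 ^+ (n.+1 * 2) /
  (8 * C0 * (2 * pi * (2 * M + 1)) * n`!%:R ^+ 2).

Definition near_constant : R :=
  128 ^+ (n.+1 * 2) * (16 * pi * C0 * n`!%:R ^+ 2).

(** [kappa <= 1] and [kappa <= far_constant / 2] give [kappa^2 < far_constant], which excludes a
    zero of A within rho. With phi'(t) rho = kappa and phi'(t)^(2n) <= phi'(t), the other bound
    reads [kappa^(2n+2) <= near_constant * phi'(t)]. *)
Definition speed_constant : R :=
  let kappa := Num.min 1 (far_constant / 2) in
  Num.min kappa (kappa ^+ (n.+1 * 2) / near_constant).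

Lemma far_constant_gt0 : 0 < far_constant.
Proof.
have p0 : 0 < pi :> R by exact: pi_gt0.
have f0 : 0 < n`!%:R ^+ 2 :> R by rewrite exprn_gt0// ltr0n fact_gt0.
have h0 : 0 < 2^-1 ^+ (n.+1 * 2) :> R by rewrite exprn_gt0.
rewrite /far_constant; move: (n`!%:R ^+ 2) (2^-1 ^+ (n.+1 * 2)) f0 h0 => f h f0 h0.
have m0 := M0; have c0 := C00.
by rewrite divr_gt0// ?mulr_gt0// ?invr_gt0; lra.
Qed.

Lemma near_constant_gt0 : 0 < near_constant.
Proof.
have p0 : 0 < pi :> R by exact: pi_gt0.
have f0 : 0 < n`!%:R ^+ 2 :> R by rewrite exprn_gt0// ltr0n fact_gt0.
have h0 : 0 < 128 ^+ (n.+1 * 2) :> R by rewrite exprn_gt0.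
rewrite /near_constant; move: (n`!%:R ^+ 2) (128 ^+ (n.+1 * 2)) f0 h0 => f h f0 h0.
by rewrite !mulr_gt0.
Qed.

Lemma speed_constant_gt0 : 0 < speed_constant.
Proof.
have k0 : 0 < Num.min 1 (far_constant / 2).
  by rewrite lt_min ltr01 divr_gt0// far_constant_gt0.
rewrite /speed_constant; move: (Num.min 1 _) k0 => k k0.
by rewrite lt_min k0 divr_gt0 ?near_constant_gt0// exprn_gt0.
Qed.

End Constants.

Section Sampling.
Variable R : realType.
Local Notation C := (Cplx R).
Variables (E : C -> C) (M : R) (n : nat) (K : C -> C -> C) (C0 : R).
Hypothesis HB : hermite_biehler E.
Hypothesis ME : forall z, upper_half_plane z -> cabs (derive1 E z / E z) <= M.
Hypothesis KE : is_reproducing_kernel (fpow E n.+1) K.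
Hypothesis C00 : 0 < C0.
Hypothesis sampling : forall F : C -> C, dB_space (fpow E n.+1) F ->
  (dB_norm2 (fpow E n.+1) F <=
   C0%:E * \esum_(s in real_zeros (companionB E))
     \sum_(j < n.+1)
       (cabs (derive1n j F s%:C) ^+ 2 / complex.Re (K s%:C s%:C))%:E)%E.
Variable t : R.
Let B := companionB E.
Let A z := (E z + sharp E z) / 2.
Hypothesis Bt : B t%:C = 0.
Let eps := phase_speed E t.

Let eE : entire E. Proof. by case: HB. Qed.
Let E0 x : E x%:C != 0. Proof. exact: (HB_neq0_real HB ME). Qed.
Let eps0 : 0 < eps. Proof. exact: (phase_speed_zero_gt0 HB ME Bt). Qed.
Let eEn : entire (fpow E n.+1). Proof. exact: entireX. Qed.
Let En0 x : fpow E n.+1 x%:C != 0. Proof. exact: expf_neq0 (E0 x). Qed.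
Let aE : 0 < cabs (E t%:C). Proof. by rewrite cabs_gt0. Qed.

Let T := test_function E t B n.

Lemma test_B_sum :
  \esum_(s in real_zeros B)
     (\sum_(j < n.+1)
       (cabs (derive1n j T s%:C) ^+ 2 / complex.Re (K s%:C s%:C))%:E)%E =
  ((n`!%:R * (eps * cabs (E t%:C)) ^+ n.+1) ^+ 2 / complex.Re (K t%:C t%:C))%:E.
Proof.
have nn s : (0 <= \sum_(j < n.+1)
    (cabs (derive1n j T s%:C) ^+ 2 / complex.Re (K s%:C s%:C))%:E)%E.
  apply: sume_ge0 => j _; rewrite lee_fin divr_ge0 ?sqr_ge0//.
  exact: (kernel_diag_ge0 KE).
rewrite (esumID [set t])//.
have -> : real_zeros B `&` [set t] = [set t].
  by apply/seteqP; split => [x []//|x -> /=]; split.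
rewrite esum_set1//.
rewrite [X in (_ + X)%E]esum1 ?adde0.
  rewrite big_ord_recr /= big1 ?add0e.
    by rewrite (test_B_derive_top HB ME Bt).
  move=> j _; rewrite (test_B_derive HB Bt Bt) ?ltn_ord// 1?ltnW//.
  by rewrite cabs0 expr0n mul0r.
move=> s [Bs /eqP st]; rewrite big1// => j _.
rewrite (test_B_derive HB Bt Bs) -1?ltnS// ?st ?orbT//.
by rewrite cabs0 expr0n mul0r.
Qed.

(** Testing the kernel with E^n G gives 4 U K(t,t) >= (phi'(t) |E(t)|^(n+1))^2, while the sum is (n!
    (phi'(t) |E(t)|)^(n+1))^2 / K(t,t); the powers of |E(t)| cancel. *)
Lemma sampling_test (U : R) : 0 < U ->
  (dB_norm2 (fpow E n.+1) (test_function E t E n) <= U%:E)%E ->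
  (dB_norm2 (fpow E n.+1) T <=
    (4 * C0 * U * n`!%:R ^+ 2 * eps ^+ (n * 2))%:E)%E.
Proof.
move=> U0 hU; apply: le_trans (sampling (test_mem_B HB ME Bt n)) _.
rewrite -/B -/T test_B_sum -EFinM lee_fin.
have := kernel_diag_lower eEn En0 KE t (test_mem_E HB ME Bt n) U0 hU.
rewrite /test_function cabsM cabsX (cabs_slope_at HB ME Bt) -/eps.
move: (complex.Re _) (cabs (E t%:C)) aE => k a a0 h.
(* The kernel is positive at [t] because E^n G does not vanish there; without this the division
   would be by 0. *)
have k0 : 0 < k.
  have : 0 < 4 * U * k by apply: lt_le_trans h; rewrite !(exprn_gt0, mulr_gt0).
  by rewrite pmulr_rgt0// mulr_gt0.
rewrite mulrA ler_pdivrMr//.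
have -> : (n`!%:R * (eps * a) ^+ n.+1) ^+ 2 =
    n`!%:R ^+ 2 * eps ^+ (n * 2) * (a ^+ n * (eps * a)) ^+ 2.
  move: (n`!%:R) => f.
  have -> : (eps * a) ^+ n.+1 = eps ^+ n * (a ^+ n * (eps * a)).
    by rewrite exprSr exprMn -mulrA.
  by rewrite exprM; ring.
have h0 : 0 <= C0 * (n`!%:R ^+ 2 * eps ^+ (n * 2)).
  by rewrite mulr_ge0 ?(ltW C00)// mulr_ge0 ?sqr_ge0// exprn_ge0 ?ltW.
rewrite (mulrA C0); apply: le_trans (ler_wpM2l h0 h) _.
by rewrite le_eqVlt; apply/orP; left; apply/eqP; ring.
Qed.

Lemma test_norm_ge (a b c : R) : a <= b -> 0 <= c ->
  (forall x, a <= x <= b -> x != t /\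
     c <= sin_phase E x ^+ (n.+1 * 2) / (x - t) ^+ 2) ->
  ((c * (b - a))%:E <= dB_norm2 (fpow E n.+1) T)%E.
Proof.
move=> ab c0 h.
have eB : entire B by exact: entire_companionB.
have eT := @entire_test R E HB t B n eB.
apply: integral_ge_itv => //.
- by have cd := continuous_dB_density eT eEn En0; exact: cd.
- by move=> x; rewrite divr_ge0// sqr_ge0.
- by move=> x /h[xt hx]; rewrite (test_B_density Bt n xt).
Qed.

Let q : R := far_constant C0 M n.

(* Where A vanishes |B / E| = 1, so the test function is not small near s. *)
Lemma zero_companionA_far (rho s : R) : (0 < n)%N -> eps <= 1 -> 1 <= rho ->
  `|s - t| <= rho -> A s%:C = 0 -> q <= (eps * rho) ^+ 2.
Proof.
move=> n0 e1 r1 st As; have M0 := HB_bound_ge0 ME.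
have [h1 h2] := test_sin_phase_bound HB ME Bt.
have m0 : 0 < (2 * M + 1)^-1 by rewrite invr_gt0; lra.
have := test_norm_le HB ME Bt n eE (fun=> lexx _) m0 (lexx 1) h1 h2.
rewrite expr1n mulr1 invrK mulrA => hU.
have U0 : 0 < 2 * pi * (2 * M + 1) :> R.
  by rewrite !mulr_gt0// ?pi_gt0//; lra.
have up := sampling_test U0 hU.
have spt : sin_phase E t = 0 by rewrite /sin_phase -/B Bt cabs0 mul0r.
have sps : sin_phase E s = 1.
  have : cabs (E s%:C) = cabs (B s%:C).
    rewrite companion_decomp -/(A _) As sub0r cabsN cabsM cabs_i mul1r.
    by [].
  by rewrite /sin_phase -/B => <-; rewrite divff// cabs_eq0.
(* With the Lipschitz constant 2 M, |sin phi| falls from 1 by at most 1/2 within distance [c0] of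
   [s]. Also [c0 <= 1/4 <= rho], so these points stay within [2 rho] of [t]. *)
set c0 : R := (4 * (M + 1))^-1.
have c0p : 0 < c0 by rewrite invr_gt0; lra.
have c1 : c0 * (4 * (M + 1)) = 1 by rewrite mulVf// gt_eqF//; lra.
have c4 : c0 <= 1 / 4 by nra.
have Mc : 2 * M * c0 <= 1 / 2 by nra.
have r0 : 0 < rho by lra.
have low : ((2^-1 ^+ (n.+1 * 2) / (2 * rho) ^+ 2 * ((s + c0) - (s - c0)))%:E <=
    dB_norm2 (fpow E n.+1) T)%E.
  apply: test_norm_ge; first lra.
    by rewrite divr_ge0 ?sqr_ge0// exprn_ge0.
  move=> x /andP[x1 x2].
  have xs : `|x - s| <= c0 by rewrite ler_norml; lra.
  have := sin_phase_lipschitz HB ME s x; rewrite sps => hl.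
  have sp : 2^-1 <= sin_phase E x.
    have : `|sin_phase E x - 1| <= 1 / 2.
      by apply: le_trans hl _; apply: le_trans (ler_wpM2l _ xs) Mc; lra.
    by rewrite ler_norml; lra.
  have xt : x != t by apply: contraTneq sp => ->; rewrite spt; lra.
  split => //.
  have xt2 : `|x - t| <= 2 * rho.
    have := ler_distD s x t; lra.
  have d0 : 0 < `|x - t| by rewrite normr_gt0 subr_eq0.
  rewrite -(real_normK (num_real (x - t))); apply: ler_pM.
  - by rewrite exprn_ge0.
  - by rewrite invr_ge0 sqr_ge0.
  - by apply: lerXn2r sp; rewrite nnegrE// sin_phase_ge0.
  - rewrite lef_pV2 ?posrE ?exprn_gt0 ?mulr_gt0//.
    by apply: lerXn2r xt2; rewrite nnegrE// mulr_ge0 ?ltW.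
have := le_trans low up; rewrite lee_fin.
(* The lower bound decays like rho^(-2), so the power of [eps] is reduced to 2 to form the product
   [eps * rho]; this uses n >= 1 and [eps <= 1]. *)
have e2 : eps ^+ (n * 2) <= eps ^+ 2.
  by rewrite ler_wiXn2l// ?(ltW eps0)// mulnC leq_pmulr.
have -> : s + c0 - (s - c0) = 2 * c0 by ring.
rewrite /q /far_constant -/c0.
set p := 2^-1 ^+ _; set U := 2 * pi * _ in U0 *.
have f0 : 0 < n`!%:R :> R by rewrite ltr0n fact_gt0.
move: (n`!%:R) f0 => f f0.
have w0 : 0 < 8 * C0 * U * f ^+ 2.
  exact: mulr_gt0 (mulr_gt0 (mulr_gt0 (ltr0n _ 8) C00) U0) (exprn_gt0 2 f0).
have w1 : 0 <= 4 * C0 * U * f ^+ 2.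
  by have := ltW w0; move: (U) => V; lra.
rewrite ler_pdivrMr// => h.
have := le_trans h (ler_wpM2l w1 e2).
have -> : p / (2 * rho) ^+ 2 * (2 * c0) = (c0 * p) / (2 * rho ^+ 2).
  by field; rewrite gt_eqF.
by rewrite ler_pdivrMr ?mulr_gt0 ?exprn_gt0// exprMn; lra.
Qed.

Let D : R := near_constant C0 n.

(* B / A is typically real on the disc of radius rho, hence |B / E| is
   comparable to phi'(t) |x - t| up to the distance rho / 2. *)
Lemma companionA_neq0_near (rho : R) : 0 < rho -> eps * rho <= 1 ->
  (forall x, `|x - t| <= rho -> A x%:C != 0) ->
  (eps * rho) ^+ (n.+1 * 2) <= D * eps ^+ (n * 2).
Proof.
move=> r0 er Ar.
have grow := companion_growth HB ME Bt r0 Ar; rewrite -/eps -/B in grow.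
have r20 : 0 < rho / 2 by rewrite divr_gt0.
have k1 : 1 <= 2 :> R by lra.
(* |sin phi| <= 4 eps |x - t| together with [eps * rho <= 1] allows the constant k = 2 at radius
   [rho / 2]; the resulting U is 16 pi / rho. *)
have hs x : `|x - t| <= rho / 2 -> sin_phase E x * (rho / 2) <= 2 * `|x - t|.
  move=> xr; have /andP[_ hB] := grow x xr.
  have hA := companionA_le_real E x.
  have a0 : 0 < cabs (E x%:C) by rewrite cabs_gt0.
  have h : sin_phase E x <= 4 * eps * `|x - t|.
    rewrite /sin_phase ler_pdivrMr//; apply: le_trans hB _.
    by rewrite ler_wpM2l// !mulr_ge0 ?(ltW eps0).
  apply: le_trans (ler_wpM2r (ltW r20) h) _.
  have := ler_wpM2r (normr_ge0 (x - t)) er; lra.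
have he : phase_speed E t * (rho / 2) <= 2 by rewrite -/eps; lra.
have := test_norm_le HB ME Bt n eE (fun=> lexx _) r20 k1 hs he.
set U := (X in (_ <= X%:E)%E) => hU.
have UE : U = 16 * pi / rho by rewrite /U; field; rewrite gt_eqF.
have U0 : 0 < U by rewrite UE !mulr_gt0 ?invr_gt0// pi_gt0.
have up := sampling_test U0 hU.
(* On [t + rho/16, t + rho/8], |B| <= 4 (1/8) |A| = |A| / 2, so |E| <= |A| + |B| <= 2 |A|; and |B|
   >= (eps rho / 64) |A|. Hence |B / E| >= eps rho / 128. *)
have low : (((eps * rho / 128) ^+ (n.+1 * 2) / (rho / 8) ^+ 2 *
      ((t + rho / 8) - (t + rho / 16)))%:E <= dB_norm2 (fpow E n.+1) T)%E.
  have er0 : 0 <= eps * rho / 128 by rewrite divr_ge0// mulr_ge0 ?ltW.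
  apply: test_norm_ge; first lra.
    by rewrite divr_ge0 ?sqr_ge0// exprn_ge0.
  move=> x /andP[x1 x2].
  have xt : 0 < x - t by lra.
  split; first by rewrite -subr_eq0 gt_eqF.
  have xr : `|x - t| <= rho / 2 by rewrite ger0_norm; lra.
  have := grow x xr; rewrite gtr0_norm// => /andP[hB1 hB2].
  have hE := HB_le_companions E x.
  have sp : eps * rho / 128 <= sin_phase E x.
    rewrite /sin_phase ler_pdivlMr ?cabs_gt0// -/B.
    have ex : eps * (x - t) <= 1 / 8.
      have := ler_wpM2l (ltW eps0) x2; have := er; lra.
    have ex2 : eps * rho / 16 <= eps * (x - t).
      have := ler_wpM2l (ltW eps0) x1; lra.
    move: hB1 hB2 hE; rewrite -/(A x%:C) -/B.
    move: (cabs_ge0 (A x%:C)) (cabs_ge0 (B x%:C)).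
    move: (cabs (A _)) (cabs (B _)) (cabs (E _)) => a b e a0 b0 hB1 hB2 hE.
    have := ler_wpM2r a0 ex; have := ler_wpM2r a0 ex2 => g1 g2.
    have ea : e <= 2 * a by lra.
    have := ler_wpM2l er0 ea; lra.
  apply: ler_pM.
  - by rewrite exprn_ge0.
  - by rewrite invr_ge0 sqr_ge0.
  - by apply: lerXn2r sp; rewrite nnegrE// sin_phase_ge0.
  - rewrite lef_pV2 ?posrE ?exprn_gt0 ?divr_gt0//.
    have xr8 : x - t <= rho / 8 by lra.
    by apply: lerXn2r xr8; rewrite nnegrE ltW// divr_gt0.
have := le_trans low up; rewrite lee_fin UE /D /near_constant exprMn exprVn.
set m := 128 ^+ _; set w := (eps * rho) ^+ _.
have m0 : 0 < m by rewrite exprn_gt0.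
move: (n`!%:R) (eps ^+ (n * 2)) => f u.
have -> : w * m^-1 / (rho / 8) ^+ 2 * (t + rho / 8 - (t + rho / 16)) =
    4 * w / (m * rho) by field; rewrite !gt_eqF.
have -> : 4 * C0 * (16 * pi / rho) * f ^+ 2 * u =
    4 * (m * (16 * pi * C0 * f ^+ 2) * u) / (m * rho) by field; rewrite !gt_eqF.
have mr : 0 < (m * rho)^-1 by rewrite invr_gt0 mulr_gt0.
by rewrite (ler_pM2r mr) (ler_pM2l (ltr0n R 4)).
Qed.

Lemma sampling_phase_speed : (0 < n)%N ->
  speed_constant C0 M n <= eps.
Proof.
move=> n0; have M0 := HB_bound_ge0 ME.
have q0 : 0 < q by exact: far_constant_gt0.
have D0 : 0 < D by exact: near_constant_gt0.
rewrite /speed_constant -/q -/D; set kappa := Num.min 1 (q / 2).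
have k0 : 0 < kappa by rewrite lt_min ltr01 divr_gt0.
have k1 : kappa <= 1 by rewrite ge_min lexx.
have kq : kappa <= q / 2 by rewrite ge_min lexx orbT.
rewrite ge_min; case: (lerP kappa eps) => //= ek.
have e1 : eps <= 1 by exact: le_trans (ltW ek) k1.
(* [rho >= 1] because [eps < kappa] in this branch. A zero of A within [rho] would force
   [q <= kappa^2 <= kappa <= q / 2]. *)
pose rho := kappa / eps.
have er : eps * rho = kappa by rewrite /rho mulrC divfK// gt_eqF.
have r0 : 0 < rho by rewrite divr_gt0.
have r1 : 1 <= rho by rewrite /rho ler_pdivlMr// mul1r ltW.
have Ar x : `|x - t| <= rho -> A x%:C != 0.
  move=> xt; apply/eqP => Ax.
  have := zero_companionA_far n0 e1 r1 xt Ax; rewrite er expr2.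
  have := ler_wpM2l (ltW k0) k1; lra.
have := companionA_neq0_near r0 _ Ar; rewrite er => /(_ k1) h.
rewrite ler_pdivrMr// mulrC; apply: le_trans h _.
rewrite ler_wpM2l ?(ltW D0)//.
(* n >= 1 and [eps <= 1] give [eps^(2n) <= eps], which makes the bound linear in [eps]. *)
by rewrite -{2}[eps]expr1 ler_wiXn2l// ?(ltW eps0)// muln_gt0 n0.
Qed.

End Sampling.

(* K is the reproducing kernel K_nu of H(E^nu); its diagonal values K t t are
   real, hence the use of complex.Re.  Both sides of the inequality are
   extended reals. *)
Theorem theorem3 (R : realType) (E : Cplx R -> Cplx R) (nu : nat)
    (K : Cplx R -> Cplx R -> Cplx R) (phi : Cplx R -> Cplx R) :
  hermite_biehler E ->
  Hinfty (fun z => derive1 E z / E z) ->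
  (2 <= nu)%N ->
  is_reproducing_kernel (fpow E nu) K ->
  is_phase E phi ->
  (exists2 C : R, 0 < C &
     forall F : Cplx R -> Cplx R, dB_space (fpow E nu) F ->
       (dB_norm2 (fpow E nu) F <=
        C%:E * \esum_(t in real_zeros (companionB E))
                 \sum_(j < nu)
                   (cabs (derive1n j F t%:C) ^+ 2 / complex.Re (K t%:C t%:C))%:E)%E) ->
  exists2 delta : R, 0 < delta &
    forall t : R, real_zeros (companionB E) t -> delta%:C <= derive1 phi t%:C.
Proof.
move=> HB [_ [M ME]]; case: nu => // n n0 KE hphi [C0 C00 sampling].
have M0 := HB_bound_ge0 ME.
exists (speed_constant C0 M n); first exact: speed_constant_gt0.
(* The order of [R[i]] compares only numbers with equal imaginary parts, so phi'(t) is first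
   replaced by the real number [phase_speed E t]. *)
move=> t Bt; rewrite (phase_derive HB ME Bt hphi) lecR.
exact: (sampling_phase_speed HB ME KE C00 sampling Bt n0).
Qed.
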